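(* Assume $\{\log g_\omega=:\phi_\omega\}$ is a strongly contracting potential (with $n_*=1$) for the random (open or closed) map $\{(T_\omega,H_\omega)\}$. Let $q_\omega$, $\nu_\omega$, $\lambda^\pm_\omega$ be the equivariant densities, conformal measures and multipliers defined in the context. Then $\int\log\lambda^+_\omega\,dm=\int\log\lambda^-_\omega\,dm=:\Lambda_1$. Define the probability measures $\mu_\omega$ by $\int f\,d\mu_\omega:=\frac{\int f q_\omega\,d\nu_\omega}{\nu_\omega(q_\omega)}$. Then $$\int f\,d\mu_{\sigma\omega}=\int f\circ T_\omega\,d\mu_\omega .$$ Furthermore, there exist a tempered $C_\omega>0$ and $0<r<1$ such that for every $n\in\mathbb N$, every $f\in L^1(\nu_\omega)$, $\tilde f\in L^1(\nu_{\sigma^n\omega})$ and $h\in BV$, $$\big|\mu_{\sigma^{-n}\omega}(f\circ T^{(n)}_{\sigma^{-n}\omega}\cdot h)-\mu_\omega(f)\,\mu_{\sigma^{-n}\omega}(h)\big|\le C_\omega\|f\|_{L^1(\nu_\omega)}\|h\|_{BV}\,r^n,$$ $$\big|\mu_{\omega}(\tilde f\circ T^{(n)}_{\omega}\cdot h)-\mu_{\sigma^n\omega}(\tilde f)\,\mu_{\omega}(h)\big|\le C_\omega\|\tilde f\|_{L^1(\nu_{\sigma^n\omega})}\|h\|_{BV}\,r^n.$$ In fact, the two inequalities hold (with some tempered $C_\omega$ depending on $r$) for any choice of $r>\vartheta$, where $\vartheta\in(0,1)$ is the contraction rate of the projective metrics described in the context.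
   Context: Functions. $I\subset\mathbb R$ is a compact interval. $\operatorname{Einf}_Z(f)$, $\operatorname{Esup}_Z(f)$ are the essential infimum/supremum of $f$ on $Z\subset I$ with respect to Lebesgue measure; $\operatorname{Einf}=\operatorname{Einf}_I$, $\operatorname{Einf}_\emptyset(f)=0$; $\|f\|_\infty=\operatorname{Esup}|f|$. $\operatorname{var}(f)$ is the total variation on $I$. $BV$ is the Banach space of (Lebesgue classes of) functions of bounded variation on $I$, represented by representatives of minimal variation, with norm $\|f\|_{BV}=\operatorname{var}(f)+\|f\|_\infty$. For $a>0$, $\mathcal C_a=\{f\in BV: f>0,\ \operatorname{var}(f)\le a\operatorname{Einf}(f)\}$. Random maps. $T_1,T_2,\dots:I\to I$ is a countable collection of maps, each admitting a finite partition of $I$ (mod Lebesgue) on whose atoms it is monotonic and continuous. $H_1,H_2,\dots\subset I$ (''holes'') are (possibly empty) finite unions of intervals, and $X_j:=I\setminus H_j$; for every $j$ at least one full branch of $T_j$ is completely contained in $X_j$. $g_1,g_2,\dots:I\to\mathbb R^+$ are weights of bounded variation. $(\Omega,m)$ is a complete probability space, $\sigma:(\Omega,m)\to(\Omega,m)$ is ergodic, invertible and probability preserving. $\Omega=\bigcup_j\Omega_j$ is an at most countable measurable partition, and for $\omega\in\Omega_j$ set $T_\omega=T_j$, $H_\omega=H_j$, $X_\omega=X_j$, $g_\omega=g_j$. $\{(T_\omega,H_\omega)\}$ is called a random open map, and $\{T_\omega\}$ (the case of empty holes) a random closed map. Write $T_\omega^{(n)}=T_{\sigma^{n-1}\omega}\circ\cdots\circ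 T_\omega$, $T^{(0)}_\omega=\mathrm{Id}$. Partitions. $\mathring{\mathcal Z}_\omega$ is the coarsest partition of $X_\omega$ into intervals each contained in an element of the monotonicity partition of $T_\omega$. An element $Z\in\mathring{\mathcal Z}_\omega$ is full if $T_\omega(Z)=I$, non-full otherwise. $b_{\omega,f}$ is the number of full elements. Non-full elements $Z_1,\dots,Z_k$ are contiguous if the convex hull of their union contains no full element; $\xi^{(1)}_\omega$ is the largest number of contiguous non-full elements. Transfer operator. $\mathcal L_\omega f=\sum_{Z\in\mathring{\mathcal Z}_\omega}\mathbf 1_{T_\omega(Z)}\,\big((fg_\omega)\circ (T_\omega|_Z)^{-1}\big)$ for $f\in BV$, and $\mathcal L^{(n)}_\omega=\mathcal L_{\sigma^{n-1}\omega}\circ\cdots\circ\mathcal L_\omega$. Strongly contracting potential (with $n_*=1$). Let $$e_\omega=\Big(3+3\frac{\operatorname{var}(g_\omega)}{\|g_\omega\|_\infty}\Big)(1+2\xi^{(1)}_\omega)\frac{\|g_\omega\|_\infty}{\operatorname{Einf}_{X_\omega}(g_\omega)},\qquad c_{\omega,1}=e_\omega/b_{\omega,f},\qquad d_{\omega,1}=e_\omega .$$ $\{\log g_\omega\}$ is strongly contracting with $n_*=1$ if $\log\#\mathring{\mathcal Z}_\omega$, $\log\|g_\omega\|_\infty$, $\log\operatorname{Einf}(g_\omega)$, $\frac{\operatorname{var}(g_\omega)}{\|g_\omega\|_\infty}\in L^1(m)$ and $\int\log c_{\omega,1}\,dm<0$. Tempered. $a:\Omega\to\mathbb R$ is tempered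 if $\lim_{|n|\to\infty}\frac1n\log|a(\sigma^n\omega)|=0$ for $m$-a.e. $\omega$. Densities, measures, multipliers (defined for $m$-a.e. $\omega$). $q_\omega=\lim_{n\to\infty}\frac{\mathcal L^{(n)}_{\sigma^{-n}\omega}1}{\operatorname{Einf}(\mathcal L^{(n)}_{\sigma^{-n}\omega}1)}$ (limit in $L^\infty$), which is in $BV$ and satisfies $\mathcal L_\omega q_\omega=\lambda^-_\omega q_{\sigma\omega}$ with $\lambda^-_\omega=\operatorname{Einf}(\mathcal L_\omega q_\omega)$. $\nu_\omega$ is the non-atomic probability measure on $I$ whose values on $f\in\mathcal C_1$ are $\nu_\omega(f)=\lim_{n\to\infty}\frac{\operatorname{Einf}(\mathcal L^{(n)}_{\omega}f)}{\operatorname{Einf}(\mathcal L^{(n)}_{\omega}1)}$ (extended to $BV$ by linearity), and it satisfies $\nu_{\sigma\omega}(\mathcal L_\omega f)=\lambda^+_\omega\nu_\omega(f)$ with $\lambda^+_\omega=\nu_{\sigma\omega}(\mathcal L_\omega1)$. The rate $\vartheta$. Fix $0<\gamma<1$ with $\int\log c_{\omega,1}\,dm<\log\gamma<0$ and set $a_\omega=\sum_{j=0}^\infty\gamma^{-j-1}d_{\sigma^{-j-1}\omega,1}\prod_{k=1}^jc_{\sigma^{-k}\omega,1}$ (empty product $=1$), which is $m$-a.s. finite. Let $f\preceq_\omega h$ mean $h-f\in\mathcal C_{a_\omega}\cup\{0\}$, and let $\Theta_\omega(f,h)=\log\frac{\rho_\omega(f,h)}{\tau_\omega(f,h)}$ on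 $\mathcal C_{a_\omega}$, where $\tau_\omega(f,h)=\sup\{\lambda>0:\lambda f\preceq_\omega h\}$, $\rho_\omega(f,h)=\inf\{\mu>0: h\preceq_\omega\mu f\}$ (the value is $\infty$ if the numerator is $\infty$ or the denominator is $0$). The number $\vartheta\in(0,1)$ is such that for every $k\ge0$ and $m$-a.e. $\omega$, $\Theta_\omega(\mathcal L^{(l)}_{\sigma^{-l}\omega}f,\mathcal L^{(l+k)}_{\sigma^{-(l+k)}\omega}h)\le\vartheta^l\,\Theta_{\sigma^{-l}\omega}(f,\mathcal L^{(k)}_{\sigma^{-(l+k)}\omega}h)$ for every sufficiently large $l$ (depending on $\omega$), every $f\in\mathcal C_{a_{\sigma^{-l}\omega}}$ and $h\in\mathcal C_{a_{\sigma^{-(l+k)}\omega}}$; such $\vartheta$ exists. *)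

(* Defs.v *)
From HB Require Import structures.
From mathcomp Require Import all_boot all_order all_algebra.
From mathcomp Require Import finmap.
From mathcomp Require Import all_classical all_reals all_analysis.
Set Implicit Arguments.
Unset Strict Implicit.
Unset Printing Implicit Defensive.
Import Order.TTheory GRing.Theory Num.Theory.
Import numFieldNormedType.Exports.
Local Open Scope classical_set_scope.
Local Open Scope ring_scope.

(* Functions on [a, b] are total functions [R -> R] whose values outside
[a, b] are never used. An element of BV is a Lebesgue class; it is handled
through any pointwise representative of bounded variation. Off a countable set
such a representative agrees with every representative of minimal variation,
so neither the transfer operator (up to countable sets) nor a non-atomic
measure depends on the choice. *)

Definition Icc (R : realType) (a b : R) : set R := `[a, b]%classic.

Definition ae_on (R : realType) (Z : set R) (P : R -> Prop) : Prop :=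
  {ae @lebesgue_measure R, forall x, Z x -> P x}.

(* [ess_inf] relative to Z. If Z is Lebesgue null, the supremum is [+oo] and
   [fine] returns 0; this covers the convention Einf over the empty set = 0.
   [Einf] and [Esup] are only used on functions of bounded variation, for which
   the essential bounds over a non-null Z are finite. *)
Definition Einf (R : realType) (Z : set R) (f : R -> R) : R :=
  fine (ereal_sup [set y : \bar R | ae_on Z (fun x => (y <= (f x)%:E)%E)]).

Definition Esup (R : realType) (Z : set R) (f : R -> R) : R :=
  fine (ereal_inf [set y : \bar R | ae_on Z (fun x => ((f x)%:E <= y)%E)]).

Definition norm_oo (R : realType) (a b : R) (f : R -> R) : R :=
  Esup (Icc a b) (fun x => `|f x|).

Definition inBV (R : realType) (a b : R) (f : R -> R) : Prop :=
  bounded_variation a b f.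

(* Variation of the Lebesgue class of f: the least total variation of a
   representative. *)
Definition var (R : realType) (a b : R) (f : R -> R) : R :=
  fine (ereal_inf [set total_variation a b h |
                     h in [set h | ae_on (Icc a b) (fun x => h x = f x)]]).

Definition norm_BV (R : realType) (a b : R) (f : R -> R) : R :=
  var a b f + norm_oo a b f.

Definition cone (R : realType) (a b c : R) (f : R -> R) : Prop :=
  [/\ inBV a b f, ae_on (Icc a b) (fun x => 0 < f x)
    & var a b f <= c * Einf (Icc a b) f].

Definition cone_le (R : realType) (a b c : R) (f h : R -> R) : Prop :=
  cone a b c (fun x => h x - f x) \/ ae_on (Icc a b) (fun x => h x - f x = 0).

Definition cone_tau (R : realType) (a b c : R) (f h : R -> R) : \bar R :=
  ereal_sup [set l%:E | l in [set l : R |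
    0 < l /\ cone_le a b c (fun x => l * f x) h]].

Definition cone_rho (R : realType) (a b c : R) (f h : R -> R) : \bar R :=
  ereal_inf [set l%:E | l in [set l : R |
    0 < l /\ cone_le a b c h (fun x => l * f x)]].

(* The supremum of an empty set of positive reals is meant to be 0, whereas
   [ereal_sup set0 = -oo]: hence the test [<= 0] on [cone_tau]. *)
Definition Theta (R : realType) (a b c : R) (f h : R -> R) : \bar R :=
  let rho := cone_rho a b c f h in
  let tau := cone_tau a b c f h in
  if (rho == +oo)%E || (tau <= 0)%E then +oo%E
  else lne (fine rho / fine tau)%:E.

(* A partition modulo Lebesgue; degenerate intervals (points) are not admitted
   as elements. *)
Definition interval_partition (R : realType) (X : set R) (Q : set (set R)) :
    Prop :=
  [/\ forall Z, Q Z ->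
        [/\ is_interval Z, (0 < @lebesgue_measure R Z)%E & Z `<=` X],
      trivIset Q id
    & @lebesgue_measure R (X `\` \bigcup_(Z in Q) Z) = 0%E].

Definition refines (T : Type) (Q P : set (set T)) : Prop :=
  forall Z, Q Z -> exists2 A, P A & Z `<=` A.

Definition coarsest_refinement (R : realType) (X : set R)
    (P Q : set (set R)) : Prop :=
  [/\ interval_partition X Q, refines Q P
    & forall Q', interval_partition X Q' -> refines Q' P -> refines Q' Q].

Definition monotone_continuous_on (R : realType) (A : set R) (T : R -> R) :
    Prop :=
  {within A, continuous T} /\
  ((forall x y, A x -> A y -> x < y -> T x < T y) \/
   (forall x y, A x -> A y -> x < y -> T y < T x)).

Definition finite_union_of_intervals (R : realType) (H : set R) : Prop :=
  exists2 D : set (set R), finite_set D & (forall J, D J -> is_interval J) /\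
    H = \bigcup_(J in D) J.

(* [partT j] is the monotonicity partition of [mapT j] and [partX j] the
   coarsest partition of the complement X_j of [hole j] into intervals each
   contained in an element of [partT j].
   [label w] is the j with w in Omega_j. *)
Record system (R : realType) (Om : Type) := System {
  lo : R;
  hi : R;
  mapT : nat -> R -> R;
  partT : nat -> set (set R);
  hole : nat -> set R;
  partX : nat -> set (set R);
  weight : nat -> R -> R;
  sigma : Om -> Om;
  sigmaV : Om -> Om;
  label : Om -> nat }.

Section System_notions.
Context (R : realType) (Om : Type) (S : system R Om).

Definition dom : set R := Icc (lo S) (hi S).
Definition compl_hole (j : nat) : set R := dom `\` hole S j.

(* "T(Z) = I" is read modulo Lebesgue, as the partitions are. *)
Definition full (j : nat) (Z : set R) : Prop :=
  @lebesgue_measure R (dom `\` (mapT S j @` Z)) = 0%E.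

Definition T_ (w : Om) : R -> R := mapT S (label S w).
Definition g_ (w : Om) : R -> R := weight S (label S w).
Definition X_ (w : Om) : set R := compl_hole (label S w).
Definition Z_ (w : Om) : set (set R) := partX S (label S w).

Definition future (n : nat) (w : Om) : Om := iter n (sigma S) w.
Definition past (n : nat) (w : Om) : Om := iter n (sigmaV S) w.

Fixpoint Tn (n : nat) (w : Om) (x : R) : R :=
  if n is k.+1 then T_ (future k w) (Tn k w x) else x.

Definition card_Z (w : Om) : nat := #|` fset_set (Z_ w)|%N.

Definition full_elements (w : Om) : set (set R) :=
  [set Z | Z_ w Z /\ full (label S w) Z].

Definition nonfull_elements (w : Om) : set (set R) :=
  [set Z | Z_ w Z /\ ~ full (label S w) Z].

Definition b_f (w : Om) : nat := #|` fset_set (full_elements w)|%N.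

Definition contiguous (w : Om) (D : set (set R)) : Prop :=
  D `<=` nonfull_elements w /\
  forall Z, full_elements w Z -> ~ Z `<=` [set` Rhull (\bigcup_(Y in D) Y)].

Definition xi1 (w : Om) : R :=
  sup [set (#|` fset_set D|%N)%:R | D in [set D | contiguous w D]].

Definition transfer (w : Om) (f : R -> R) (y : R) : R :=
  \sum_(Z \in Z_ w)
    \1_(T_ w @` Z) y * (f \* g_ w) ('pinv_(fun=> 0) Z (T_ w) y).

Fixpoint transfer_n (n : nat) (w : Om) (f : R -> R) : R -> R :=
  if n is k.+1 then transfer (future k w) (transfer_n k w f) else f.

Definition e_ (w : Om) : R :=
  (3 + 3 * (var (lo S) (hi S) (g_ w) / norm_oo (lo S) (hi S) (g_ w)))
  * (1 + 2 * xi1 w)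
  * (norm_oo (lo S) (hi S) (g_ w) / Einf (X_ w) (g_ w)).

Definition c_1 (w : Om) : R := e_ w / (b_f w)%:R.
Definition d_1 (w : Om) : R := e_ w.

Definition a_ (gamma : R) (w : Om) : R :=
  fine (\sum_(0 <= j <oo)
    (gamma ^- j.+1 * d_1 (past j.+1 w)
     * \prod_(1 <= k < j.+1) c_1 (past k w))%:E)%E.

Definition cone_a (gamma : R) (w : Om) : (R -> R) -> Prop :=
  cone (lo S) (hi S) (a_ gamma w).

Definition Theta_ (gamma : R) (w : Om) (f h : R -> R) : \bar R :=
  Theta (lo S) (hi S) (a_ gamma w) f h.

Definition lam_minus (q : Om -> R -> R) (w : Om) : R :=
  Einf dom (transfer w (q w)).

Definition lam_plus (nu : Om -> probability (measurableTypeR R) R) (w : Om) :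
    R :=
  (\int[nu (sigma S w)]_(x in dom) transfer w (cst 1) x)%R.

End System_notions.

Section Random_open_maps.
Context (R : realType) (d : measure_display) (Om : measurableType d)
  (m : probability Om R) (S : system R Om).

Definition ergodic_invertible (sigma sigmai : Om -> Om) : Prop :=
  [/\ cancel sigma sigmai /\ cancel sigmai sigma,
      measurable_fun setT sigma /\ measurable_fun setT sigmai,
      forall A, measurable A -> m (sigma @^-1` A) = m A
    & forall A, measurable A -> sigma @^-1` A = A -> m A = 0%E \/ m A = 1%E].

(* A random closed map is the case [hole S j = set0] for all j. A finite
   collection of maps is covered by letting some [label] fibres be empty. *)
Record random_open_map : Prop := RandomOpenMap {
  rom_I : lo S < hi S;
  rom_map : forall j x, dom S x -> dom S (mapT S j x);
  rom_partT : forall j,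
    finite_set (partT S j) /\ interval_partition (dom S) (partT S j);
  rom_mono : forall j A, partT S j A -> monotone_continuous_on A (mapT S j);
  rom_hole : forall j,
    hole S j `<=` dom S /\ finite_union_of_intervals (hole S j);
  rom_partX : forall j,
    coarsest_refinement (compl_hole S j) (partT S j) (partX S j);
  rom_full : forall j, exists A,
    [/\ partT S j A, full S j A & A `<=` compl_hole S j];
  rom_weight : forall j,
    inBV (lo S) (hi S) (weight S j) /\ (forall x, dom S x -> 0 < weight S j x);
  rom_complete : measure_is_complete m;
  rom_ergodic : ergodic_invertible (sigma S) (sigmaV S);
  rom_index : forall j, measurable (label S @^-1` [set j]) }.

(* [lne] is the extended logarithm (-oo on nonpositive numbers), so that
   integrability of log Einf forces Einf > 0 almost everywhere. *)
Definition strongly_contracting : Prop :=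
  [/\ m.-integrable setT (fun w => lne (card_Z S w)%:R%:E),
      m.-integrable setT (fun w => lne (norm_oo (lo S) (hi S) (g_ S w))%:E),
      m.-integrable setT (fun w => lne (Einf (dom S) (g_ S w))%:E),
      m.-integrable setT (fun w =>
        (var (lo S) (hi S) (g_ S w) / norm_oo (lo S) (hi S) (g_ S w))%:E)
    & (\int[m]_w lne (c_1 S w)%:E < 0)%E].

Definition tempered (C : Om -> R) : Prop :=
  {ae m, forall w,
    ((n%:R^-1)%:E * lne `|C (future S n w)|%:E @[n --> \oo] --> 0)%E /\
    ((n%:R^-1)%:E * lne `|C (past S n w)|%:E @[n --> \oo] --> 0)%E}.

Definition equivariant_density (q : Om -> R -> R) : Prop :=
  {ae m, forall w,
    [/\ inBV (lo S) (hi S) (q w),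
        norm_oo (lo S) (hi S) (fun x =>
          transfer_n S n (past S n w) (cst 1) x
            / Einf (dom S) (transfer_n S n (past S n w) (cst 1))
          - q w x) @[n --> \oo] --> 0
      & ae_on (dom S) (fun x =>
          transfer S w (q w) x = lam_minus S q w * q (sigma S w) x)]}.

Definition conformal_measure (nu : Om -> probability (measurableTypeR R) R) :
    Prop :=
  {ae m, forall w,
    [/\ nu w (dom S) = 1%E, forall x, nu w [set x] = 0%E,
        forall f, cone (lo S) (hi S) 1 f ->
          Einf (dom S) (transfer_n S n w f)
            / Einf (dom S) (transfer_n S n w (cst 1)) @[n --> \oo]
          --> (\int[nu w]_(x in dom S) f x)%R
      & forall f, inBV (lo S) (hi S) f ->
          (\int[nu (sigma S w)]_(x in dom S) transfer S w f x)%R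
          = lam_plus S nu w * (\int[nu w]_(x in dom S) f x)%R]}.

Definition contraction_rate (gamma theta : R) : Prop :=
  [/\ 0 < gamma < 1, (\int[m]_w lne (c_1 S w)%:E < lne gamma%:E)%E,
      0 < theta < 1
    & forall k : nat, {ae m, forall w, exists l0 : nat,
        forall l : nat, (l0 <= l)%N -> forall f h : R -> R,
        cone_a S gamma (past S l w) f ->
        cone_a S gamma (past S (l + k) w) h ->
        (Theta_ S gamma w
           (transfer_n S l (past S l w) f)
           (transfer_n S (l + k) (past S (l + k) w) h)
         <= (theta ^+ l)%:E
            * Theta_ S gamma (past S l w)
                f (transfer_n S k (past S (l + k) w) h))%E}].

Definition equilibrium_measure (q : Om -> R -> R)
    (nu mu : Om -> probability (measurableTypeR R) R) : Prop :=
  {ae m, forall w, forall f : R -> R,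
    (nu w).-integrable (dom S) (EFin \o f) ->
    (\int[mu w]_(x in dom S) (f x)%:E
     = (\int[nu w]_(x in dom S) (f x * q w x)%:E)
       * ((\int[nu w]_(x in dom S) q w x)%R^-1)%:E)%E}.

Definition equivariant_measure
    (mu : Om -> probability (measurableTypeR R) R) : Prop :=
  {ae m, forall w, forall f : R -> R,
    (mu (sigma S w)).-integrable (dom S) (EFin \o f) ->
    (\int[mu (sigma S w)]_(x in dom S) (f x)%:E
     = \int[mu w]_(x in dom S) (f (T_ S w x))%:E)%E}.

(* Integrals are extended-real valued, so the bounds also say that the
   correlations are finite. *)
Definition correlation_decay
    (nu mu : Om -> probability (measurableTypeR R) R) (C : Om -> R) (r : R) :
    Prop :=
  {ae m, forall w, forall (n : nat) (h : R -> R), inBV (lo S) (hi S) h ->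
    (forall f : R -> R, (nu w).-integrable (dom S) (EFin \o f) ->
      let w' := past S n w in
      (`| \int[mu w']_(x in dom S) (f (Tn S n w' x) * h x)%:E
          - (\int[mu w]_(x in dom S) (f x)%:E)
            * (\int[mu w']_(x in dom S) (h x)%:E) |
       <= (C w)%:E * (\int[nu w]_(x in dom S) `|f x|%:E)
          * (norm_BV (lo S) (hi S) h)%:E * (r ^+ n)%:E)%E) /\
    (forall f : R -> R, (nu (future S n w)).-integrable (dom S) (EFin \o f) ->
      let w' := future S n w in
      (`| \int[mu w]_(x in dom S) (f (Tn S n w x) * h x)%:E
          - (\int[mu w']_(x in dom S) (f x)%:E)
            * (\int[mu w]_(x in dom S) (h x)%:E) |
       <= (C w)%:E * (\int[nu w']_(x in dom S) `|f x|%:E)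
          * (norm_BV (lo S) (hi S) h)%:E * (r ^+ n)%:E)%E)}.

End Random_open_maps.

(* Main.v *)
From HB Require Import structures.
Require Import Defs.
From mathcomp Require Import all_boot all_order all_algebra.
From mathcomp Require Import finmap.
From mathcomp Require Import all_classical all_reals all_analysis.
From mathcomp Require Import measurable_realfun.
From mathcomp Require Import zify ring lra.

(** Write L for the transfer operator of one map.  The argument is a contraction of
cones that is not uniform in the base point, followed by ergodic averaging.

_One map._  A function of bounded variation is handled up to countable sets, through
an increasing function V that controls its increments ([ctl]).  Comparing the
branches that are not full with nearby full ones, one obtains the Lasota-Yorke
inequality [Lop_kcone]: L maps the closed cone of parameter al, given by the
inequality var f <= al Einf f, into the cone of parameter c_1 al + d_1.

_Cones._  The series [a_] solves gamma a_(sigma w) = c_1 a_w + d_1, so that the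
operator maps the cone of parameter a_w into the cone of parameter gamma a_(sigma w)
([aperture], [tr_maps]).  The latter has finite projective diameter in the cone of
parameter a_(sigma w), and Birkhoff's argument makes each step a contraction, with a
factor that depends on a_(sigma w) only ([cmp_contract]).  By Birkhoff's ergodic
theorem and the negativity of int log (c_1 / gamma), the series converges and a grows
subexponentially along the orbits ([a_partial_bound]).

_Rates._  The orbit visits with positive frequency any set of positive measure.  On a
set where a is bounded the contraction is uniform, whence a rate theta < 1, up to a
factor exp (A w) with A subexponential ([contracts_visits]).  If instead theta is a
given rate of contraction of the projective metrics, the number of steps after which
the contraction takes place is bounded on a set of positive measure, and visits to
this set give the same conclusion at the rate theta ([contracts_rate]).  For that,
measurability has to be extracted from a condition on all functions of the cones
([failure]).

_Correlations._  Conformality extends to the duality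
lam_plus nu_w((f o T) h) = nu_(sigma w)(f L h) for integrable f ([dual_step]).  For h in
BV, add to h q a constant large enough to put the sum into the cone.
After n steps, the sum is almost proportional to the density, so that the correlation is
at most exp (A) theta^n times a power of the apertures at the two ends of the orbit
segment ([corr_BV]).  All these constants are subexponential along the orbits; the
supremum of such a quantity, discounted at a small exponential rate, is tempered
([tempering]), and the discount is paid by passing from theta to r > theta ([decay]).
Invariance of the measures mu is the duality with h = q.

_Exponents._  Integrating L q = lam_minus q with respect to nu_(sigma w) shows that
log lam_minus - log lam_plus is the coboundary of log nu(q).  It is bounded below by
an integrable function, so its integral vanishes ([coboundary]).  This uses the
measurability of nu(q), which holds because q and nu are limits of quantities that
depend on finitely many labels ([E_meas]). *)

Set Implicit Arguments.
Unset Strict Implicit.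
Unset Printing Implicit Defensive.
Import Order.TTheory GRing.Theory Num.Theory.
Import numFieldNormedType.Exports.
Local Open Scope classical_set_scope.
Local Open Scope ring_scope.

(** * Functions of bounded variation up to countable sets *)

Section Control.
Context {R : realType}.
Implicit Types (f g h V W : R -> R) (A D : set R).

(** The total variation of f from a to x is such a V, and conversely the
oscillation of V on [a, b] bounds the variation of f. Unlike total variations,
controls can be restricted to the complement of a countable set, and lower
limits of controls are controls. *)
Definition ctl A f V :=
  forall x y, A x -> A y -> x <= y -> `|f y - f x| <= V y - V x.

Definition osc_le A V (M : R) := forall x y, A x -> A y -> V y - V x <= M.

Lemma ctl_mono A f V x y : ctl A f V -> A x -> A y -> x <= y -> V x <= V y.
Proof. by move=> h hx hy xy; rewrite -subr_ge0 (le_trans _ (h _ _ hx hy xy)). Qed.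

Lemma ctl_sub A D f V : A `<=` D -> ctl D f V -> ctl A f V.
Proof. by move=> s h x y /s ? /s ?; exact: h. Qed.

Lemma osc_sub A D V M : A `<=` D -> osc_le D V M -> osc_le A V M.
Proof. by move=> s h x y /s ? /s ?; exact: h. Qed.

Lemma ctl_lip A f V (phi : R -> R) : (forall x y, `|phi y - phi x| <= `|y - x|) ->
  ctl A f V -> ctl A (phi \o f) V.
Proof. by move=> L h x y hx hy xy; exact: le_trans (L _ _) (h _ _ hx hy xy). Qed.

Lemma ctlD A f g V W : ctl A f V -> ctl A g W ->
  ctl A (fun x => f x + g x) (fun x => V x + W x).
Proof.
move=> h k x y hx hy xy.
have -> : f y + g y - (f x + g x) = (f y - f x) + (g y - g x) by lra.
have -> : V y + W y - (V x + W x) = (V y - V x) + (W y - W x) by lra.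
by rewrite (le_trans (ler_normD _ _))// lerD ?h ?k.
Qed.

Lemma ctlZ A f V c : ctl A f V -> ctl A (fun x => c * f x) (fun x => `|c| * V x).
Proof.
by move=> h x y hx hy xy; rewrite -!mulrBr normrM ler_wpM2l// h.
Qed.

Lemma ctlM A f g V W (F G : R) : (forall x, A x -> `|f x| <= F) ->
  (forall x, A x -> `|g x| <= G) -> ctl A f V -> ctl A g W ->
  ctl A (fun x => f x * g x) (fun x => G * V x + F * W x).
Proof.
move=> hF hG h k x y hx hy xy.
have -> : f y * g y - f x * g x = (f y - f x) * g y + f x * (g y - g x) by lra.
rewrite (le_trans (ler_normD _ _))// !normrM.
have := h _ _ hx hy xy; have := k _ _ hx hy xy => k1 h1.
have H1 : `|f y - f x| * `|g y| <= (V y - V x) * G by rewrite ler_pM// hG.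
have H2 : `|f x| * `|g y - g x| <= F * (W y - W x) by rewrite ler_pM// hF.
lra.
Qed.

(** W t is the supremum of phi over the points of D to the left of t, where m
stands in when there are none. *)
Lemma monoext D (phi : R -> R) (m M : R) :
  (forall x y, D x -> D y -> x <= y -> phi x <= phi y) ->
  (forall x, D x -> m <= phi x <= M) -> m <= M ->
  exists W : R -> R, [/\ forall x y, x <= y -> W x <= W y,
    forall x, D x -> W x = phi x & forall x, m <= W x <= M].
Proof.
move=> hm hb mM.
pose E t := [set m] `|` [set z | exists s, [/\ D s, s <= t & z = phi s]].
have E0 t : (E t) !=set0 by exists m; left.
have Eb t : ubound (E t) M.
  by move=> z [->//|[s [Ds _ ->]]]; case/andP: (hb _ Ds).
have hE t : has_sup (E t) by split; [|exists M].
exists (fun t => sup (E t)); split.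
- move=> x y xy; apply: ge_sup => // z Ez; apply: sup_upper_bound => //.
  case: Ez => [->|[s [Ds sx ->]]]; [by left|right; exists s; split => //].
  exact: le_trans xy.
- move=> x Dx; apply/eqP; rewrite eq_le; apply/andP; split.
    apply: ge_sup => // z [->|[s [Ds sx ->]]]; last exact: hm.
    by case/andP: (hb _ Dx).
  by apply: sup_upper_bound => //; right; exists x.
- move=> x; apply/andP; split; last exact: ge_sup.
  by apply: sup_upper_bound => //; left.
Qed.

(** A function controlled on a subset only extends, with its control, to the
line: it is the difference of the two nondecreasing functions (V + f) / 2 and
(V - f) / 2, and each of these extends by suprema. *)
Lemma ctl_extend D f V M : D !=set0 -> ctl D f V -> osc_le D V M ->
  exists h W, [/\ forall x, D x -> h x = f x, ctl setT h W & osc_le setT W M].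
Proof.
move=> [x0 Dx0] cf ov.
pose p x := (V x + f x) / 2; pose n x := (V x - f x) / 2.
have pm x y : D x -> D y -> x <= y -> p x <= p y.
  by move=> dx dy xy; have := cf _ _ dx dy xy; rewrite ler_norml /p => /andP[]; lra.
have nm x y : D x -> D y -> x <= y -> n x <= n y.
  by move=> dx dy xy; have := cf _ _ dx dy xy; rewrite ler_norml /n => /andP[]; lra.
have key x y z t : D x -> D y -> D z -> D t -> (p y - p x) + (n t - n z) <= M.
  move=> dx dy dz dt.
  have H u v : D u -> D v -> exists2 w, D w & u <= w /\ v <= w.
    by move=> du dv; case: (leP u v) => uv; [exists v|exists u] => //; split=> //; exact: ltW.
  have H' u v : D u -> D v -> exists2 w, D w & w <= u /\ w <= v.
    by move=> du dv; case: (leP u v) => uv; [exists u|exists v] => //; split=> //; exact: ltW.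
  have [w dw [yw tw]] := H _ _ dy dt; have [w' dw' [xw zw]] := H' _ _ dx dz.
  have := pm _ _ dy dw yw; have := nm _ _ dt dw tw.
  have := pm _ _ dw' dx xw; have := nm _ _ dw' dz zw; have := ov _ _ dw' dw.
  rewrite /p /n; lra.
pose P := [set p x | x in D]; pose N := [set n x | x in D].
have P0 : P !=set0 by exists (p x0), x0.
have N0 : N !=set0 by exists (n x0), x0.
have Pu : has_ubound P by exists (M + p x0) => _ [x dx <-]; have := key _ _ _ _ Dx0 dx Dx0 Dx0; lra.
have Pl : has_lbound P by exists (p x0 - M) => _ [x dx <-]; have := key _ _ _ _ dx Dx0 Dx0 Dx0; lra.
have Nu : has_ubound N by exists (M + n x0) => _ [x dx <-]; have := key _ _ _ _ Dx0 Dx0 Dx0 dx; lra.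
have Nl : has_lbound N by exists (n x0 - M) => _ [x dx <-]; have := key _ _ _ _ Dx0 Dx0 dx Dx0; lra.
have sP x : D x -> inf P <= p x <= sup P.
  by move=> dx; apply/andP; split; [apply: ge_inf|apply: ub_le_sup] => //; exists x.
have sN x : D x -> inf N <= n x <= sup N.
  by move=> dx; apply/andP; split; [apply: ge_inf|apply: ub_le_sup] => //; exists x.
have tot : (sup P - inf P) + (sup N - inf N) <= M.
  have H1 y z t : D y -> D z -> D t -> p y + (n t - n z) - M <= inf P.
    move=> dy dz dt; apply: lb_le_inf => // _ [x dx <-]; have := key _ _ _ _ dx dy dz dt; lra.
  have H2 z t : D z -> D t -> sup P <= inf P + M - (n t - n z).
    move=> dz dt; apply: ge_sup => // _ [y dy <-]; have := H1 _ _ _ dy dz dt; lra.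
  have H3 t : D t -> sup P - inf P - M + n t <= inf N.
    move=> dt; apply: lb_le_inf => // _ [z dz <-]; have := H2 _ _ dz dt; lra.
  suff : sup N <= inf N - (sup P - inf P - M) by lra.
  apply: ge_sup => // _ [t dt <-]; have := H3 _ dt; lra.
have [|Wp [Wpm Wpe Wpb]] := monoext pm sP.
  by case/andP: (sP _ Dx0) => ? ?; lra.
have [|Wn [Wnm Wne Wnb]] := monoext nm sN.
  by case/andP: (sN _ Dx0) => ? ?; lra.
exists (fun x => Wp x - Wn x), (fun x => Wp x + Wn x); split.
- by move=> x dx; rewrite Wpe// Wne// /p /n; lra.
- move=> x y _ _ xy; have := Wpm _ _ xy; have := Wnm _ _ xy.
  rewrite ler_norml => ? ?; apply/andP; split; lra.
- move=> x y _ _; move: (Wpb x) (Wpb y) (Wnb x) (Wnb y).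
  move=> /andP[? ?] /andP[? ?] /andP[? ?] /andP[? ?]; lra.
Qed.

Lemma ctl_abs_le A f V M x0 : A x0 -> ctl A f V -> osc_le A V M ->
  forall x, A x -> `|f x| <= `|f x0| + M.
Proof.
move=> a0 c o x ax.
have : `|f x - f x0| <= M.
  case: (leP x0 x) => xx; first exact: le_trans (c _ _ a0 ax xx) (o _ _ a0 ax).
  by rewrite distrC; exact: le_trans (c _ _ ax a0 (ltW xx)) (o _ _ ax a0).
move=> h; have := ler_normD (f x - f x0) (f x0); rewrite subrK; lra.
Qed.

End Control.

Section BVclass.
Context {R : realType} (a b : R).
Hypothesis ab : a < b.
Implicit Types (f g h V W : R -> R) (P Q : R -> Prop).
Local Notation I := (Icc a b).
Local Notation BV := (inBV a b).

Lemma IccP x : I x <-> a <= x <= b.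
Proof. by rewrite /Icc/= in_itv. Qed.

Lemma Icca : I a. Proof. by apply/IccP; rewrite lexx ltW. Qed.
Lemma Iccb : I b. Proof. by apply/IccP; rewrite lexx ltW. Qed.
Hint Resolve Icca Iccb : core.

Lemma ctl_TV f V : ctl I f V -> (total_variation a b f <= (V b - V a)%:E)%E.
Proof.
move=> c; have lab := ltW ab.
pose p x := (V x + f x) / 2; pose n x := (V x - f x) / 2.
have pm : {in `[a, b] &, {homo p : x y / x <= y}}.
  move=> x y /= xi yi xy.
  by have := c x y xi yi xy; rewrite ler_norml /p => /andP[]; lra.
have nm : {in `[a, b] &, {homo n : x y / x <= y}}.
  move=> x y /= xi yi xy.
  by have := c x y xi yi xy; rewrite ler_norml /n => /andP[]; lra.
have -> : f = (p \+ (\- n)) by apply/funext => x /=; rewrite /p /n; lra.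
rewrite (le_trans (total_variation_le _ _ lab))// total_variationN.
rewrite !nondecreasing_total_variation// -EFinD lee_fin /p /n; lra.
Qed.

Lemma ctl_BV f V : ctl I f V -> BV f.
Proof.
move=> c; apply/bounded_variationP; first exact: ltW.
rewrite ge0_fin_numE; last exact/total_variation_ge0/ltW.
by rewrite (le_lt_trans (ctl_TV c))// ltry.
Qed.

Lemma BV_ctl f : BV f -> exists V, [/\ ctl I f V, V a = 0 &
  V b = fine (total_variation a b f)].
Proof.
move=> bv; exists (fun x => fine (total_variation a x f)); split=> //; last first.
  by rewrite total_variationxx.
move=> x y /IccP/andP[ax xb] /IccP/andP[ay yb] xy.
have fx : total_variation a x f \is a fin_num.
  exact/bounded_variationP/(bounded_variationl ax xb).
have fy : total_variation a y f \is a fin_num.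
  exact/bounded_variationP/(bounded_variationl ay yb).
rewrite -lee_fin EFinB !fineK// leeBrDl//.
by rewrite (total_variationD f ax xy) leeD2l// total_variation_ge.
Qed.

Lemma ctl_osc f V : ctl I f V -> osc_le I V (V b - V a).
Proof.
move=> c x y ix iy; move: (ix) (iy) => /IccP/andP[ax xb] /IccP/andP[ay yb].
have := ctl_mono c Icca ix ax; have := ctl_mono c iy Iccb yb; lra.
Qed.

Lemma BV_bnd f : BV f -> exists2 B, 0 < B & forall x, I x -> `|f x| <= B.
Proof.
move=> /BV_ctl[V [c _ _]]; exists (`|f a| + (V b - V a) + 1) => [|x ix].
  have := ctl_mono c Icca Iccb (ltW ab); have := normr_ge0 (f a); lra.
have := ctl_abs_le Icca c (ctl_osc c) ix; lra.
Qed.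

Lemma BV_cst c : BV (fun=> c).
Proof. by apply: (@ctl_BV _ (fun=> 0)) => x y _ _ _; rewrite !subrr normr0. Qed.

Lemma BV_add f g : BV f -> BV g -> BV (fun x => f x + g x).
Proof. by move=> /BV_ctl[V [c _ _]] /BV_ctl[W [k _ _]]; exact: ctl_BV (ctlD c k). Qed.

Lemma BV_scale c f : BV f -> BV (fun x => c * f x).
Proof. by move=> /BV_ctl[V [k _ _]]; exact: ctl_BV (ctlZ c k). Qed.

Lemma BV_opp f : BV f -> BV (fun x => - f x).
Proof.
by move=> /(BV_scale (-1)); under eq_fun do rewrite mulN1r.
Qed.

Lemma BV_sub f g : BV f -> BV g -> BV (fun x => f x - g x).
Proof. by move=> hf /BV_opp; exact: BV_add. Qed.

Lemma BV_mul f g : BV f -> BV g -> BV (fun x => f x * g x).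
Proof.
move=> hf hg; have [F _ bF] := BV_bnd hf; have [G _ bG] := BV_bnd hg.
move: hf hg => /BV_ctl[V [c _ _]] /BV_ctl[W [k _ _]].
exact: ctl_BV (ctlM bF bG c k).
Qed.

Lemma BV_lip f (phi : R -> R) : (forall x y, `|phi y - phi x| <= `|y - x|) ->
  BV f -> BV (phi \o f).
Proof. by move=> L /BV_ctl[V [c _ _]]; exact: ctl_BV (ctl_lip L c). Qed.

Lemma BV_abs f : BV f -> BV (fun x => `|f x|).
Proof. by apply: (BV_lip (phi:=@Num.Def.normr R R)) => x y; exact: ler_dist_dist. Qed.

Lemma lip_min (c x y : R) : `|Num.min y c - Num.min x c| <= `|y - x|.
Proof.
have := ler_norm (y - x); have := ler_norm (- (y - x)); rewrite normrN => h3 h4.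
by case: (ltP y c) => h1; case: (ltP x c) => h2; rewrite ler_norml; apply/andP; split; lra.
Qed.

Lemma lip_max (c x y : R) : `|Num.max y c - Num.max x c| <= `|y - x|.
Proof.
have := ler_norm (y - x); have := ler_norm (- (y - x)); rewrite normrN => h3 h4.
by case: (ltP y c) => h1; case: (ltP x c) => h2; rewrite ler_norml; apply/andP; split; lra.
Qed.

Lemma BV_eq f g : (forall x, I x -> f x = g x) -> BV f -> BV g.
Proof.
move=> e /BV_ctl[V [c _ _]]; apply: (@ctl_BV _ V) => x y ix iy xy.
by rewrite -!e//; exact: c.
Qed.

Lemma BV_itv (J : set R) : is_interval J -> BV (\1_J).
Proof.
move=> iJ.
pose U := [set x | exists2 j, J j & j <= x]; pose L := [set x | exists2 j, J j & j < x /\ ~ J x].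
suff -> : (\1_J : R -> R) = (fun x => (\1_U x : R) - (\1_L x : R)).
  have mono (A : set R) : (forall x y, A x -> x <= y -> A y) -> BV (\1_A).
    move=> hA; apply: (@ctl_BV _ (\1_A)) => x y _ _ xy.
    rewrite ger0_norm// subr_ge0 !indicE.
    case: (boolP (x \in A)) => [xA|]; last by rewrite ler0n.
    by rewrite (mem_set (hA _ _ (set_mem xA) xy)).
  apply: BV_sub; apply: mono => x y.
    by case=> j Jj jx xy; exists j => //; exact: le_trans xy.
  case=> j Jj [jx nJ] xy; exists j => //; split; first exact: lt_le_trans xy.
  by move=> Jy; apply: nJ; apply: (iJ j y) => //; rewrite (ltW jx).
apply/funext => x; rewrite !indicE.
case: (pselect (J x)) => Jx.
  have xU : U x by exists x.
  have xL : ~ L x by case=> j _ [].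
  by rewrite (mem_set Jx) (mem_set xU) (memNset xL) subr0.
rewrite (memNset Jx); case: (pselect (U x)) => [xU|nU].
  have xL : L x.
    case: xU => j Jj jx; exists j => //; split=> //; rewrite lt_neqAle jx andbT.
    by apply/eqP => jxE; rewrite jxE in Jj.
  by rewrite (mem_set xU) (mem_set xL) subrr.
rewrite (memNset nU) memNset ?subrr// => -[j Jj [jx _]]; apply: nU.
by exists j => //; exact: ltW.
Qed.

Lemma BV_measurable f : BV f -> measurable_fun I f.
Proof.
move=> /BV_ctl[V [c _ _]].
pose p x := (V x + f x) / 2; pose n x := (V x - f x) / 2.
have pm : forall x y, I x -> I y -> x <= y -> p x <= p y.
  move=> x y /= xi yi xy.
  by have := c x y xi yi xy; rewrite ler_norml /p => /andP[]; lra.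
have nm : forall x y, I x -> I y -> x <= y -> n x <= n y.
  move=> x y /= xi yi xy.
  by have := c x y xi yi xy; rewrite ler_norml /n => /andP[]; lra.
have ext (phi : R -> R) : (forall x y, I x -> I y -> x <= y -> phi x <= phi y) ->
    measurable_fun I phi.
  move=> hm.
  have hbnd x : I x -> phi a <= phi x <= phi b.
    by move=> ix; move: (ix) => /IccP/andP[ax xb]; rewrite !hm.
  have [W [Wm We _]] := monoext hm hbnd (hm _ _ Icca Iccb (ltW ab)).
  apply: (eq_measurable_fun W) => [x /set_mem ix|]; first exact: We.
  by apply: nondecreasing_measurable => //; exact: measurable_itv.
have -> : f = (p \- n) by apply/funext => x /=; rewrite /p /n; lra.
by apply: measurable_funB; exact: ext.
Qed.

End BVclass.

Section Coc.
Context {R : realType} (a b : R).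
Hypothesis ab : a < b.
Implicit Types (f g h V W : R -> R) (P Q : R -> Prop).
Local Notation I := (Icc a b).
Local Notation BV := (inBV a b).

(** Off a countable set of points of [a, b].  This is the notion of exceptional
set for classes of functions of bounded variation: images of countable sets are
countable, non-atomic measures do not charge them, and relations that hold almost
everywhere between functions of bounded variation hold off a countable set. *)
Definition coc P := countable [set x | I x /\ ~ P x].

Lemma coc_sub P Q : (forall x, I x -> P x -> Q x) -> coc P -> coc Q.
Proof.
by move=> PQ; apply: sub_countable; apply: subset_card_le => x [ix nq]; split=> // px; exact/nq/PQ.
Qed.

Lemma cocW P : (forall x, I x -> P x) -> coc P.
Proof.
move=> h; rewrite /coc (_ : [set _ | _] = set0)//; apply/seteqP; split=> x//= [ix]; case.
exact: h.
Qed.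

Lemma coc_all (P : nat -> R -> Prop) : (forall n, coc (P n)) -> coc (fun x => forall n, P n x).
Proof.
move=> h; apply: (@sub_countable _ _ _ (\bigcup_n [set x | I x /\ ~ P n x])).
  by apply: subset_card_le => x [ix /existsNP[n hn]]; exists n.
exact: (bigcup_countable (countableP _) (fun n _ => h n)).
Qed.

Lemma coc_and P Q : coc P -> coc Q -> coc (fun x => P x /\ Q x).
Proof.
move=> hP hQ; apply: coc_sub (coc_all (P:=fun n => if n is 0%N then P else Q) _).
  by move=> x _ h; split; [exact: (h 0%N)|exact: (h 1%N)].
by case.
Qed.

Lemma coc2 P Q S : coc P -> coc Q -> (forall x, I x -> P x -> Q x -> S x) -> coc S.
Proof. by move=> hP hQ h; apply: coc_sub (coc_and hP hQ) => x ix []; exact: h. Qed.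

Lemma ae_on_sub (Z : set R) P Q : (forall x, Z x -> P x -> Q x) -> ae_on Z P -> ae_on Z Q.
Proof. by move=> PQ; apply: (@filterS _ _ (ae_filter_ringOfSetsType _)) => x h zx; exact/PQ/h. Qed.

Lemma ae_on2 (Z : set R) P Q S : ae_on Z P -> ae_on Z Q ->
  (forall x, Z x -> P x -> Q x -> S x) -> ae_on Z S.
Proof. by move=> hP hQ PQ; apply: (@filterS2 _ _ (ae_filter_ringOfSetsType _) _ _ _ _ hP hQ) => x h k zx; exact: PQ (h zx) (k zx). Qed.

Lemma ae_on_all (Z : set R) (P : nat -> R -> Prop) : (forall n, ae_on Z (P n)) ->
  ae_on Z (fun x => forall n, P n x).
Proof. by move=> /ae_foralln h; apply: (@filterS _ _ (ae_filter_ringOfSetsType _) _ _ _ h) => x k zx n; exact: k. Qed.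

Lemma ae_on_pick (Z : set (measurableTypeR R)) P : measurable Z -> (0 < @lebesgue_measure R Z)%E ->
  ae_on Z P -> exists2 x, Z x & P x.
Proof.
move=> mZ Z0 h; apply: contrapT => hn.
have : (@lebesgue_measure R).-negligible Z.
  by apply: negligibleS h => x zx /= /(_ zx) px; apply: hn; exists x.
by move/(negligibleP _ mZ) => Z0'; rewrite [X in (_ < X)%E]Z0' ltxx in Z0.
Qed.

Lemma coc_ae P : coc P -> ae_on I P.
Proof.
move=> h; exists [set x | I x /\ ~ P x]; split => //.
- by apply: countable_measurable => // t; exact: measurable_set1.
- exact: countable_lebesgue_measure0.
- by move=> x /= /not_implyP.
Qed.

Lemma ae_pick P x y : ae_on I P -> I x -> I y -> x < y -> exists2 z, x < z < y & P z.
Proof.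
move=> aeP /IccP/andP[ax xb] /IccP/andP[ay yb] xy.
apply: contrapT => hn; case: aeP => N [mN N0 sN].
have : `]x, y[%classic `<=` N.
  move=> z /=; rewrite in_itv/= => /andP[xz zy]; apply: sN => /= /(_ _) h.
  apply: hn; exists z; first by rewrite xz.
  by apply: h; apply/IccP; rewrite (le_trans ax (ltW xz)) (le_trans (ltW zy) yb).
move=> /(@le_measure _ _ _ (@lebesgue_measure R)); rewrite !inE => /(_ _ _).
move=> /(_ (measurable_itv _) mN); rewrite [X in (_ <= X)%E]N0.
have E : @lebesgue_measure R `]x, y[%classic = (y - x)%:E.
  by rewrite lebesgue_measure_itv/= lte_fin xy.
by rewrite [X in (X <= _)%E]E lee_fin subr_le0 leNgt xy.
Qed.

(** Let V be the variation of u from a.  If 1/n < |u y|, then u vanishes at points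
as close to y as desired, so V increases by more than 1/n between any point x < y
and y: the integral part of n V is injective on the set of these y. *)
Lemma BV_ae0 u : BV u -> ae_on I (fun x => u x = 0) -> coc (fun x => u x = 0).
Proof.
move=> /BV_ctl[V [c V0 _]] ae0.
suff H n : countable [set x | I x /\ n.+1%:R^-1 < `|u x|].
  apply: (@sub_countable _ _ _ (\bigcup_n [set x | I x /\ n.+1%:R^-1 < `|u x|])).
    apply: subset_card_le => x [ix /eqP ux].
    have : 0 < `|u x| by rewrite normr_gt0.
    by move=> /ltr_add_invr[k]; rewrite add0r => hk; exists k.
  exact: (bigcup_countable (countableP _)).
apply/countable_injP; exists (fun x => `|Num.floor (n.+1%:R * V x)|%N).
have V_ge0 x : I x -> 0 <= V x.
  by move=> ix; rewrite -V0; apply: (ctl_mono c (Icca ab) ix); case/IccP/andP: ix.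
have n0 : 0 < n.+1%:R :> R by rewrite ltr0n.
have key x y : I x -> I y -> x < y -> n.+1%:R^-1 < `|u y| -> 1 < n.+1%:R * V y - n.+1%:R * V x.
  move=> ix iy xy uy; have [z /andP[xz zy] uz] := ae_pick ae0 ix iy xy.
  have iz : I z.
    by move: ix iy => /IccP/andP[ax _] /IccP/andP[_ yb]; apply/IccP;
      rewrite (le_trans ax (ltW xz)) (le_trans (ltW zy) yb).
  have := c _ _ iz iy (ltW zy); rewrite uz subr0 => h.
  have := ctl_mono c ix iz (ltW xz) => h2.
  by rewrite -mulrBr -ltr_pdivrMl// mulr1; apply: (lt_le_trans uy); rewrite (le_trans h)// lerB.
have inj x y : I x -> I y -> x < y -> n.+1%:R^-1 < `|u y| ->
   `|Num.floor (n.+1%:R * V x)|%N <> `|Num.floor (n.+1%:R * V y)|%N.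
  move=> ix iy xy uy; have := key _ _ ix iy xy uy.
  have fx : 0 <= n.+1%:R * V x by rewrite mulr_ge0// V_ge0.
  have fy : 0 <= n.+1%:R * V y by rewrite mulr_ge0// V_ge0.
  move=> h e.
  have e2 : Num.floor (n.+1%:R * V x) = Num.floor (n.+1%:R * V y).
    by apply/eqP; rewrite -(gez0_abs (_ : 0 <= Num.floor (n.+1%:R * V x))) ?floor_ge0// e gez0_abs ?floor_ge0.
  have := floorD1_gt (n.+1%:R * V y); have := floor_le_tmp (n.+1%:R * V x).
  rewrite -e2 intrD; lra.
move=> x y /set_mem[ix ux] /set_mem[iy uy] e; apply/eqP; case: ltgtP => // xy; exfalso.
  exact: inj ix iy xy uy e.
exact: inj iy ix xy ux (esym e).
Qed.

Lemma BV_ae_eq f g : BV f -> BV g -> ae_on I (fun x => f x = g x) -> coc (fun x => f x = g x).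
Proof.
move=> hf hg h; apply: coc_sub (BV_ae0 (BV_sub ab hf hg) _) => [x _ /eqP|].
  by rewrite subr_eq0 => /eqP.
by apply: ae_on_sub h => x _ ->; rewrite subrr.
Qed.

Lemma BV_ae_ge f c : BV f -> ae_on I (fun x => c <= f x) -> coc (fun x => c <= f x).
Proof.
move=> hf h.
have hu := BV_lip ab (lip_min c) hf.
apply: coc_sub (BV_ae_eq hu (BV_cst ab c) _) => [x _ /= <-|]; first by rewrite ge_min lexx.
by apply: ae_on_sub h => x _ /= cf; apply/min_idPr.
Qed.

Lemma coc_ne P : coc P -> exists2 x, I x & P x.
Proof.
move=> /coc_ae h; have [z /andP[az zb] pz] := ae_pick h (Icca ab) (Iccb ab) ab.
by exists z => //; apply/IccP; rewrite !ltW.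
Qed.

(** ** Essential infima *)

(** The bounds make the supremum that defines the essential infimum finite; it is
the limit of a sequence of almost sure lower bounds, hence one itself. *)
Lemma Einf_spec Z f B c0 : measurable Z -> (0 < @lebesgue_measure R Z)%E ->
  ae_on Z (fun x => f x <= B) -> ae_on Z (fun x => c0 <= f x) ->
  ae_on Z (fun x => Einf Z f <= f x) /\
  forall c, ae_on Z (fun x => c <= f x) -> c <= Einf Z f.
Proof.
move=> mZ Z0 hB hc0; rewrite /Einf; set S := [set y | _].
have SB : (ereal_sup S <= B%:E)%E.
  apply: ge_ereal_sup => y Sy.
  have [x zx [h1 h2]] := ae_on_pick mZ Z0 (ae_on2 (S:=fun x => (y <= (f x)%:E)%E /\ f x <= B) Sy hB (fun _ _ u1 u2 => conj u1 u2)).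
  by rewrite (le_trans h1)// lee_fin.
have Sc c : ae_on Z (fun x => c <= f x) -> (c%:E <= ereal_sup S)%E.
  by move=> h; apply: ereal_sup_ubound; apply: ae_on_sub h => x _; rewrite lee_fin.
have Sfin : ereal_sup S \is a fin_num.
  rewrite fin_numE; apply/andP; split; apply/eqP => E.
    by have := Sc _ hc0; rewrite E leeNy_eq.
  by move: SB; rewrite E leye_eq.
split; last by move=> c h; rewrite -lee_fin fineK// Sc.
have : ae_on Z (fun x => forall n : nat, fine (ereal_sup S) - n.+1%:R^-1 <= f x).
  apply: ae_on_all => n.
  have n0 : (0 : R) < n.+1%:R^-1 by rewrite invr_gt0 ltr0n.
  have [y Sy hy] := ub_ereal_sup_adherent n0 Sfin.
  apply: ae_on_sub Sy => x _ yf; rewrite -lee_fin EFinB fineK//.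
  exact: le_trans (ltW hy) yf.
apply: ae_on_sub => x _ h; rewrite leNgt; apply/negP => /ltr_add_invr[n hn].
by have := h n; rewrite lerBlDr leNgt hn.
Qed.

Lemma Icc_meas : measurable (I : set R). Proof. exact: measurable_itv. Qed.
Lemma Icc_pos : (0 < @lebesgue_measure R I)%E.
Proof. by rewrite lebesgue_measure_itv/= lte_fin ab -EFinB lte_fin subr_gt0. Qed.
Hint Resolve Icc_meas Icc_pos : core.

Lemma abs_ae f B : (forall x, I x -> `|f x| <= B) ->
  ae_on I (fun x => f x <= B) /\ ae_on I (fun x => - B <= f x).
Proof.
by move=> bB; split; apply/coc_ae/cocW => x /bB; rewrite ler_norml => /andP[].
Qed.

Lemma BV_Einf f : BV f -> coc (fun x => Einf I f <= f x).
Proof.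
move=> hf; have [B _ bB] := BV_bnd ab hf.
have [B1 B2] := abs_ae bB.
by have [k _] := Einf_spec Icc_meas Icc_pos B1 B2; exact: BV_ae_ge.
Qed.

Lemma le_Einf f c : BV f -> coc (fun x => c <= f x) -> c <= Einf I f.
Proof.
move=> hf; have [B _ bB] := BV_bnd ab hf.
have [B1 B2] := abs_ae bB.
by have [_ k] := Einf_spec Icc_meas Icc_pos B1 B2; move=> /coc_ae; exact: k.
Qed.

Lemma Einf_le f c : BV f -> coc (fun x => f x <= c) -> Einf I f <= c.
Proof.
move=> /BV_Einf hf hc; have [x _ ] := coc_ne (coc_and hf hc).
by case=> h1 h2; exact: le_trans h2.
Qed.

Lemma EsupN Z f : Esup Z f = - Einf Z (fun x => - f x).
Proof.
rewrite /Esup /Einf /ereal_inf fineN; congr (- fine (ereal_sup _)).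
apply/seteqP; split=> [_ [z /= h <-]|z /= h].
  by apply: ae_on_sub h => x _; rewrite EFinN leeN2.
exists (- z)%E; last by rewrite oppeK.
by apply: ae_on_sub h => x _; rewrite EFinN leeNr.
Qed.

Lemma BV_norm_oo f : BV f -> coc (fun x => `|f x| <= norm_oo a b f).
Proof.
move=> hf; rewrite /norm_oo EsupN.
apply: coc_sub (BV_Einf (BV_opp ab (BV_abs ab hf))) => x _; rewrite lerNr; exact.
Qed.

Lemma norm_oo_ge0 f : BV f -> 0 <= norm_oo a b f.
Proof.
by move=> /BV_norm_oo/coc_ne[x _]; apply: le_trans.
Qed.

Lemma Einf_eq f g : BV f -> BV g -> coc (fun x => f x = g x) -> Einf I f = Einf I g.
Proof.
move=> hf hg e; apply/eqP; rewrite eq_le; apply/andP; split; apply: le_Einf => //.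
  by apply: coc2 (BV_Einf hf) e _ => x _ h <-.
by apply: coc2 (BV_Einf hg) e _ => x _ h ->.
Qed.

Lemma Einf_cst c : Einf I (fun=> c) = c.
Proof.
have hc := BV_cst ab c.
apply/eqP; rewrite eq_le; apply/andP; split; first by apply: Einf_le => //; apply: cocW.
by apply: le_Einf => //; apply: cocW.
Qed.

Lemma Einf_add f g : BV f -> BV g -> Einf I f + Einf I g <= Einf I (fun x => f x + g x).
Proof.
move=> hf hg; apply: le_Einf; first exact: BV_add.
by apply: coc2 (BV_Einf hf) (BV_Einf hg) _ => x _; exact: lerD.
Qed.

Lemma Einf_scale c f : 0 <= c -> BV f -> Einf I (fun x => c * f x) = c * Einf I f.
Proof.
move=> c0 hf; have hcf := BV_scale ab c hf.
apply/eqP; rewrite eq_le; apply/andP; split; last first.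
  by apply: le_Einf => //; apply: coc_sub (BV_Einf hf) => x _; exact: ler_wpM2l.
have [->|c1] := eqVneq c 0.
  by rewrite mul0r; apply: Einf_le; [exact: BV_scale|apply: cocW => x _; rewrite mul0r].
have {c0 c1}c0 : 0 < c by rewrite lt_neqAle eq_sym c1.
rewrite -ler_pdivrMl//; apply: le_Einf => //.
by apply: coc_sub (BV_Einf hcf) => x _; rewrite -ler_pdivrMl.
Qed.

(** ** The variation of a class *)

Lemma var_set f : let S := [set total_variation a b h |
    h in [set h | ae_on I (fun x => h x = f x)]] in (0 <= ereal_inf S)%E.
Proof. by apply: le_ereal_inf_tmp => _ [h _ <-]; apply: total_variation_ge0; exact: ltW. Qed.

Lemma var_ge0 f : 0 <= var a b f.
Proof. exact/fine_ge0/var_set. Qed.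

Lemma var_le f V M P : coc P ->
  ctl [set x | I x /\ P x] f V -> osc_le [set x | I x /\ P x] V M -> var a b f <= M.
Proof.
move=> cP c o.
have ne : [set x | I x /\ P x] !=set0 by have [x ix px] := coc_ne cP; exists x.
have [h [W [hf ch oh]]] := ctl_extend ne c o.
have chI : ctl I h W by apply: ctl_sub ch.
have M0 : W b - W a <= M by exact: oh.
rewrite /var; set X := ereal_inf _.
have XM : (X <= M%:E)%E.
  apply: le_trans (_ : (_ <= (W b - W a)%:E)%E) _; last by rewrite lee_fin.
  apply: le_trans (ctl_TV ab chI); apply: ereal_inf_lbound; exists h => //=.
  by apply/coc_ae; apply: coc_sub cP => x ix px; exact: hf.
have X0 : (0 <= X)%E by exact: var_set.
have Xf : X \is a fin_num by rewrite ge0_fin_numE// (le_lt_trans XM)// ltry.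
by rewrite -lee_fin fineK.
Qed.

(* The lower limit of a bounded sequence, as a supremum of eventual lower bounds. *)
Definition low_lim (u : nat -> R) :=
  sup [set c | exists N, forall n, (N <= n)%N -> c <= u n].

Lemma low_lim_le (u v : nat -> R) (B M : R) :
  (forall n, 0 <= u n <= B) -> (forall n, 0 <= v n <= B) ->
  (forall n, u n - v n <= M + n.+1%:R^-1) ->
  low_lim u - low_lim v <= M.
Proof.
move=> hu hv huv; apply/ler_addgt0Pr => e e0; rewrite lerBlDr.
apply: ge_sup; first by exists 0, 0%N => n _; case/andP: (hu n).
move=> c [N hc]; rewrite -lerBlDl.
have [k] := ltr_add_invr e0; rewrite add0r => hk.
apply: ub_le_sup.
  exists B => z [N' /(_ N' (leqnn _))] /le_trans; apply.
  by case/andP: (hv N').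
exists (maxn N k) => n; rewrite geq_max => /andP[Nn kn].
have := hc _ Nn; have := huv n.
have : n.+1%:R^-1 <= k.+1%:R^-1 :> R by rewrite lef_pV2 ?posrE ?ltr0n// ler_nat.
by move: hk; move: (n.+1%:R^-1) (k.+1%:R^-1) => t1 t2; lra.
Qed.

(** For representatives whose total variations tend to the infimum, the lower limit
of the variations from a to x controls f off the countable set where one of the
representatives differs from f. *)
Lemma var_ctl f : BV f -> exists P V, [/\ coc P, ctl [set x | I x /\ P x] f V
  & osc_le [set x | I x /\ P x] V (var a b f)].
Proof.
move=> hf; rewrite /var; set X := ereal_inf _.
have X0 : (0 <= X)%E by exact: var_set.
have Xf : X \is a fin_num.
  rewrite ge0_fin_numE//; apply: (@le_lt_trans _ _ (total_variation a b f)).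
    by apply: ereal_inf_lbound; exists f => //=; apply/coc_ae/cocW.
  by rewrite -ge0_fin_numE; [exact/bounded_variationP/hf/ltW|apply: total_variation_ge0; exact: ltW].
have /choice[h hh] n : exists h : R -> R, ae_on I (fun x => h x = f x) /\
    (total_variation a b h < X + n.+1%:R^-1%:E)%E.
  have n0 : (0 : R) < n.+1%:R^-1 by rewrite invr_gt0 ltr0n.
  by have [_ [h /= hh <-] hx] := lb_ereal_inf_adherent n0 Xf; exists h.
have hBV n : BV (h n).
  apply/bounded_variationP; first exact: ltW.
  rewrite ge0_fin_numE; last exact/total_variation_ge0/ltW.
  have [_ /lt_trans] := hh n; apply; rewrite -(fineK Xf) -EFinD; exact: ltry.
have /choice[V hV] n := BV_ctl (hBV n).
have Vb n x : I x -> 0 <= V n x <= fine X + 1.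
  move=> ix; case: (hV n) => c Va Vb'.
  rewrite -{1}Va (ctl_mono c (Icca ab) ix) ?(andP (IccP _ x).1 ix).1//=; last first.
    by case/IccP/andP: ix.
  have xb : x <= b by case/IccP/andP: ix.
  apply: (le_trans (ctl_mono c ix (Iccb ab) xb)); rewrite Vb'.
  rewrite -lee_fin fineK; last by apply/bounded_variationP; [exact: ltW|exact: hBV].
  case: (hh n) => _ /ltW /le_trans; apply; rewrite EFinD fineK// leeD2l// lee_fin.
  by rewrite invf_le1 ?ltr0n// ler1n.
have Vosc n x y : I x -> I y -> V n y - V n x <= fine X + n.+1%:R^-1.
  move=> ix iy; case: (hV n) => c Va Vb'.
  apply: (le_trans (ctl_osc ab c ix iy)); rewrite Va subr0 Vb'.
  rewrite -lee_fin fineK; last by apply/bounded_variationP; [exact: ltW|exact: hBV].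
  by case: (hh n) => _ /ltW /le_trans; apply; rewrite EFinD fineK.
exists (fun x => forall n, h n x = f x), (fun x => low_lim (V ^~ x)); split.
- by apply: coc_all => n; apply: BV_ae_eq => //; exact: (hh n).1.
- move=> x y [ix hx] [iy hy] xy.
  suff : low_lim (V ^~ x) - low_lim (V ^~ y) <= - `|f y - f x| by lra.
  apply: (low_lim_le (B:=fine X + 1)) => n; try exact: Vb.
  have [c _ _] := hV n; have := c _ _ ix iy xy; rewrite hx hy.
  have : 0 <= n.+1%:R^-1 :> R by rewrite invr_ge0.
  by move: (n.+1%:R^-1) => t; lra.
- move=> x y [ix _] [iy _]; apply: (low_lim_le (B:=fine X + 1)) => n; try exact: Vb.
  exact: Vosc.
Qed.

(** Extend f and its control from the complement of a countable set by [ctl_extend],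
and truncate the result, which is a Lipschitz operation. *)
Lemma min_rep f c1 c2 : BV f -> coc (fun x => c1 <= f x <= c2) ->
  exists h V, [/\ coc (fun x => h x = f x), ctl setT h V,
    osc_le setT V (var a b f) & forall x, c1 <= h x <= c2].
Proof.
move=> hf hc; have [P [V [cP cV oV]]] := var_ctl hf.
have [x0 ix0 [px0 cx0]] := coc_ne (coc_and cP hc).
have c12 : c1 <= c2 by case/andP: cx0 => ? /(le_trans _); apply.
have ne : [set x | I x /\ P x] !=set0 by exists x0.
have [h [W [hE ch oh]]] := ctl_extend ne cV oV.
exists (fun x => Num.max (Num.min (h x) c2) c1), W; split => //.
- apply: coc2 cP hc _ => x ix px /andP[h1 h2]; rewrite hE//.
  by rewrite (min_idPl h2) (max_idPl h1).
- exact: (ctl_lip (lip_max c1) (ctl_lip (lip_min c2) ch)).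
- by move=> x; rewrite le_max lexx orbT ge_max c12 andbT ge_min lexx orbT.
Qed.

Lemma var_le_ctl f h V M : coc (fun x => h x = f x) -> ctl I h V -> osc_le I V M ->
  var a b f <= M.
Proof.
move=> e c o; apply: (@var_le f V M _ e).
  by move=> x y [ix hx] [iy hy]; rewrite -hx -hy; exact: c.
by move=> x y [ix _] [iy _]; exact: o.
Qed.

Lemma var_add f g : BV f -> BV g -> var a b (fun x => f x + g x) <= var a b f + var a b g.
Proof.
move=> /var_ctl[P [V [p c o]]] /var_ctl[Q [W [q k u]]].
apply: (@var_le _ (fun x => V x + W x) _ _ (coc_and p q)).
  apply: ctlD; [apply: ctl_sub c|apply: ctl_sub k] => x [ix []]; by split.
move=> x y [ix [px qx]] [iy [py qy]].
have := o _ _ (conj ix px) (conj iy py); have := u _ _ (conj ix qx) (conj iy qy); lra.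
Qed.

Lemma var_scale_le c f : BV f -> var a b (fun x => c * f x) <= `|c| * var a b f.
Proof.
move=> /var_ctl[P [V [p k o]]].
apply: (@var_le _ (fun x => `|c| * V x) _ _ p); first exact: ctlZ.
by move=> x y ix iy; rewrite -mulrBr ler_wpM2l// o.
Qed.

Lemma var_eq f g : BV f -> BV g -> coc (fun x => f x = g x) -> var a b f = var a b g.
Proof.
have H u v : BV u -> coc (fun x => u x = v x) -> var a b v <= var a b u.
  move=> /var_ctl[P [V [p k o]]] e; apply: (@var_le _ V _ _ (coc_and p e)).
    by move=> x y [ix [px ex]] [iy [py ey]]; rewrite -ex -ey; exact: k.
  by apply: osc_sub o => x [ix []].
move=> hf hg e; apply/eqP; rewrite eq_le !H//.
by apply: coc_sub e => x _ ->.
Qed.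

Lemma var_cst c : var a b (fun=> c) = 0.
Proof.
apply/eqP; rewrite eq_le var_ge0 andbT.
apply: (@var_le_ctl _ (fun=> c) (fun=> 0)); first exact: cocW.
  by move=> x y *; rewrite !subrr normr0.
by move=> x y *; rewrite subrr.
Qed.

Lemma var_mul f g F G : BV f -> BV g -> coc (fun x => `|f x| <= F) -> coc (fun x => `|g x| <= G) ->
  var a b (fun x => f x * g x) <= G * var a b f + F * var a b g.
Proof.
move=> /var_ctl[P [V [p c o]]] /var_ctl[Q [W [q k u]]] hF hG.
have [x0 _ [F0 G0]] := coc_ne (coc_and hF hG).
apply: (@var_le _ (fun x => G * V x + F * W x) _ _ (coc_and (coc_and p q) (coc_and hF hG))).
  apply: ctlM; [by move=> x [_ [_ []]]|by move=> x [_ [_ []]]| |].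
  - by apply: ctl_sub c => x [ix [[]]].
  - by apply: ctl_sub k => x [ix [[]]].
move=> x y [ix [[px qx] _]] [iy [[py qy] _]].
have -> : G * V y + F * W y - (G * V x + F * W x) = G * (V y - V x) + F * (W y - W x) by lra.
by rewrite lerD// ler_wpM2l ?(le_trans _ F0)// ?(le_trans _ G0)//; [apply: o|apply: u]; split.
Qed.

(** The variation is lower semicontinuous, because the lower limit of controls of
the functions u n, normalized at a point, controls their limit. *)
Lemma var_lim (u : nat -> R -> R) f M : (forall n, BV (u n)) -> BV f ->
  (forall n, var a b (u n) <= M) -> coc (fun x => u ^~ x @ \oo --> f x) -> var a b f <= M.
Proof.
move=> bu bf hM hl.
have /choice[P /choice[V hV]] n : exists P, exists V, [/\ coc P, ctl [set x | I x /\ P x] (u n) V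
  & osc_le [set x | I x /\ P x] V (var a b (u n))] by exact: var_ctl (bu n).
have cP : coc (fun x => forall n, P n x) by apply: coc_all => n; case: (hV n).
have [x0 ix0 px0] := coc_ne cP.
have M0 : 0 <= M by exact: le_trans (var_ge0 _) (hM 0%N).
pose W n x := V n x - V n x0 + M.
have Wb n x : I x /\ (forall n, P n x) -> 0 <= W n x <= M + M.
  case=> ix px; case: (hV n) => _ _ o; rewrite /W.
  have := o _ _ (conj ix (px n)) (conj ix0 (px0 n)); have := o _ _ (conj ix0 (px0 n)) (conj ix (px n)).
  by have := hM n => h1 h2 h3; apply/andP; split; lra.
apply: (@var_le _ (fun x => low_lim (W ^~ x)) _ _ (coc_and cP hl)); last first.
  move=> x y [ix [px _]] [iy [py _]]; apply: (low_lim_le (B:=M + M)) => n; try by apply: Wb.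
  case: (hV n) => _ _ o; rewrite /W; have := o _ _ (conj ix (px n)) (conj iy (py n)); have := hM n.
  have : 0 <= n.+1%:R^-1 :> R by rewrite invr_ge0.
  by move: (n.+1%:R^-1) => t; lra.
move=> x y [ix [px lx]] [iy [py ly]] xy.
have lxy : `|u n y - u n x| @[n --> \oo] --> `|f y - f x| by apply: cvg_norm; exact: cvgB.
have loc (k : R) : (\forall n \near \oo, k <= `|u n y - u n x|) -> k <= low_lim (W ^~ y) - low_lim (W ^~ x).
  case=> N _ hN.
  have sh (w : nat -> R) : low_lim (fun n => w (n + N)%N) = low_lim w.
    congr (sup _); apply/seteqP; split => c [K hK].
      exists (K + N)%N => n KN; have Nn : (N <= n)%N := leq_trans (leq_addl _ _) KN.
      by rewrite -(subnK Nn); apply: hK; rewrite leq_subRL// addnC.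
    by exists K => n Kn; apply: hK; exact: leq_trans Kn (leq_addr _ _).
  suff : low_lim (W ^~ x) - low_lim (W ^~ y) <= - k by lra.
  rewrite -[X in X - _]sh -[X in _ - X]sh.
  apply: (low_lim_le (B:=M + M)) => n; try by apply: Wb.
  have := hN (n + N)%N (leq_addl _ _) => /= kn.
  case: (hV (n + N)%N) => _ c _; have := c _ _ (conj ix (px _)) (conj iy (py _)) xy; rewrite /W.
  have : 0 <= n.+1%:R^-1 :> R by rewrite invr_ge0.
  by move: (n.+1%:R^-1) => t; lra.
apply/ler_addgt0Pr => e e0; rewrite -lerBlDr; apply: loc.
move/cvgrPdist_le : lxy => /(_ _ e0); apply: filterS => n.
rewrite ler_norml => /andP[]; lra.
Qed.

Lemma norm_BV_ge0 f : BV f -> 0 <= norm_BV a b f.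
Proof. by move=> hf; rewrite addr_ge0 ?var_ge0// norm_oo_ge0. Qed.

End Coc.

(** * Cones of functions and projective distances *)

Section Cones.
Context {R : realType} (a b : R).
Hypothesis ab : a < b.
Implicit Types (f g h u v : R -> R) (P Q : R -> Prop).
Local Notation I := (Icc a b).
Local Notation BV := (inBV a b).
Local Notation Einf := (Einf (Icc a b)).
Local Notation var := (var a b).
Local Notation coc := (coc a b).

(** For c > 0, this is [cone a b c] together with the zero class.  It is closed, so
that extremal constants in its order are attained. *)
Definition kcone (c : R) f := BV f /\ var f <= c * Einf f.

Lemma kcone_BV c f : kcone c f -> BV f. Proof. by case. Qed.

Lemma kcone_eq c f g : (forall x, f x = g x) -> kcone c f -> kcone c g.
Proof. by move=> /funext ->. Qed.

Lemma kcone_coc c f g : BV g -> coc (fun x => f x = g x) -> kcone c f -> kcone c g.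
Proof. by move=> hg e [hf h]; split=> //; rewrite -(var_eq ab hf hg e) -(Einf_eq ab hf hg e). Qed.

Lemma kcone_add c f g : 0 <= c -> kcone c f -> kcone c g -> kcone c (fun x => f x + g x).
Proof.
move=> c0 [hf vf] [hg vg]; split; first exact: BV_add.
apply: (le_trans (var_add ab hf hg)); apply: (le_trans (lerD vf vg)).
by rewrite -mulrDr ler_wpM2l// Einf_add.
Qed.

Lemma kcone_scale c k f : 0 <= k -> kcone c f -> kcone c (fun x => k * f x).
Proof.
move=> k0 [hf vf]; split; first exact: BV_scale.
apply: (le_trans (var_scale_le ab k hf)); rewrite ger0_norm// Einf_scale// mulrCA.
exact: ler_wpM2l.
Qed.

Lemma kcone_lin c k l f g : 0 <= c -> 0 <= k -> 0 <= l -> kcone c f -> kcone c g ->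
  kcone c (fun x => k * f x + l * g x).
Proof. by move=> c0 k0 l0 hf hg; apply: kcone_add => //; exact: kcone_scale. Qed.

Lemma kcone0 c : kcone c (fun=> 0).
Proof. by split; [exact: BV_cst|rewrite var_cst// Einf_cst// mulr0]. Qed.

Lemma Einf_ge0 c f : 0 < c -> kcone c f -> 0 <= Einf f.
Proof. by move=> c0 [hf vf]; rewrite -(pmulr_rge0 _ c0) (le_trans _ vf)// var_ge0. Qed.

Lemma kcone_mono c d f : 0 < c -> c <= d -> kcone c f -> kcone d f.
Proof.
move=> c0 cd kf; have := Einf_ge0 c0 kf; case: kf => hf vf e0; split=> //.
by apply: (le_trans vf); rewrite ler_wpM2r.
Qed.

Lemma BV_upper f : BV f -> coc (fun x => f x <= Einf f + var f).
Proof.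
move=> hf; have [P [V [p c o]]] := var_ctl ab hf.
apply: coc_sub (p) => x ix px; rewrite -lerBlDr; apply: (le_Einf ab hf).
apply: coc_sub (p) => y iy py; rewrite lerBlDr -lerBlDl.
case: (leP x y) => xy.
  have := c _ _ (conj ix px) (conj iy py) xy; have := o _ _ (conj ix px) (conj iy py).
  by rewrite ler_norml => ? /andP[]; lra.
have := c _ _ (conj iy py) (conj ix px) (ltW xy); have := o _ _ (conj iy py) (conj ix px).
by rewrite ler_norml => ? /andP[]; lra.
Qed.

Lemma kcone_bnd c f : kcone c f -> coc (fun x => Einf f <= f x <= (1 + c) * Einf f).
Proof.
case=> hf vf; apply: coc2 (BV_Einf ab hf) (BV_upper hf) _ => x _ h1 h2.
by rewrite h1 (le_trans h2)// mulrDl mul1r lerD2l.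
Qed.

Lemma kcone_zero c f : kcone c f -> Einf f = 0 -> coc (fun x => f x = 0).
Proof.
move=> kf e0; apply: coc_sub (kcone_bnd kf) => x _; rewrite e0 mulr0 => h.
by apply/le_anti; rewrite andbC.
Qed.

(** A perturbation by e F changes the variation and the essential infimum by at most
a multiple of e. *)
Lemma kcone_closed c u F : 0 <= c -> BV u -> BV F ->
  (forall e, 0 < e -> kcone c (fun x => u x + e * F x)) -> kcone c u.
Proof.
move=> c0 hu hF h; split=> //.
pose K := var F + c * `|Einf (fun x => - F x)|.
suff H e : 0 < e -> var u <= c * Einf u + e * K.
  have K0 : 0 <= K by rewrite addr_ge0 ?var_ge0// mulr_ge0.
  apply/ler_addgt0Pr => e e0; apply: le_trans (H (e / (K + 1)) _) _.
    by rewrite divr_gt0// ltr_wpDl.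
  rewrite lerD2l -mulrA ger_pMr// ler_pdivrMl ?ltr_wpDl// mulr1; lra.
move=> e0; have [hue vue] := h _ e0; have hne := BV_opp ab (BV_scale ab e hF).
have E1 := Einf_add ab hue hne.
have e1 : (fun x => u x + e * F x + - (e * F x)) = u by apply/funext => x; rewrite addrK.
rewrite e1 in E1.
have V1 := var_add ab hue hne; rewrite e1 in V1.
have e2 : (fun x => - (e * F x)) = (fun x => (- e) * F x) by apply/funext => x; rewrite mulNr.
have V2 : var (fun x => - (e * F x)) <= e * var F.
  by rewrite e2; have := var_scale_le ab (- e) hF; rewrite normrN gtr0_norm.
have e3 : (fun x => - (e * F x)) = (fun x => e * - F x) by apply/funext => x; rewrite mulrN.
rewrite e3 Einf_scale ?(ltW e0)// in E1; last exact: BV_opp.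
have : - `|Einf (fun x => - F x)| <= Einf (fun x => - F x) by rewrite lerNl -normrN ler_norm.
move: E1 V1 V2 vue; rewrite /K; move: (Einf (fun x => - F x)) => z.
move=> E1 V1 V2 vue zz.
have H1 : e * - `|z| <= e * z by rewrite ler_pM2l.
have H2 : c * Einf (fun x => u x + e * F x) <= c * (Einf u + e * `|z|).
  by apply: ler_wpM2l => //; lra.
lra.
Qed.

(** ** The cones of positive functions and their order *)

Lemma cone_kcone c f : cone a b c f -> kcone c f.
Proof. by case. Qed.

Lemma kcone_cone c f : 0 < c -> kcone c f -> 0 < Einf f -> cone a b c f.
Proof.
move=> c0 [hf vf] e0; split=> //.
by apply/coc_ae; apply: coc_sub (BV_Einf ab hf) => x _; exact: lt_le_trans.
Qed.

Lemma cone_leP c f h : 0 < c -> BV f -> BV h ->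
  cone_le a b c f h <-> kcone c (fun x => h x - f x).
Proof.
move=> c0 hf hh; have hd := BV_sub ab hh hf; split.
  case=> [/cone_kcone//|/(BV_ae0 ab hd) z].
  by apply: kcone_coc (kcone0 c) => //; apply: coc_sub z => x _ ->.
move=> k; have := Einf_ge0 c0 k; rewrite le_eqVlt => /orP[/eqP e0|e0].
  by right; apply/coc_ae/(kcone_zero k).
by left; exact: kcone_cone.
Qed.

(** [cmp c F H x]: for some l >= 0 one has l F <= H <= x l F in the order of the
cone.  For F and H in the cone, this says that their projective distance is at
most ln x, without a separate treatment of the boundary of the cone. *)
Definition cmp (c : R) F H (x : R) := exists l, [/\ 0 <= l,
  kcone c (fun t => H t - l * F t) & kcone c (fun t => x * l * F t - H t)].

Lemma cmp_mono c F H x y : 0 <= c -> kcone c F -> x <= y -> cmp c F H x -> cmp c F H y.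
Proof.
move=> c0 kF xy [l [l0 h1 h2]]; exists l; split=> //.
have k0 : 0 <= (y - x) * l by rewrite mulr_ge0// subr_ge0.
apply: kcone_eq (kcone_add c0 h2 (kcone_scale k0 kF)) => t; lra.
Qed.

Lemma cmp_bnd c F H x : 0 < c -> cmp c F H x ->
  exists2 l, 0 <= l & coc (fun t => l * F t <= H t <= x * l * F t).
Proof.
move=> c0 [l [l0 h1 h2]]; exists l => //.
have := Einf_ge0 c0 h1; have := Einf_ge0 c0 h2 => e2 e1.
apply: coc2 (kcone_bnd h1) (kcone_bnd h2) _ => t _ /andP[H1 _] /andP[H2 _].
by move: (le_trans e1 H1) (le_trans e2 H2); rewrite !subr_ge0 => -> ->.
Qed.

Definition linear_op (L : (R -> R) -> R -> R) :=
  forall k l f g, L (fun t => k * f t + l * g t) = (fun t => k * L f t + l * L g t).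

Definition maps_cone (L : (R -> R) -> R -> R) (c d : R) := forall f, kcone c f -> kcone d (L f).

Lemma linear_opB L k l f g : linear_op L ->
  L (fun t => k * f t - l * g t) = (fun t => k * L f t - l * L g t).
Proof.
move=> /(_ k (- l) f g); under eq_fun do rewrite mulNr.
by move=> ->; apply/funext => t; rewrite mulNr.
Qed.

Lemma linear_opB1 L l f g : linear_op L ->
  L (fun t => f t - l * g t) = (fun t => L f t - l * L g t).
Proof.
move=> /(linear_opB 1 l f g); under eq_fun do rewrite mul1r.
by move=> ->; apply/funext => t; rewrite mul1r.
Qed.

Lemma linear_opB2 L l f g : linear_op L ->
  L (fun t => l * f t - g t) = (fun t => l * L f t - L g t).
Proof.
move=> /(linear_opB l 1 f g); under eq_fun do rewrite mul1r.
by move=> ->; apply/funext => t; rewrite mul1r.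
Qed.

Lemma cmp_nonexp L c d f h x : linear_op L -> maps_cone L c d ->
  cmp c f h x -> cmp d (L f) (L h) x.
Proof.
move=> lL pL [l [l0 h1 h2]]; exists l; split=> //.
  by have := pL _ h1; rewrite linear_opB1.
by have := pL _ h2; rewrite linear_opB2.
Qed.

(** The diameter of the cone of parameter g c within the cone of parameter c is at
most the logarithm of [kap g c ^- 2]. *)
Definition kap (g c : R) := (1 - g) / (1 + g + g * c).

Lemma kap_itv (g c : R) : 0 < g < 1 -> 0 < c -> 0 < kap g c < 1.
Proof.
move=> /andP[g0 g1] c0; have gc : 0 < g * c by rewrite mulr_gt0.
apply/andP; split; first by rewrite divr_gt0//; lra.
by rewrite ltr_pdivrMr; lra.
Qed.

(** The variations of u and v are at most g c times their infima, and u is at most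
(1 + g c) times its infimum: the triangle inequality for the variation leaves room
for the multiple [kap g c] of u. *)
Lemma kcone_inner (g c : R) u v : 0 < g < 1 -> 0 < c -> kcone (g * c) u -> kcone (g * c) v ->
  kcone c (fun t => Einf u * v t - kap g c * Einf v * u t).
Proof.
move=> g01 c0 ku kv; have /andP[k0 k1] := kap_itv g01 c0.
have /andP[g0 g1] := g01.
have gc : 0 < g * c by rewrite mulr_gt0.
have := Einf_ge0 gc ku; have := Einf_ge0 gc kv.
have := kcone_bnd ku; have := kcone_bnd kv.
case: ku => bu vu; case: kv => bv vv.
move: (Einf u) (Einf v) vu vv => p r vu vv hv hu r0 p0.
set k := kap g c in k0 k1 *.
have kr : 0 <= k * r by rewrite mulr_ge0// ltW.
have E : (fun t => p * v t - k * r * u t) = (fun t => p * v t + - (k * r) * u t).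
  by apply/funext => t; rewrite mulNr.
have b1 := BV_scale ab p bv; have b2 := BV_scale ab (- (k * r)) bu.
split; first by rewrite E; exact: BV_add.
have V : var (fun t => p * v t - k * r * u t) <= p * (g * c * r) + k * r * (g * c * p).
  rewrite E; apply: (le_trans (var_add ab b1 b2)); apply: lerD.
    by apply: (le_trans (var_scale_le ab _ bv)); rewrite ger0_norm// ler_wpM2l.
  by apply: (le_trans (var_scale_le ab _ bu)); rewrite normrN ger0_norm// ler_wpM2l.
have N : p * r - k * r * ((1 + g * c) * p) <= Einf (fun t => p * v t - k * r * u t).
  apply: (le_Einf ab); first by rewrite E; exact: BV_add.
  apply: coc2 hu hv _ => t _ /andP[_ h1] /andP[h2 _].
  by rewrite lerB// ler_wpM2l.
apply: (le_trans V); apply: le_trans (ler_wpM2l (ltW c0) N).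
have kE : k * (1 + g + g * c) = 1 - g by rewrite /k /kap divfK//; lra.
suff : p * (g * c * r) + k * r * (g * c * p) = c * (p * r - k * r * ((1 + g * c) * p)) by move=> ->.
have -> : c * (p * r - k * r * ((1 + g * c) * p)) = p * r * c * (1 - k * (1 + g + g * c)) + k * r * (g * c * p) by lra.
by rewrite kE; lra.
Qed.

(** Birkhoff contraction.  With u = L h - l L f and v = x l L f - L h, lower
bounds of u by v and of v by u in the cone turn into an upper and a lower bound
of L h by L f of smaller ratio. *)
Lemma cmp_contract L c d (g : R) f h x : 0 < g < 1 -> 0 < d -> linear_op L ->
  maps_cone L c (g * d) -> kcone c f -> 1 <= x -> cmp c f h x ->
  cmp d (L f) (L h) (1 + (1 - kap g d ^+ 2) * (x - 1)).
Proof.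
move=> g01 d0 lL pL kf x1 [l [l0 h1 h2]]; have /andP[k0 k1] := kap_itv g01 d0.
have /andP[g0 g1] := g01.
have gd : 0 < g * d by rewrite mulr_gt0.
have gdd : g * d <= d by rewrite ger_pMl// ltW.
have ku := pL _ h1; have kv := pL _ h2; have kLf := kcone_mono gd gdd (pL _ kf).
rewrite linear_opB1// in ku; rewrite linear_opB2// in kv.
set u := (fun t => L h t - l * L f t) in ku.
set v := (fun t => x * l * L f t - L h t) in kv.
have K1 := kcone_inner g01 d0 ku kv; have K2 := kcone_inner g01 d0 kv ku.
have p0 := Einf_ge0 gd ku; have r0 := Einf_ge0 gd kv.
set k := kap g d in k0 k1 K1 K2 *; set w := 1 - k ^+ 2.
have w0 : 0 <= w by rewrite /w subr_ge0 expr_le1// ltW.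
have [pz|pn] := eqVneq (Einf u) 0.
  have z := kcone_zero ku pz.
  have bL := kcone_BV kLf; have bu := kcone_BV ku; have bv := kcone_BV kv.
  have bh : BV (L h).
    have := BV_add ab bu (BV_scale ab l bL); congr (BV _).
    by apply/funext => t; rewrite /u subrK.
  exists l; split=> //.
    apply: kcone_coc (kcone0 d); first exact: bu.
    by apply: coc_sub z => t _ /= ht; exact: esym.
  have c0 : 0 <= w * (x - 1) * l by rewrite !mulr_ge0// subr_ge0.
  apply: kcone_coc (kcone_scale c0 kLf); first exact/BV_sub/bh/BV_scale.
  by apply: coc_sub z => t _; rewrite /u => ht; rewrite (_ : L h t = l * L f t); lra.
have [rz|rn] := eqVneq (Einf v) 0.
  have z := kcone_zero kv rz.
  have bL := kcone_BV kLf; have bu := kcone_BV ku; have bv := kcone_BV kv.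
  have bh : BV (L h).
    have := BV_add ab bu (BV_scale ab l bL); congr (BV _).
    by apply/funext => t; rewrite /u subrK.
  have xl0 : 0 <= x * l by rewrite mulr_ge0//; lra.
  exists (x * l); split=> //.
    apply: kcone_coc (kcone0 d); first exact/BV_sub/BV_scale.
    by apply: coc_sub z => t _; rewrite /v; lra.
  have c0 : 0 <= w * (x - 1) * (x * l) by rewrite mulr_ge0// mulr_ge0// subr_ge0.
  apply: kcone_coc (kcone_scale c0 kLf); first exact/BV_sub/bh/BV_scale.
  by apply: coc_sub z => t _; rewrite /v => ht; rewrite (_ : L h t = x * l * L f t); lra.
have {p0 pn}p0 : 0 < Einf u by rewrite lt_neqAle eq_sym pn.
have {r0 rn}r0 : 0 < Einf v by rewrite lt_neqAle eq_sym rn.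
move: (Einf u) (Einf v) p0 r0 K1 K2 => p r p0 r0 K1 K2.
have x0 : 0 < x by lra.
have D1 : 0 < r + k * p by rewrite addr_gt0// mulr_gt0.
have D2 : 0 < p + k * r by rewrite addr_gt0// mulr_gt0.
have D3 : 0 < r + k * p * x by rewrite addr_gt0// mulr_gt0// mulr_gt0.
pose l1 := l * (r + k * p * x) / (r + k * p).
pose l2 := l * (p * x + k * r) / (p + k * r).
have l10 : 0 <= l1 by rewrite /l1 divr_ge0 ?mulr_ge0// ltW.
exists l1; split; first exact: l10.
  have i0 : 0 <= (r + k * p)^-1 by rewrite invr_ge0 ltW.
  apply: kcone_eq (kcone_scale i0 K2) => t; rewrite /u /v /l1; field.
  by rewrite gt_eqF.
have H : l2 <= (1 + w * (x - 1)) * l1.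
  rewrite /l2 /l1 ler_pdivrMr// -!mulrA [leRHS]mulrCA; apply: ler_wpM2l => //.
  rewrite !mulrA [leRHS]mulrAC ler_pdivlMr//.
  have pr : 0 < p * r by rewrite mulr_gt0.
  have E1 : (p * x + k * r) * (r + k * p) = (p + k * r) * (r + k * p * x) + w * (x - 1) * (p * r).
    rewrite /w; lra.
  have -> : (1 + w * (x - 1)) * (r + k * p * x) * (p + k * r) =
     (p + k * r) * (r + k * p * x) + w * (x - 1) * ((p + k * r) * (r + k * p * x)) by lra.
  rewrite E1 lerD2l; apply: ler_wpM2l; first by rewrite mulr_ge0//; lra.
  have kr : 0 < k * r by rewrite mulr_gt0.
  have kpx : 0 < k * p * x by rewrite mulr_gt0// mulr_gt0.
  by apply: ler_pM; [exact: ltW|exact: ltW|rewrite lerDl ltW|rewrite lerDl ltW].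
have i0 : 0 <= (p + k * r)^-1 by rewrite invr_ge0 ltW.
have e0 : 0 <= (1 + w * (x - 1)) * l1 - l2 by rewrite subr_ge0.
apply: kcone_eq (kcone_lin (ltW d0) i0 e0 K1 kLf) => t; rewrite /u /v /l2; field.
by rewrite gt_eqF.
Qed.

(** Apply [kcone_inner] to f and h, in both orders. *)
Lemma cmp_init (g c : R) f h : 0 < g < 1 -> 0 < c -> kcone (g * c) f -> 0 < Einf f ->
  kcone (g * c) h -> cmp c f h (kap g c ^- 2).
Proof.
move=> g01 c0 kf f0 kh; have /andP[k0 k1] := kap_itv g01 c0.
have /andP[g0 g1] := g01; have gc : 0 < g * c by rewrite mulr_gt0.
have K1 := kcone_inner g01 c0 kf kh; have K2 := kcone_inner g01 c0 kh kf.
have r0 := Einf_ge0 gc kh.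
move: (Einf f) (Einf h) f0 r0 K1 K2 => p r p0 r0 K1 K2.
move: (kap g c) k0 k1 K1 K2 => k k0 k1 K1 K2.
exists (k * r / p); split; first by rewrite divr_ge0 ?mulr_ge0// ltW.
  have i0 : 0 <= p^-1 by rewrite invr_ge0 ltW.
  apply: kcone_eq (kcone_scale i0 K1) => t; field.
  by rewrite gt_eqF.
have i0 : 0 <= (k * p)^-1 by rewrite invr_ge0 ltW// mulr_gt0.
apply: kcone_eq (kcone_scale i0 K2) => t; field.
by rewrite !gt_eqF.
Qed.

(** Let l be the largest constant with l F <= H.  Just above l the lower comparison
fails, so the alternative gives the upper comparison at constants that tend to
X l; the order is closed. *)
Lemma cmp_extremal c F H x X : 0 < c -> kcone c F -> 0 < Einf F -> BV H -> 1 <= X ->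
  cmp c F H x ->
  (forall l1 l2, 0 < l1 -> 0 < l2 -> X * l1 < l2 ->
     kcone c (fun t => H t - l1 * F t) \/ kcone c (fun t => l2 * F t - H t)) ->
  cmp c F H X.
Proof.
move=> c0 kF F0 bH X1 [l [l0 h1 h2]] alt; have bF := kcone_BV kF.
pose A := [set l | 0 <= l /\ kcone c (fun t => H t - l * F t)].
have [B B0 bB] := BV_bnd ab bH.
have Aub : ubound A (B / Einf F).
  move=> z [z0 kz]; rewrite ler_pdivlMr//.
  have e0 := Einf_ge0 c0 kz.
  have [t it [/andP[H1 _] H2]] := coc_ne ab (coc_and (kcone_bnd kz) (BV_Einf ab bF)).
  have := le_trans e0 H1; rewrite subr_ge0 => /(le_trans (ler_wpM2l z0 H2)) /le_trans; apply.
  exact: le_trans (ler_norm _) (bB _ it).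
have Al : A l by [].
have hA : has_sup A by split; [exists l|exists (B / Einf F)].
have tau0 : 0 <= sup A by apply: le_trans l0 _; exact: sup_upper_bound.
have down z w : 0 <= w -> w <= z -> A z -> A w.
  move=> w0 wz [z0 kz]; split=> //.
  have d0 : 0 <= z - w by rewrite subr_ge0.
  apply: kcone_eq (kcone_add (ltW c0) kz (kcone_scale d0 kF)) => t; lra.
exists (sup A); split=> //.
  apply: (kcone_closed (F:=F) (ltW c0)) => //; first exact/BV_sub/BV_scale.
  move=> e e0; have [z [z0 kz] hz] := sup_adherent e0 hA.
  have d0 : 0 <= z - (sup A - e) by rewrite subr_ge0 ltW.
  apply: kcone_eq (kcone_add (ltW c0) kz (kcone_scale d0 kF)) => t; lra.
apply: (kcone_closed (F:=F) (ltW c0)) => //; first exact/BV_sub/bH/BV_scale.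
move=> e e0; pose l1 := sup A + e / (X * 2).
have X0 : 0 < X by lra.
have e2 : 0 < e / (X * 2) by rewrite divr_gt0// mulr_gt0.
have [|||k|k] := alt l1 (X * sup A + e).
- by rewrite /l1; lra.
- by rewrite ltr_wpDl// mulr_ge0// ltW.
- rewrite /l1 mulrDr ltrD2l.
  have -> : X * (e / (X * 2)) = e / 2 by field; rewrite gt_eqF.
  lra.
- exfalso; have : A l1 by split=> //; rewrite /l1; lra.
  by move=> /(sup_upper_bound hA); rewrite /l1; lra.
by apply: kcone_eq k => t; lra.
Qed.

(** ** Projective distances and comparison constants *)

Lemma Theta_le c f h l1 l2 : 0 < c -> BV f -> BV h -> 0 < l1 -> 0 < l2 ->
  kcone c (fun t => h t - l1 * f t) -> kcone c (fun t => l2 * f t - h t) ->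
  (Theta a b c f h <= (ln (l2 / l1))%:E)%E.
Proof.
move=> c0 bf bh l10 l20 h1 h2.
have t1 : (l1%:E <= cone_tau a b c f h)%E.
  apply: ereal_sup_ubound; exists l1 => //; split=> //.
  by apply/cone_leP => //; exact: BV_scale.
have r2 : (cone_rho a b c f h <= l2%:E)%E.
  apply: ereal_inf_lbound; exists l2 => //; split=> //.
  by apply/cone_leP => //; exact: BV_scale.
have r0 : (0 <= cone_rho a b c f h)%E.
  by apply: le_ereal_inf_tmp => _ [l [l0 _] <-]; rewrite lee_fin ltW.
rewrite /Theta; move: (cone_rho a b c f h) (cone_tau a b c f h) t1 r2 r0.
move=> [r| |]//= [t| |]//=; rewrite ?lee_fin => t1 r2 r0.
  have t0 := lt_le_trans l10 t1; rewrite (lt_geF t0)/=.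
  have := r0; rewrite le_eqVlt => /orP[/eqP<-|r0'].
    by rewrite mul0r lexx leNye.
  rewrite (lt_geF (divr_gt0 r0' t0))/= lee_fin ler_ln ?posrE ?divr_gt0//.
  by apply: ler_pM => //; [rewrite invr_ge0 ltW|rewrite lef_pV2 ?posrE].
by rewrite invr0 mulr0 lexx leNye.
Qed.

(** The constants l with l F <= H form an initial segment of the positive reals, and
those with H <= l F a final one: a failure at l1 bounds [cone_tau] from above, and
a failure at l2 bounds [cone_rho] from below. *)
Lemma Theta_ge c F H l1 l2 t : 0 < c -> kcone c F -> BV H -> 0 < l1 -> 0 < l2 ->
  ~ kcone c (fun t => H t - l1 * F t) -> ~ kcone c (fun t => l2 * F t - H t) ->
  (Theta a b c F H <= t%:E)%E -> ln (l2 / l1) <= t.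
Proof.
move=> c0 kF bH l10 l20 h1 h2; have bF := kcone_BV kF.
have t1 : (cone_tau a b c F H <= l1%:E)%E.
  apply: ge_ereal_sup => _ [l [l0 /cone_leP hl] <-]; rewrite lee_fin leNgt; apply/negP => ll.
  apply: h1; have d0 : 0 <= l - l1 by rewrite subr_ge0 ltW.
  apply: kcone_eq (kcone_add (ltW c0) (hl c0 (BV_scale ab _ bF) bH) (kcone_scale d0 kF)) => s; lra.
have r2 : (l2%:E <= cone_rho a b c F H)%E.
  apply: le_ereal_inf_tmp => _ [l [l0 /cone_leP hl] <-]; rewrite lee_fin leNgt; apply/negP => ll.
  apply: h2; have d0 : 0 <= l2 - l by rewrite subr_ge0 ltW.
  apply: kcone_eq (kcone_add (ltW c0) (hl c0 bH (BV_scale ab _ bF)) (kcone_scale d0 kF)) => s; lra.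
rewrite /Theta; move: (cone_rho a b c F H) (cone_tau a b c F H) t1 r2.
move=> [r| |]//= [s| |]//=; rewrite ?lee_fin => t1 r2; last first.
  by rewrite leNye leye_eq.
case: ifPn; first by rewrite leye_eq.
rewrite -ltNge => s0.
have r0 := lt_le_trans l20 r2.
rewrite (lt_geF (divr_gt0 r0 s0))/= lee_fin; apply: le_trans.
rewrite ler_ln ?posrE ?divr_gt0//.
by apply: ler_pM => //; [exact: ltW|rewrite invr_ge0 ltW|rewrite lef_pV2 ?posrE].
Qed.

End Cones.

(** * Lists of ordered intervals *)

(** The elements stand for disjoint intervals Z, listed from left to right.  For a
nonnegative function with control V, M Z and J Z will be its supremum and its
infimum over Z, and lo Z, hi Z the infimum and the supremum of V over Z. *)
Section Runs.
Context {R : realType} {T : eqType}.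
Variables (full : pred T) (M J lo hi : T -> R).
Implicit Types (s : seq T).

Lemma sum_osc_le s (A0 A1 : R) : pairwise (fun Z Z' => hi Z <= lo Z') s ->
  (forall Z, Z \in s -> [/\ A0 <= lo Z, lo Z <= hi Z & hi Z <= A1]) -> A0 <= A1 ->
  \sum_(Z <- s) (hi Z - lo Z) <= A1 - A0.
Proof.
elim: s A0 => [|Z s IH] A0 /=; first by rewrite big_nil subr_ge0.
move=> /andP[hZ ps] h A01; rewrite big_cons.
have [h1 h2 h3] := h Z (mem_head _ _).
have := IH (hi Z) ps _ h3.
suff H : forall Z', Z' \in s -> [/\ hi Z <= lo Z', lo Z' <= hi Z' & hi Z' <= A1].
  by move=> /(_ H); lra.
move=> Z' Z's; have [] := h Z'; first by rewrite in_cons Z's orbT.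
by move=> _ k1 k2; split=> //; move/allP: hZ; apply.
Qed.

(** Every run of consecutive elements that are not full, counting c of them
before the head of the list, has length at most k. *)
Fixpoint runs_le (k : R) (c : nat) s : bool :=
  if s is Z :: s' then
    if full Z then runs_le k 0 s' else (c.+1%:R <= k) && runs_le k c.+1 s'
  else true.

Lemma runs_leP k s : 0 <= k ->
  (forall s1 r s2, s = s1 ++ r ++ s2 -> all (predC full) r -> (size r)%:R <= k) ->
  runs_le k 0 s.
Proof.
move=> k0 h.
have H t : forall s1 r, s = s1 ++ r ++ t -> all (predC full) r -> runs_le k (size r) t.
  elim: t => [//|Z t IH] s1 r E ar /=.
  have [fZ|nZ] := boolP (full Z).
    by apply: (IH (s1 ++ r ++ [:: Z]) [::]) => //=; rewrite E -!catA.
  have E' : s = s1 ++ rcons r Z ++ t by rewrite E cat_rcons.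
  have ar' : all (predC full) (rcons r Z) by rewrite all_rcons ar andbT.
  have := IH _ _ E' ar'; rewrite size_rcons => ->; rewrite andbT.
  by have := h _ _ _ E' ar'; rewrite size_rcons.
exact: (H s [::] [::]).
Qed.

Hypothesis J0 : forall Z, 0 <= J Z.
Variable P : pred T.
Hypothesis after : forall F Z, P F -> P Z -> full F -> hi F <= lo Z -> M Z <= J F + (hi Z - lo F).
Hypothesis before : forall F Z, P F -> P Z -> full F -> hi Z <= lo F -> M Z <= J F + (hi F - lo Z).

(** The induction reads the list from left to right, after a prefix in which F is
the last full element, followed by c elements that are not full; x is the value of
hi at the last element of the prefix.  Each element that is not full is compared
with the full element that precedes it, which serves at most k times. *)
Lemma sum_run_after s k c (F : T) (x A1 : R) :
  pairwise (fun Z Z' => hi Z <= lo Z') s -> runs_le k c s -> full F ->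
  P F -> all P s ->
  (forall Z, Z \in s -> [/\ x <= lo Z, lo Z <= hi Z & hi Z <= A1]) ->
  lo F <= x -> hi F <= x -> x <= A1 -> c%:R <= k ->
  \sum_(Z <- s | ~~ full Z) M Z <=
    (k - c%:R) * J F + k * (\sum_(Z <- s | full Z) J Z) + k * (A1 - lo F) - c%:R * (x - lo F).
Proof.
elim: s c F x => [|Z s IH] c F x /=.
  move=> _ _ _ _ _ _ Fx _ xA ck; rewrite !big_nil mulr0 addr0.
  have H1 : 0 <= (k - c%:R) * J F by rewrite mulr_ge0 ?subr_ge0.
  have k0 : 0 <= k by apply: le_trans ck.
  have H2 : c%:R * (x - lo F) <= k * (A1 - lo F).
    by apply: ler_pM => //; [rewrite subr_ge0|rewrite lerB].
  lra.
move=> /andP[hZ ps] rl fF PF /andP[PZ aP] h Fx hFx xA ck; rewrite !big_cons.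
have k0 : 0 <= k by apply: le_trans ck.
have [h1 h2 h3] := h Z (mem_head _ _).
have hs : forall Z', Z' \in s -> [/\ hi Z <= lo Z', lo Z' <= hi Z' & hi Z' <= A1].
  move=> Z' Z's; have [] := h Z'; first by rewrite in_cons Z's orbT.
  by move=> _ k1 k2; split=> //; move/allP: hZ; apply.
move: rl; have [fZ|nZ] := boolP (full Z) => /= rl.
  have := IH 0%N Z (hi Z) ps rl fZ PZ aP hs h2 (lexx _) h3 k0.
  rewrite subr0 mul0r subr0.
  have H1 : c%:R * (x - lo F) <= k * (lo Z - lo F).
    by apply: ler_pM => //; [rewrite subr_ge0|rewrite lerB].
  have H2 : 0 <= (k - c%:R) * J F by rewrite mulr_ge0 ?subr_ge0.
  by rewrite mulrDr; lra.
case/andP: rl => ck1 rl.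
have := IH c.+1 F (hi Z) ps rl fF PF aP hs _ _ h3 ck1.
have Fx' : lo F <= hi Z by lra.
have hFx' : hi F <= hi Z by lra.
move=> /(_ Fx' hFx').
have MZ : M Z <= J F + (hi Z - lo F) by apply: after => //; lra.
have H1 : c%:R * (x - lo F) <= c%:R * (hi Z - lo F) by apply: ler_wpM2l => //; lra.
rewrite -[c.+1%:R]natr1; move: (\sum_(Z <- s | _) _) (\sum_(Z <- s | _) _) => S1 S2.
have -> : (k - (c%:R + 1)) * J F = (k - c%:R) * J F - J F by lra.
have -> : (c%:R + 1) * (hi Z - lo F) = c%:R * (hi Z - lo F) + (hi Z - lo F) by lra.
lra.
Qed.

(** The elements before the first full one are compared with it, the others with
the full element that precedes them; either comparison uses a full element at most
k times, whence the factor 2 k. *)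
Lemma sum_run s k (A0 A1 : R) : 0 <= k -> has full s ->
  pairwise (fun Z Z' => hi Z <= lo Z') s -> runs_le k 0 s -> all P s ->
  (forall Z, Z \in s -> [/\ A0 <= lo Z, lo Z <= hi Z & hi Z <= A1]) ->
  \sum_(Z <- s | ~~ full Z) M Z <=
    2 * k * (\sum_(Z <- s | full Z) J Z + (A1 - A0)).
Proof.
move=> k0.
suff H c : c%:R <= k -> has full s -> pairwise (fun Z Z' => hi Z <= lo Z') s -> runs_le k c s -> all P s ->
  (forall Z, Z \in s -> [/\ A0 <= lo Z, lo Z <= hi Z & hi Z <= A1]) ->
  exists F, [/\ F \in s, full F & \sum_(Z <- s | ~~ full Z) M Z <=
    (k - c%:R) * (J F + (A1 - A0)) + k * (\sum_(Z <- s | full Z) J Z + (A1 - A0))].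
  move=> hf ps rl aP h; have [F [Fs fF /le_trans]] := H 0%N k0 hf ps rl aP h; apply.
  rewrite subr0 -mulrA mulr2n mulrDl mul1r lerD2r; apply: ler_wpM2l => //; rewrite lerD2r.
  rewrite (big_rem F)//= fF lerDl; apply: sumr_ge0 => Z _; exact: J0.
elim: s c => [//|Z s IH] c /= ck hf /andP[hZ ps] rl /andP[PZ aP] h.
have [h1 h2 h3] := h Z (mem_head _ _).
have hs : forall Z', Z' \in s -> [/\ hi Z <= lo Z', lo Z' <= hi Z' & hi Z' <= A1].
  move=> Z' Z's; have [] := h Z'; first by rewrite in_cons Z's orbT.
  by move=> _ k1 k2; split=> //; move/allP: hZ; apply.
have hs' : forall Z', Z' \in s -> [/\ A0 <= lo Z', lo Z' <= hi Z' & hi Z' <= A1].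
  by move=> Z' /hs[? ? ?]; split=> //; lra.
move: rl hf; have [fZ|nZ] := boolP (full Z) => /= rl hf.
  exists Z; split=> //; first exact: mem_head.
  rewrite !big_cons fZ /=.
  have := sum_run_after ps rl fZ PZ aP hs h2 (lexx _) h3 k0.
  rewrite subr0 mul0r subr0.
  have H1 : 0 <= (k - c%:R) * (J Z + (A1 - A0)).
    by rewrite mulr_ge0 ?subr_ge0// addr_ge0//; lra.
  have H2 : k * (A1 - lo Z) <= k * (A1 - A0) by apply: ler_wpM2l => //; lra.
  by rewrite !mulrDr; rewrite mulrDr in H1; lra.
case/andP: rl => ck1 rl.
have [F [Fs fF HF]] := IH c.+1 ck1 hf ps rl aP hs'.
exists F; split=> //; first by rewrite in_cons Fs orbT.
rewrite !big_cons nZ (negbTE nZ).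
have [g1 g2 g3] := hs _ Fs.
have MZ : M Z <= J F + (hi F - lo Z) by apply: before => //; move/allP: aP; apply.
move: HF; rewrite -[c.+1%:R]natr1; move: (\sum_(Z <- s | _) _) (\sum_(Z <- s | _) _) => S1 S2.
have -> : (k - (c%:R + 1)) * (J F + (A1 - A0)) = (k - c%:R) * (J F + (A1 - A0)) - (J F + (A1 - A0)) by lra.
lra.
Qed.

End Runs.

Section ListSums.
Context {R : realType} {T : eqType}.
Implicit Types (s : seq T) (F : T -> R).

Lemma count_le_sum s (p : pred T) (m : R) F :
  (forall Z, Z \in s -> p Z -> m <= F Z) -> (count p s)%:R * m <= \sum_(Z <- s | p Z) F Z.
Proof.
elim: s => [|Z s IH] h; first by rewrite big_nil mul0r.
have {}IH : (count p s)%:R * m <= \sum_(Z <- s | p Z) F Z.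
  by apply: IH => Z' Zs; apply: h; rewrite in_cons Zs orbT.
rewrite big_cons /=; case: (boolP (p Z)) => pZ; last by rewrite add0n.
by rewrite natrD mulrDl mul1r lerD// h// mem_head.
Qed.

Lemma sum_le_size s (c : R) F : (forall Z, Z \in s -> F Z <= c) ->
  \sum_(Z <- s) F Z <= (size s)%:R * c.
Proof.
elim: s => [|Z s IH] h; first by rewrite big_nil mul0r.
rewrite big_cons /= -natr1 mulrDl mul1r addrC; apply: lerD; last by rewrite h// mem_head.
by apply: IH => Z' Zs; apply: h; rewrite in_cons Zs orbT.
Qed.

End ListSums.

Section OrderedIntervals.
Context {R : realType}.
Implicit Types (Q : set (set R)) (Z : set R).

Definition ahead Z Z' := forall x y, Z x -> Z' y -> x < y.

(** Sort by the order of a chosen point in each interval: for disjoint intervals, two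
chosen points compare as all the others do. *)
Lemma sort_intervals Q : finite_set Q -> (forall Z, Q Z -> is_interval Z /\ Z !=set0) ->
  trivIset Q id -> exists s : seq (set R), [/\ uniq s, forall Z, Q Z <-> Z \in s
    & pairwise (fun Z Z' => `[< ahead Z Z' >]) s].
Proof.
move=> fQ hQ tQ.
pose pt Z : R := xget 0 Z.
pose s := sort (fun Z Z' => pt Z <= pt Z') (fset_set Q).
have sQ Z : (Z \in s) = (Z \in Q) by rewrite mem_sort in_fset_set.
have us : uniq s by rewrite sort_uniq fset_uniq.
have ss : sorted (fun Z Z' => pt Z <= pt Z') s by apply: sort_sorted => x y; exact: le_total.
exists s; split=> //; first by move=> Z; rewrite sQ inE.
have : all (mem Q) s by apply/allP => Z; rewrite sQ.
move: us; have := ss; rewrite sorted_pairwise; last by move=> y x z; exact: le_trans.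
elim: s {ss sQ} => [//|Z s IH] /= /andP[hZ ps] /andP[nZ us] /andP[QZ aQ].
rewrite IH// andbT; apply/allP => Z' Z's; apply/asboolP => x y Zx Zy.
move/allP: hZ => /(_ _ Z's) le_pt.
have QZ' : Q Z' by move/allP: aQ => /(_ _ Z's); rewrite inE.
have {}QZ : Q Z by move: QZ; rewrite inE.
have [iZ _] := hQ _ QZ; have [iZ' _] := hQ _ QZ'.
have Zp : Z (pt Z) by apply: xgetI Zx.
have Zp' : Z' (pt Z') by apply: xgetI Zy.
rewrite ltNge; apply/negP => yx.
have dis z : Z z -> Z' z -> False.
  move=> Zz Zz'; have E : Z = Z' by apply: (tQ Z Z') => //; exists z.
  by rewrite E Z's in nZ.
case: (leP (pt Z) y) => py.
  by apply: (dis y) => //; apply: (iZ _ _ Zp Zx); rewrite py.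
by apply: (dis (pt Z)) => //; apply: (iZ' _ _ Zy Zp'); rewrite (ltW py).
Qed.

Lemma Rhull_bounds (A : set R) x : [set` Rhull A] x ->
  (exists2 y, A y & y <= x) /\ (exists2 z, A z & x <= z).
Proof.
rewrite Rhull_smallest => /(_ [set x | (exists2 y, A y & y <= x) /\ (exists2 z, A z & x <= z)]).
apply; split.
  move=> y z [[u Au uy] _] [_ [v Av zv]] t /andP[yt tz]; split.
    by exists u => //; exact: le_trans yt.
  by exists v => //; exact: le_trans zv.
by move=> y Ay; split; exists y.
Qed.

End OrderedIntervals.

(** * The transfer operator of one map *)

Section OneMap.
Context {R : realType} (a b : R).
Implicit Types (f h u : R -> R) (Z : set R).
Local Notation I := (Icc a b).
Local Notation BV := (inBV a b).
Local Notation leb := (@lebesgue_measure R).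

Definition branch (T : R -> R) Z u (y : R) : R :=
  \1_(T @` Z) y * u ('pinv_(fun=> 0) Z T y).

Definition Lop (T g : R -> R) (Q : set (set R)) f (y : R) : R :=
  \sum_(Z \in Q) branch T Z (f \* g) y.

Definition fullb (T : R -> R) Z : bool := `[< leb (I `\` (T @` Z)) = 0%E >].

Record branch_data (T g : R -> R) (Q : set (set R)) (X : set R) : Prop := BranchData {
  bd_ab : a < b;
  bd_T : forall x, I x -> I (T x);
  bd_fin : finite_set Q;
  bd_itv : forall Z, Q Z -> [/\ is_interval Z, (0 < leb Z)%E & Z `<=` X];
  bd_X : X `<=` I;
  bd_mX : measurable (X : set (measurableTypeR R));
  bd_triv : trivIset Q id;
  bd_mono : forall Z, Q Z -> monotone_continuous_on Z T;
  bd_full : exists2 Z, Q Z & fullb T Z;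
  bd_BV : BV g;
  bd_pos : forall x, I x -> 0 < g x }.

Variables (T g : R -> R) (Q : set (set R)) (X : set R).
Hypothesis bd : branch_data T g Q X.
Let ab : a < b := bd_ab bd.

Lemma bd_sub Z x : Q Z -> Z x -> I x.
Proof. by move=> QZ Zx; case: (bd_itv bd QZ) => _ _ /(_ _ Zx)/(bd_X bd). Qed.

Lemma bd_ne Z : Q Z -> Z !=set0.
Proof.
move=> QZ; apply/set0P/eqP => Z0; case: (bd_itv bd QZ) => _ + _.
by rewrite Z0 measure0 ltxx.
Qed.

Lemma bd_inj Z : Q Z -> {in Z &, injective T}.
Proof.
move=> QZ x y /set_mem Zx /set_mem Zy e; case: (bd_mono bd QZ) => _ mono.
case: (ltgtP x y) => // xy; case: mono => mono.
- by have := mono _ _ Zx Zy xy; rewrite e ltxx.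
- by have := mono _ _ Zx Zy xy; rewrite e ltxx.
- by have := mono _ _ Zy Zx xy; rewrite e ltxx.
- by have := mono _ _ Zy Zx xy; rewrite e ltxx.
Qed.

Lemma branch_in Z u x : Q Z -> Z x -> branch T Z u (T x) = u x.
Proof.
move=> QZ Zx; rewrite /branch indicE mem_set ?mul1r; last by exists x.
by rewrite (pinvKV _ (bd_inj QZ)) ?inE.
Qed.

Lemma branch_out Z u y : ~ (T @` Z) y -> branch T Z u y = 0.
Proof. by move=> h; rewrite /branch indicE memNset// mul0r. Qed.

Lemma image_itv Z : Q Z -> is_interval (T @` Z).
Proof.
move=> QZ; apply/connected_intervalP; apply: connected_continuous_connected.
  by apply/connected_intervalP; case: (bd_itv bd QZ).
by case: (bd_mono bd QZ).
Qed.

(** The image of Z is an interval: if it missed a point of ]a, b[, it would miss an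
interval of positive length. *)
Lemma full_interior Z y : Q Z -> fullb T Z -> a < y < b -> (T @` Z) y.
Proof.
move=> QZ /asboolP f0 /andP[ay yb]; apply: contrapT => nJ.
have [x Zx] := bd_ne QZ.
have mJ : measurable (I `\` (T @` Z) : set (measurableTypeR R)).
  by apply: measurableD; [exact: Icc_meas|apply: (@is_interval_measurable R); exact: image_itv].
have key (c d : R) : a <= c -> d <= b -> c < d -> ~ (`]c, d[%classic `<=` ~` (T @` Z)).
  move=> ac db cd sub.
  have : `]c, d[%classic `<=` I `\` (T @` Z).
    move=> t tcd; split; last exact: sub.
    move: tcd => /=; rewrite in_itv/= => /andP[ct td]; apply/IccP.
    by rewrite (le_trans ac (ltW ct)) (le_trans (ltW td) db).
  move=> /(@le_measure _ _ _ leb); rewrite !inE => /(_ (measurable_itv _) mJ).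
  rewrite [X in (_ <= X)%E]f0.
  have E : leb `]c, d[%classic = (d - c)%:E by rewrite lebesgue_measure_itv/= lte_fin cd.
  by rewrite [X in (X <= _)%E]E lee_fin subr_le0 leNgt cd.
case: (leP y (T x)) => yx.
  have {}yx : y < T x by rewrite lt_neqAle yx andbT; apply/eqP => e; apply: nJ; exists x.
  apply: (key a y) => //; first exact: ltW.
  move=> t /=; rewrite in_itv/= => /andP[_ ty] Jt; apply: nJ.
  by apply: (image_itv QZ Jt (y:=T x)); [exists x|rewrite (ltW ty) (ltW yx)].
apply: (key y b) => //; first exact: ltW.
move=> t /=; rewrite in_itv/= => /andP[yt _] Jt; apply: nJ.
by apply: (image_itv QZ (x:=T x) _ Jt); [exists x|rewrite (ltW yt) (ltW yx)].
Qed.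

Lemma branch_ctl_in Z u V w : Q Z -> ctl Z u V -> osc_le Z V w ->
  exists W, ctl (T @` Z) (branch T Z u) W /\ osc_le (T @` Z) W w.
Proof.
move=> QZ c o; case: (bd_mono bd QZ) => _ [inc|dec].
  exists (branch T Z V); split=> [_ _ [x Zx <-] [y Zy <-] xy|_ _ [x Zx <-] [y Zy <-]].
    rewrite !branch_in//; apply: c => //; rewrite leNgt; apply/negP => yx.
    by have := inc _ _ Zy Zx yx; rewrite ltNge xy.
  by rewrite !branch_in//; exact: o.
exists (branch T Z (fun x => - V x)); split=> [_ _ [x Zx <-] [y Zy <-] xy|_ _ [x Zx <-] [y Zy <-]].
  rewrite !branch_in// distrC (_ : - V y - - V x = V x - V y); last by lra.
  apply: c => //; rewrite leNgt; apply/negP => yx.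
  by have := dec _ _ Zx Zy yx; rewrite ltNge xy.
by rewrite !branch_in// (_ : - V y - - V x = V x - V y); [exact: o|lra].
Qed.

(** The two jumps at the ends of the image cost twice the bound of u. *)
Lemma branch_ctl Z u V w M : Q Z -> ctl Z u V -> osc_le Z V w -> 
  (forall x, Z x -> `|u x| <= M) ->
  exists W, ctl setT (branch T Z u) W /\ osc_le setT W (w + 2 * M).
Proof.
move=> QZ c o bu; have [W0 [c0 o0]] := branch_ctl_in QZ c o.
have [x0 Zx0] := bd_ne QZ; set J := T @` Z in c0 o0.
have Jx0 : J (T x0) by exists x0.
have M0 : 0 <= M by apply: le_trans (bu _ Zx0).
have iJ := image_itv QZ.
pose m := inf [set W0 y | y in J].
have hi : has_inf [set W0 y | y in J].
  split; first by exists (W0 (T x0)), (T x0).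
  by exists (W0 (T x0) - w) => _ [y Jy <-]; have := o0 _ _ Jy Jx0; lra.
have mb y : J y -> m <= W0 y <= m + w.
  move=> Jy; apply/andP; split; first by apply: ge_inf; [case: hi|exists y].
  rewrite -lerBlDr; apply: lb_le_inf; first by case: hi.
  by move=> _ [z Jz <-]; have := o0 _ _ Jz Jy; lra.
have w0 : 0 <= w by case/andP: (mb _ Jx0); lra.
have bJ y : `|branch T Z u y| <= M.
  case: (pselect (J y)) => [[x Zx <-]|nJ]; first by rewrite branch_in// bu.
  by rewrite branch_out// normr0.
pose W y := if `[< J y >] then M + (W0 y - m) else if y < T x0 then 0 else 2 * M + w.
have WJ y : J y -> W y = M + (W0 y - m) by move=> h; rewrite /W asboolT.
have Wl y : ~ J y -> y < T x0 -> W y = 0 by move=> h yx; rewrite /W asboolF// yx.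
have Wr y : ~ J y -> T x0 < y -> W y = 2 * M + w.
  by move=> h yx; rewrite /W asboolF// ltNge (ltW yx).
have nJ y : ~ J y -> y < T x0 \/ T x0 < y.
  by move=> ny; case: (ltgtP y (T x0)) => [| |e]; [left|right|case: ny; rewrite e].
have Wb y : 0 <= W y <= w + 2 * M.
  case: (pselect (J y)) => [Jy|ny]; first by rewrite WJ//; case/andP: (mb _ Jy) => ? ?; apply/andP; split; lra.
  by case: (nJ _ ny) => h; [rewrite Wl|rewrite Wr]; rewrite ?lexx//; apply/andP; split; lra.
exists W; split; last by move=> x y _ _; case/andP: (Wb x); case/andP: (Wb y); lra.
move=> x y _ _ xy.
have := bJ x; have := bJ y.
case: (pselect (J x)) => [Jx|nx]; case: (pselect (J y)) => [Jy|ny].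
- by move=> _ _; rewrite (WJ x Jx) (WJ y Jy); have := c0 _ _ Jx Jy xy; lra.
- rewrite [branch T Z u y]branch_out// sub0r normrN => _ h.
  have yr : T x0 < y.
    case: (nJ _ ny) => // yl; exfalso; apply: ny.
    by apply: (iJ _ _ Jx Jx0); rewrite xy ltW.
  by rewrite (WJ x Jx) (Wr y)//; case/andP: (mb _ Jx); lra.
- rewrite [branch T Z u x]branch_out// subr0 => h _.
  have xl : x < T x0.
    case: (nJ _ nx) => // yl; exfalso; apply: nx.
    by apply: (iJ _ _ Jx0 Jy); rewrite xy ltW.
  by rewrite (WJ y Jy) (Wl x)//; case/andP: (mb _ Jy); lra.
- rewrite !branch_out// subrr normr0 => _ _.
  case: (nJ _ nx) => hx; case: (nJ _ ny) => hy.
  + by rewrite !Wl// subrr.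
  + by rewrite (Wl x)// (Wr y)//; lra.
  + by have := lt_le_trans hx xy; rewrite ltNge (ltW hy).
  + by rewrite !Wr// subrr.
Qed.

Lemma sorted_branches : exists s : seq (set R), [/\ uniq s, forall Z, Q Z <-> Z \in s,
  pairwise (fun Z Z' => `[< ahead Z Z' >]) s, fset_set Q =i s
  & forall f y, Lop T g Q f y = \sum_(Z <- s) branch T Z (f \* g) y].
Proof.
have [|s [us Qs ps]] := sort_intervals (bd_fin bd) _ (bd_triv bd).
  by move=> Z QZ; split; [case: (bd_itv bd QZ)|exact: bd_ne].
have e : fset_set Q =i s.
  move=> Z; rewrite in_fset_set; last exact: bd_fin bd.
  by apply/idP/idP => [/set_mem/Qs|/Qs/mem_set].
exists s; split=> // f y; rewrite /Lop fsbig_finite; last exact: bd_fin bd.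
by apply: perm_big; apply: uniq_perm => //; exact: fset_uniq.
Qed.

Lemma Lop_lin k l f h : Lop T g Q (fun t => k * f t + l * h t) =
  (fun t => k * Lop T g Q f t + l * Lop T g Q h t).
Proof.
have [s [_ _ _ _ E]] := sorted_branches; apply/funext => t; rewrite !E !big_distrr/= -big_split/=.
by apply: eq_bigr => Z _; rewrite /branch /=; ring.
Qed.

Lemma Lop_linear : linear_op (Lop T g Q).
Proof. exact: Lop_lin. Qed.

Lemma Lop_BV f : BV f -> BV (Lop T g Q f).
Proof.
move=> hf; have [s [_ Qs _ _ E]] := sorted_branches.
have -> : Lop T g Q f = (fun y => \sum_(Z <- s) branch T Z (f \* g) y) by apply/funext.
have hu : BV (f \* g) by apply: BV_mul => //; exact: bd_BV bd.
have [V [c _ _]] := BV_ctl hu; have [B _ bB] := BV_bnd ab hu.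
have H Z : Z \in s -> BV (branch T Z (f \* g)).
  move=> /Qs QZ; have sub : Z `<=` I by move=> x; exact: bd_sub.
  have [W [cW _]] := branch_ctl QZ (ctl_sub sub c) (osc_sub sub (ctl_osc ab c)) (fun x Zx => bB x (sub x Zx)).
  exact: (ctl_BV ab (ctl_sub (@subsetT _ _) cW)).
elim: s {E Qs} H => [|Z s IH] H.
  by under eq_fun do rewrite big_nil; exact: BV_cst.
under eq_fun do rewrite big_cons; apply: BV_add => //; first by apply: H; exact: mem_head.
by apply: IH => Z' Z's; apply: H; rewrite in_cons Z's orbT.
Qed.

(** The exceptional points y are images of exceptional points x.  A null set would
not do here, since its image by T need not be null. *)
Lemma coc_preimage (P : R -> Prop) : coc a b P ->
  coc a b (fun y => forall x, I x -> T x = y -> P x).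
Proof.
move=> cP; apply: sub_countable cP; apply: card_le_trans (card_image_le T _).
apply: subset_card_le => y [_ /existsNP[x /not_implyP[ix /not_implyP[<- nP]]]].
by exists x.
Qed.

Lemma branch_le Z u v y : Q Z -> (forall x, Z x -> T x = y -> u x <= v x) ->
  branch T Z u y <= branch T Z v y.
Proof.
move=> QZ h; case: (pselect ((T @` Z) y)) => [[x Zx xy]|ny]; last by rewrite !branch_out.
by rewrite -xy !branch_in//; exact: h.
Qed.

Lemma Lop_mono f h : coc a b (fun x => f x <= h x) ->
  coc a b (fun y => Lop T g Q f y <= Lop T g Q h y).
Proof.
move=> /coc_preimage; have [s [_ Qs _ _ E]] := sorted_branches.
apply: coc_sub => y iy hy; rewrite !E; rewrite !big_seq; apply: ler_sum => Z /Qs QZ.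
apply: branch_le => // x Zx xy /=; have ix := bd_sub QZ Zx.
by rewrite ler_pM2r ?(bd_pos bd)//; exact: hy.
Qed.

Lemma Lop_coc f h : coc a b (fun x => f x = h x) ->
  coc a b (fun y => Lop T g Q f y = Lop T g Q h y).
Proof.
move=> e; have h1 : coc a b (fun x => f x <= h x) by apply: coc_sub e => x _ ->.
have h2 : coc a b (fun x => h x <= f x) by apply: coc_sub e => x _ ->.
apply: coc2 (Lop_mono h1) (Lop_mono h2) _ => x _ k1 k2; apply/le_anti/andP; split=> //.
Qed.

(** ** The Lasota-Yorke inequality *)

Definition contig (D : set (set R)) := D `<=` [set Z | Q Z /\ ~~ fullb T Z] /\
  forall Z, Q Z -> fullb T Z -> ~ Z `<=` [set` Rhull (\bigcup_(Y in D) Y)].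

Variable xi : R.
Hypothesis xi0 : 0 <= xi.
Hypothesis xi_le : forall D, contig D -> (#|` fset_set D|%N)%:R <= xi.

(** A full element in the convex hull of a run lies between two members of the run,
hence belongs to it. *)
Lemma runs_contig s : uniq s -> (forall Z, Q Z <-> Z \in s) ->
  pairwise (fun Z Z' => `[< ahead Z Z' >]) s -> runs_le (fullb T) xi 0 s.
Proof.
move=> us Qs ps; apply: runs_leP => // s1 r s2 E ar.
have fr : finite_set [set` r] by exact: finite_seq.
have ur : uniq r by move: us; rewrite E !cat_uniq => /and3P[_ _ /and3P[]].
have -> : size r = #|` fset_set [set` r]|.
  apply/perm_size/uniq_perm => //; first exact: fset_uniq.
  by move=> Z; rewrite in_fset_set// mem_setE.
apply: xi_le; split.
  move=> Z /= Zr; split; last by move/allP: ar; apply.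
  by apply/Qs; rewrite E !mem_cat Zr orbT.
move=> Z QZ fZ hull; have [x Zx] := bd_ne QZ.
have [[y [Y /= Yr Yy] yx] [z [W /= Wr Wz] xz]] := Rhull_bounds (hull _ Zx).
have Zs : Z \in s by apply/Qs.
have nZr : Z \notin r by apply/negP => Zr; move/allP: ar => /(_ _ Zr)/=; rewrite fZ.
move: ps; rewrite E !pairwise_cat => /and3P[+ _ /and3P[+ _ _]].
rewrite allrel_catr => /andP[/allrelP a1 _] /allrelP a2.
move: Zs; rewrite E !mem_cat (negbTE nZr) /= => /orP[Z1|Z2].
  have /asboolP := a1 _ _ Z1 Yr; move=> /(_ _ _ Zx Yy); by rewrite ltNge yx.
have /asboolP := a2 _ _ Wr Z2; move=> /(_ _ _ Wz Zx); by rewrite ltNge xz.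
Qed.

Variables gi : R.
Hypothesis gi0 : 0 < gi.
Hypothesis gi_le : coc a b (fun x => X x -> gi <= g x).

Let G := norm_oo a b g.
Let vg := var a b g.
Let nb := (#|` fset_set [set Z | Q Z /\ fullb T Z]|%N)%:R : R.

(** E is the sum over the full elements Z of the infimum of f over Z.  Every full
branch contributes at least gi times this infimum at every interior point, whence
the two lower bounds.  The variation of the image is at most the sum over all
branches of the oscillation of a control of f g, plus two jumps of size at most
G sup_Z f for each branch that is not full.  The suprema over these Z are bounded by
E + var f in total, up to the factor 2 xi: this is [sum_run]. *)
Lemma LY_aux f : BV f -> coc a b (fun x => 0 <= f x) -> exists E : R,
  [/\ nb * Einf I f <= E, gi * E <= Einf I (Lop T g Q f)
    & var a b (Lop T g Q f) <= (G + vg + 4 * xi * G) * (E + var a b f)].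
Proof.
move=> hf f0; have bg := bd_BV bd.
have [s [us Qs ps es LE]] := sorted_branches.
have [B B0 bB] := BV_bnd ab hf.
set m := Einf I f; have m0 : 0 <= m by apply: le_Einf.
have cf : coc a b (fun x => m <= f x <= B).
  apply: coc_sub (BV_Einf ab hf) => x ix ->; exact: le_trans (ler_norm _) (bB _ ix).
(* Representatives of least variation, with controls on the whole line: they are
   used in the estimates on each branch, and f and g are recovered at the end. *)
have [h [V [he ch oh hb]]] := min_rep ab hf cf.
have cg : coc a b (fun x => 0 <= g x <= G).
  apply: coc_sub (BV_norm_oo ab bg) => x ix gx; rewrite (ltW (bd_pos bd ix))/=.
  exact: le_trans (ler_norm _) gx.
have [k [W [ke ck ok kb]]] := min_rep ab bg cg.
have G0 : 0 <= G by exact: norm_oo_ge0.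
pose vf := var a b f; have vf0 : 0 <= vf by exact: var_ge0.
have vg0 : 0 <= vg by exact: var_ge0.
pose M Z := sup [set h x | x in Z]; pose J Z := inf [set h x | x in Z].
pose lo Z := inf [set V x | x in Z]; pose hi Z := sup [set V x | x in Z].
pose wlo Z := inf [set W x | x in Z]; pose whi Z := sup [set W x | x in Z].
have Msup Z x : Z x -> h x <= M Z.
  move=> Zx; apply: ub_le_sup; last by exists x.
  by exists B => _ [y _ <-]; case/andP: (hb y).
have Jinf Z x : Z x -> J Z <= h x.
  move=> Zx; apply: ge_inf; last by exists x.
  by exists m => _ [y _ <-]; case/andP: (hb y).
have bnd (V' : R -> R) (v x0 : R) : osc_le setT V' v ->
    (forall Z, has_ubound [set V' x | x in Z]) /\ (forall Z, has_lbound [set V' x | x in Z]).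
  move=> o; split=> Z; [exists (V' x0 + v)|exists (V' x0 - v)] => _ [y _ <-].
    by have := o x0 y Logic.I Logic.I; lra.
  by have := o y x0 Logic.I Logic.I; lra.
have [Vu Vl] := bnd _ _ a oh; have [Wu Wl] := bnd _ _ a ok.
have hiS Z x : Z x -> V x <= hi Z by move=> Zx; apply: ub_le_sup => //; exists x.
have loS Z x : Z x -> lo Z <= V x by move=> Zx; apply: ge_inf => //; exists x.
have whiS Z x : Z x -> W x <= whi Z by move=> Zx; apply: ub_le_sup => //; exists x.
have wloS Z x : Z x -> wlo Z <= W x by move=> Zx; apply: ge_inf => //; exists x.
have supP (V' : R -> R) Z c : Q Z -> (forall x, Z x -> V' x <= c) -> sup [set V' x | x in Z] <= c.
  move=> QZ hc; have [x Zx] := bd_ne QZ; apply: ge_sup; first by exists (V' x), x.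
  by move=> _ [y Zy <-]; exact: hc.
have infP (V' : R -> R) Z c : Q Z -> (forall x, Z x -> c <= V' x) -> c <= inf [set V' x | x in Z].
  move=> QZ hc; have [x Zx] := bd_ne QZ; apply: lb_le_inf; first by exists (V' x), x.
  by move=> _ [y Zy <-]; exact: hc.
have Vm x y : x <= y -> V x <= V y by move=> xy; apply: (ctl_mono ch).
have Wm x y : x <= y -> W x <= W y by move=> xy; apply: (ctl_mono ck).
pose V0 := V a; pose W0 := W a.
have ordV (Z Z' : set R) : Q Z -> Q Z' -> ahead Z Z' -> hi Z <= lo Z'.
  move=> QZ QZ' az; apply: (supP _ _ _ QZ) => x Zx; apply: (infP _ _ _ QZ') => y Zy.
  exact/Vm/ltW/az.
have ordW (Z Z' : set R) : Q Z -> Q Z' -> ahead Z Z' -> whi Z <= wlo Z'.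
  move=> QZ QZ' az; apply: (supP _ _ _ QZ) => x Zx; apply: (infP _ _ _ QZ') => y Zy.
  exact/Wm/ltW/az.
have ps_in (r : rel (set R)) : (forall Z Z', Q Z -> Q Z' -> ahead Z Z' -> r Z Z') -> pairwise r s.
  move=> hr; apply: (sub_in_pairwise (P := mem s)) ps; last exact/allP.
  by move=> Z Z' /Qs QZ /Qs QZ' /asboolP; exact: hr.
have pV : pairwise (fun Z Z' => hi Z <= lo Z') s by exact: ps_in.
have pW : pairwise (fun Z Z' => whi Z <= wlo Z') s by exact: ps_in.
have itvV Z : Z \in s -> [/\ V a <= lo Z, lo Z <= hi Z & hi Z <= V b].
  move=> /Qs QZ; have [x0 Zx0] := bd_ne QZ; split.
  - by apply: (infP _ _ _ QZ) => x /(bd_sub QZ)/IccP/andP[ax _]; exact: Vm.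
  - exact: le_trans (loS _ _ Zx0) (hiS _ _ Zx0).
  - by apply: (supP _ _ _ QZ) => x /(bd_sub QZ)/IccP/andP[_ xb]; exact: Vm.
have itvW Z : Z \in s -> [/\ W a <= wlo Z, wlo Z <= whi Z & whi Z <= W b].
  move=> /Qs QZ; have [x0 Zx0] := bd_ne QZ; split.
  - by apply: (infP _ _ _ QZ) => x /(bd_sub QZ)/IccP/andP[ax _]; exact: Wm.
  - exact: le_trans (wloS _ _ Zx0) (whiS _ _ Zx0).
  - by apply: (supP _ _ _ QZ) => x /(bd_sub QZ)/IccP/andP[_ xb]; exact: Wm.
have J0 Z : 0 <= J Z.
  case: (pselect (Z !=set0)) => [[x Zx]|/set0P/negP/negPn/eqP ->]; last by rewrite /J image_set0 inf0.
  apply: lb_le_inf; first by exists (h x), x.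
  by move=> _ [y _ <-]; case/andP: (hb y) => + _; exact: le_trans.
have M0 Z : Q Z -> 0 <= M Z.
  move=> QZ; have [x Zx] := bd_ne QZ; apply: le_trans (Msup _ _ Zx).
  by case/andP: (hb x) => + _; exact: le_trans.
have hV x y : h x <= h y + `|V x - V y|.
  have : `|h x - h y| <= `|V x - V y|.
    case: (leP y x) => xy; first exact: le_trans (ch _ _ Logic.I Logic.I xy) (ler_norm _).
    by rewrite distrC [leRHS]distrC; exact: le_trans (ch _ _ Logic.I Logic.I (ltW xy)) (ler_norm _).
  by have := ler_norm (h x - h y); lra.
have MJ (F Z : set R) (c : R) : Q F -> Q Z -> (forall x y, Z x -> F y -> `|V x - V y| <= c) -> M Z <= J F + c.
  move=> QF QZ H; apply: (supP _ _ _ QZ) => x Zx; rewrite -lerBlDr; apply: (infP _ _ _ QF) => y Fy.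
  by have := hV x y; have := H _ _ Zx Fy; lra.
have after F Z : Q F -> Q Z -> fullb T F -> hi F <= lo Z -> M Z <= J F + (hi Z - lo F).
  move=> QF QZ _ FZ; apply: MJ => // x y Zx Fy.
  have := hiS _ _ Zx; have := loS _ _ Zx; have := hiS _ _ Fy; have := loS _ _ Fy => h1 h2 h3 h4.
  by rewrite ger0_norm; lra.
have before F Z : Q F -> Q Z -> fullb T F -> hi Z <= lo F -> M Z <= J F + (hi F - lo Z).
  move=> QF QZ _ FZ; apply: MJ => // x y Zx Fy.
  have := hiS _ _ Zx; have := loS _ _ Zx; have := hiS _ _ Fy; have := loS _ _ Fy => h1 h2 h3 h4.
  by rewrite ler0_norm; lra.
have Vab : V a <= V b by apply: Vm; exact: ltW.
have Wab : W a <= W b by apply: Wm; exact: ltW.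
have hf' : has (fullb T) s by have [F QF fF] := bd_full bd; apply/hasP; exists F => //; exact/Qs.
have aP : all [pred Z | `[< Q Z >]] s by apply/allP => Z Zs; apply/asboolP/Qs.
have SR : \sum_(Z <- s | ~~ fullb T Z) M Z <= 2 * xi * (\sum_(Z <- s | fullb T Z) J Z + (V b - V a)).
  apply: (sum_run (P:=[pred Z | `[< Q Z >]]) J0 _ _ xi0 hf' pV (runs_contig us Qs ps) aP itvV).
    by move=> F Z /asboolP QF /asboolP QZ; exact: after.
  by move=> F Z /asboolP QF /asboolP QZ; exact: before.
have SV := sum_osc_le pV itvV Vab; have SW := sum_osc_le pW itvW Wab.
set E := \sum_(Z <- s | fullb T Z) J Z in SR.
have E0 : 0 <= E by apply: sumr_ge0.
have oV : V b - V a <= vf by exact: oh.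
have oW : W b - W a <= vg by exact: ok.
have MZ Z : Q Z -> M Z <= E + vf.
  move=> QZ; have [F QF fF] := bd_full bd.
  have : J F <= E by rewrite /E (big_rem F) /= ?fF ?lerDl ?sumr_ge0//; exact/Qs.
  have : M Z <= J F + vf.
    apply: MJ => // x y _ _; have h1 := oh x y Logic.I Logic.I; have h2 := oh y x Logic.I Logic.I.
    by rewrite ler_norml; apply/andP; split; rewrite /vf; lra.
  lra.
have cin : coc a b (fun y => a < y < b).
  apply: (@sub_countable _ _ _ [set a; b]); last exact/finite_set_countable.
  apply: subset_card_le => y [/IccP/andP[ay yb] /negP]; rewrite negb_and -!leNgt.
  by case/orP => ?; [left|right]; apply/le_anti; apply/andP.
exists E; split.
- have -> : nb = (count (fullb T) s)%:R.
    rewrite /nb -size_filter; congr (_%:R); apply/perm_size/uniq_perm; [exact: fset_uniq|exact: filter_uniq|].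
    move=> Z; rewrite in_fset_set; last first.
      by apply: sub_finite_set (bd_fin bd) => Z' [].
    by rewrite mem_filter; apply/idP/andP => [/set_mem[/Qs -> ->]//|[fZ /Qs QZ]]; apply/mem_set.
  apply: count_le_sum => Z /Qs QZ _; apply: (infP _ _ _ QZ) => x Zx.
  by case/andP: (hb x).
- apply: (le_Einf ab); first exact: Lop_BV.
  have c1 : coc a b (fun x => h x = f x /\ (0 <= f x /\ (X x -> gi <= g x))).
    exact: coc_and he (coc_and f0 gi_le).
  apply: coc2 cin (coc_preimage c1) _ => y iy yab hy.
  rewrite LE (bigID (fullb T))/= -[leLHS]addr0; apply: lerD.
    rewrite /E mulr_sumr big_seq_cond [leRHS]big_seq_cond.
    apply: ler_sum => Z /andP[/Qs QZ fZ].
    have [x Zx xy] := full_interior QZ fZ yab; have ix := bd_sub QZ Zx.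
    have [e1 [e2 e3]] := hy _ ix xy; rewrite -xy branch_in//= mulrC; apply: ler_pM => //.
    - exact: ltW.
    - by rewrite -e1; exact: Jinf.
    - by apply: e3; case: (bd_itv bd QZ) => _ _; exact.
  rewrite big_seq_cond; apply: sumr_ge0 => Z /andP[/Qs QZ _].
  case: (pselect ((T @` Z) y)) => [[x Zx xy]|ny]; last by rewrite branch_out.
  have ix := bd_sub QZ Zx; have [_ [e2 _]] := hy _ ix xy.
  by rewrite -xy branch_in//= mulr_ge0// ltW// (bd_pos bd).
have c1 : coc a b (fun x => h x = f x /\ k x = g x) by exact: coc_and he ke.
pose D y := a < y < b /\ forall x, I x -> T x = y -> h x = f x /\ k x = g x.
have cD : coc a b D by exact: coc_and cin (coc_preimage c1).
(* The oscillation on the image of Z of a control of the branch Z. *)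
pose w Z := G * (hi Z - lo Z) + M Z * (whi Z - wlo Z) + (if fullb T Z then 0 else 2 * (M Z * G)).
have /choice[WW hWW] Z : exists W', Z \in s ->
    ctl [set y | I y /\ D y] (branch T Z (f \* g)) W' /\ osc_le [set y | I y /\ D y] W' (w Z).
  case: (boolP (Z \in s)) => [/Qs QZ|_]; last by exists (fun=> 0).
  have eb y : I y /\ D y -> branch T Z (f \* g) y = branch T Z (h \* k) y.
    case=> iy [_ hy]; case: (pselect ((T @` Z) y)) => [[x Zx xy]|ny]; last by rewrite !branch_out.
    by rewrite -xy !branch_in//=; have [-> ->] := hy _ (bd_sub QZ Zx) xy.
  have hM x : Z x -> `|h x| <= M Z.
    by move=> Zx; rewrite ger0_norm ?Msup//; case/andP: (hb x) => + _; exact: le_trans.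
  have kG x : Z x -> `|k x| <= G by move=> _; case/andP: (kb x) => k0 k1; rewrite ger0_norm.
  have c := ctlM hM kG (ctl_sub (@subsetT _ Z) ch) (ctl_sub (@subsetT _ Z) ck).
  have o : osc_le Z (fun x => G * V x + M Z * W x) (G * (hi Z - lo Z) + M Z * (whi Z - wlo Z)).
    move=> x y Zx Zy.
    have -> : G * V y + M Z * W y - (G * V x + M Z * W x) = G * (V y - V x) + M Z * (W y - W x) by lra.
    by apply: lerD; apply: ler_wpM2l; rewrite ?M0// lerB// ?hiS ?loS ?whiS ?wloS.
  have tr W' A w' : [set y | I y /\ D y] `<=` A -> w' <= w Z -> ctl A (branch T Z (h \* k)) W' -> osc_le A W' w' ->
      ctl [set y | I y /\ D y] (branch T Z (f \* g)) W' /\ osc_le [set y | I y /\ D y] W' (w Z).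
    move=> sA ww c' o'; split=> x y Dx Dy; first by rewrite (eb x Dx) (eb y Dy); apply: c'; exact: sA.
    by apply: le_trans ww; apply: o'; exact: sA.
  case: (boolP (fullb T Z)) => fZ.
    have [W' [c' o']] := branch_ctl_in QZ c o; exists W' => _.
    apply: (tr _ _ _ _ _ c' o'); last by rewrite /w fZ addr0.
    by move=> y [_ [yab _]]; exact: full_interior.
  have hkM x : Z x -> `|(h \* k) x| <= M Z * G.
    by move=> Zx; rewrite /= normrM; apply: ler_pM => //; [exact: hM|exact: kG].
  have [W' [c' o']] := branch_ctl QZ c o hkM; exists W' => _.
  by apply: (tr _ _ _ _ _ c' o') => //; rewrite /w (negbTE fZ).
have [cS oS] : ctl [set y | I y /\ D y] (fun y => \sum_(Z <- s) branch T Z (f \* g) y) (fun y => \sum_(Z <- s) WW Z y) /\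
    osc_le [set y | I y /\ D y] (fun y => \sum_(Z <- s) WW Z y) (\sum_(Z <- s) w Z).
  split=> x y Dx Dy.
    move=> xy; rewrite -!sumrB big_seq [leRHS]big_seq; apply: le_trans (ler_norm_sum _ _ _) _.
    by apply: ler_sum => Z Zs; apply: (hWW _ Zs).1.
  by rewrite -!sumrB !big_seq; apply: ler_sum => Z Zs; apply: (hWW _ Zs).2.
have -> : Lop T g Q f = (fun y => \sum_(Z <- s) branch T Z (f \* g) y) by apply/funext.
apply: (le_trans (var_le ab cD cS oS)).
rewrite /w !big_split/= -mulr_sumr.
have H1 : G * \sum_(Z <- s) (hi Z - lo Z) <= G * vf by apply: ler_wpM2l => //; lra.
have H2 : \sum_(Z <- s) M Z * (whi Z - wlo Z) <= (E + vf) * vg.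
  apply: le_trans (_ : _ <= (E + vf) * \sum_(Z <- s) (whi Z - wlo Z)) _; last first.
    by apply: ler_wpM2l; [exact: addr_ge0|lra].
  rewrite mulr_sumr !big_seq; apply: ler_sum => Z Zs; apply: ler_wpM2r.
    by case: (itvW _ Zs) => *; lra.
  exact/MZ/Qs.
have H3 : \sum_(Z <- s) (if fullb T Z then 0 else 2 * (M Z * G)) <= 4 * xi * G * (E + vf).
  have -> : \sum_(Z <- s) (if fullb T Z then 0 else 2 * (M Z * G)) = 2 * G * \sum_(Z <- s | ~~ fullb T Z) M Z.
    rewrite mulr_sumr [RHS]big_mkcond/=; apply: eq_bigr => Z _; case: (fullb T Z) => //=; ring.
  apply: le_trans (_ : _ <= 2 * G * (2 * xi * (E + vf))) _; last by rewrite le_eqVlt; apply/orP; left; apply/eqP; ring.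
  apply: ler_wpM2l; first by rewrite mulr_ge0.
  apply: (le_trans SR); apply: ler_wpM2l; first by rewrite mulr_ge0.
  by rewrite lerD2l.
have GE : 0 <= G * E by rewrite mulr_ge0.
by rewrite -/vf; lra.
Qed.

(** In [LY_aux] the factor G + vg + 4 xi G is at most e gi.  The term gi E is at most
the infimum of the image, and as nb full branches contribute at least gi times the
infimum of f each, gi var f is at most al / nb times the infimum of the image. *)
Lemma Lop_kcone f al : 0 < al -> 0 < nb -> 0 < G -> kcone a b al f ->
  let e := (3 + 3 * (vg / G)) * (1 + 2 * xi) * (G / gi) in
  kcone a b (e / nb * al + e) (Lop T g Q f).
Proof.
move=> al0 nb0 G0 kf e; have [bf vf] := kf; split; first exact: Lop_BV.
have m0 := Einf_ge0 ab al0 kf.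
have f0 : coc a b (fun x => 0 <= f x).
  by apply: coc_sub (kcone_bnd ab kf) => x _ /andP[+ _]; exact: le_trans.
have [E [nE gE VE]] := LY_aux bf f0.
have vg0 : 0 <= vg by exact: var_ge0.
have vf0 : 0 <= var a b f by exact: var_ge0.
have E0 : 0 <= E by apply: le_trans nE; rewrite mulr_ge0// ltW.
have eg : e * gi = (3 * G + 3 * vg) * (1 + 2 * xi).
  by rewrite /e; field; rewrite !gt_eqF.
have e0 : 0 <= e.
  have h1 : 0 <= 3 * G + 3 * vg by rewrite addr_ge0// mulr_ge0// ltW.
  have h2 : 0 <= 1 + 2 * xi by rewrite addr_ge0// mulr_ge0.
  by rewrite -(pmulr_lge0 _ gi0) eg mulr_ge0.
apply: (le_trans VE).
have H0 : 0 <= xi * vg by rewrite mulr_ge0.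
have H1 : 0 <= xi * G by rewrite mulr_ge0// ltW.
have H2 : G + vg + 4 * xi * G <= e * gi by rewrite eg; have := ltW G0; lra.
apply: le_trans (_ : _ <= e * gi * (E + var a b f)) _.
  by apply: ler_wpM2r => //; exact: addr_ge0.
have H3 : gi * (al * Einf I f) <= al / nb * Einf I (Lop T g Q f).
  rewrite -mulrA mulrCA; apply: ler_wpM2l; first exact: ltW.
  by rewrite ler_pdivlMl// mulrCA; apply: le_trans gE; rewrite ler_pM2l.
have H4 : e * (gi * var a b f) <= e * (al / nb * Einf I (Lop T g Q f)).
  apply: ler_wpM2l => //; apply: le_trans H3; apply: ler_wpM2l => //; exact: ltW.
have H5 : e * (gi * E) <= e * Einf I (Lop T g Q f) by apply: ler_wpM2l.
have -> : (e / nb * al + e) * Einf I (Lop T g Q f) = e * (al / nb * Einf I (Lop T g Q f)) + e * Einf I (Lop T g Q f) by lra.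
lra.
Qed.

Lemma Lop_Einf f : BV f -> coc a b (fun x => 0 <= f x) ->
  gi * (nb * Einf I f) <= Einf I (Lop T g Q f).
Proof.
move=> bf f0; have [E [nE gE _]] := LY_aux bf f0.
by apply: le_trans gE; rewrite ler_pM2l.
Qed.

Lemma Lop_upper f B : 0 <= B -> coc a b (fun x => f x <= B) ->
  coc a b (fun y => Lop T g Q f y <= (#|` fset_set Q|)%:R * (B * G)).
Proof.
move=> B0 fB; have [s [us Qs ps es LE]] := sorted_branches.
have c1 : coc a b (fun x => f x <= B /\ `|g x| <= G).
  by apply: coc_and => //; apply: BV_norm_oo => //; exact: bd_BV bd.
apply: coc_sub (coc_preimage c1) => y iy hy; rewrite LE.
have -> : #|` fset_set Q| = size s.
  by apply/perm_size/uniq_perm => //; exact: fset_uniq.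
have G0 : 0 <= G by apply: norm_oo_ge0 => //; exact: bd_BV bd.
apply: sum_le_size => Z /Qs QZ.
case: (pselect ((T @` Z) y)) => [[x Zx xy]|ny]; last by rewrite branch_out// mulr_ge0.
have ix := bd_sub QZ Zx; have [h1 h2] := hy _ ix xy; rewrite -xy branch_in//=.
have g0 := bd_pos bd ix; rewrite gtr0_norm// in h2.
by apply: le_trans (ler_wpM2r (ltW g0) h1) _; exact: ler_wpM2l.
Qed.

End OneMap.

(** * Ergodic theory of an invertible transformation *)

Section Ergodic.
Context {R : realType} {d : measure_display} {Om : measurableType d} (m : probability Om R).
Implicit Types (f phi u : Om -> R) (w : Om).

Local Notation intg f := (m.-integrable setT (EFin \o f)).

Section OneSided.
Variable s : Om -> Om.
Hypothesis ms : measurable_fun setT s.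
Hypothesis inv : forall A, measurable A -> m (s @^-1` A) = m A.

Lemma integrable_comp f : intg f -> intg (f \o s) /\ \int[m]_x f (s x) = \int[m]_x f x.
Proof.
move=> If; have mf : measurable_fun setT f by apply/measurable_EFinP; exact: measurable_int If.
have E g : measurable_fun setT g -> (forall x, 0 <= g x)%E ->
    (\int[m]_x g (s x) = \int[m]_x g x)%E.
  move=> mg g0.
  have := @ge0_integral_pushforward _ _ _ _ R s ms m setT g measurableT mg (fun x _ => g0 x).
  rewrite preimage_setT /= => <-.
  by apply: eq_measure_integral => A mA _; exact: inv.
have mfs : measurable_fun setT (f \o s) by exact: measurableT_comp.
have If' : intg (f \o s).
  apply/integrableP; split; first exact/measurable_EFinP.
  have := E (fun x => `|(f x)%:E|)%E; move=> /= ->//.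
    by case/integrableP: If.
  by apply/measurable_EFinP; exact: measurableT_comp.
split=> //; rewrite /Rintegral; congr fine.
rewrite integralE [RHS]integralE; congr (_ - _)%E.
  transitivity (\int[m]_x ((EFin \o f)^\+ (s x)))%E; first by apply: eq_integral => x _; rewrite !funeposE.
  by apply: E; [exact/measurable_funepos/(measurable_int _ If)|move=> x; exact: funepos_ge0].
transitivity (\int[m]_x ((EFin \o f)^\- (s x)))%E; first by apply: eq_integral => x _; rewrite !funenegE.
by apply: E; [exact/measurable_funeneg/(measurable_int _ If)|move=> x; exact: funeneg_ge0].
Qed.

Lemma ae_comp (P : Om -> Prop) : {ae m, forall w, P w} -> {ae m, forall w, P (s w)}.
Proof.
move=> [N [mN N0 sN]]; exists (s @^-1` N); split.
- by rewrite -[X in measurable X]setTI; exact: ms.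
- by rewrite inv.
- by move=> w /= h; apply: sN.
Qed.

Lemma ae_iter (P : Om -> Prop) : {ae m, forall w, P w} -> {ae m, forall w, forall n, P (iter n s w)}.
Proof.
move=> h; apply/ae_foralln; elim=> [//|n IH] /=.
by have := ae_comp IH; apply: filterS => w; rewrite -iterSr.
Qed.

Hypothesis erg : forall A, measurable A -> s @^-1` A = A -> m A = 0%E \/ m A = 1%E.

(** The maximum of the Birkhoff sums of f of lengths 0 to n. *)
Fixpoint max_sum f n w : R :=
  if n is k.+1 then Num.max 0 (f w + max_sum f k (s w)) else 0.

Lemma max_sum_ge0 f n w : 0 <= max_sum f n w.
Proof. by case: n => //= n; rewrite le_max lexx. Qed.

Lemma max_sumS f n w : max_sum f n w <= max_sum f n.+1 w.
Proof.
elim: n w => [|n IH] w; first by rewrite max_sum_ge0.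
by rewrite /= ge_max !le_max lexx/= lerD2l IH orbT.
Qed.

Lemma max_sum_mono f n k w : (n <= k)%N -> max_sum f n w <= max_sum f k w.
Proof.
move=> /subnK <-; elim: (k - n)%N => [//|j IH]; rewrite addSn.
exact: le_trans IH (max_sumS _ _ _).
Qed.

Lemma sum_le_max_sum f n w : \sum_(i < n) f (iter i s w) <= max_sum f n w.
Proof.
elim: n w => [|n IH] w; first by rewrite big_ord0.
rewrite big_ord_recl /= le_max; apply/orP; right; rewrite lerD2l.
by apply: le_trans (IH _); rewrite le_eqVlt; apply/orP; left; apply/eqP; apply: eq_bigr => i _; rewrite -iterSr.
Qed.

Lemma max_sum_int f n : intg f -> intg (max_sum f n).
Proof.
move=> If; elim: n => [|n IH]; first exact: integrable0.
have [I1 _] := integrable_comp IH.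
have mf : measurable_fun setT f by apply/measurable_EFinP; exact: measurable_int If.
have m1 : measurable_fun setT (max_sum f n \o s) by apply/measurable_EFinP; exact: measurable_int I1.
have mm : measurable_fun setT (max_sum f n.+1).
  by apply: measurable_maxr => //; exact: measurable_funD.
have I2 : intg (fun x => `|f x| + max_sum f n (s x)).
  by apply: eq_integrable (integrableD measurableT (integrable_norm If) I1).
apply: le_integrable I2 => //; first exact/measurable_EFinP.
move=> x _; change (`|max_sum f n.+1 x|%:E <= `| `|f x| + max_sum f n (s x)|%:E)%E.
rewrite lee_fin (ger0_norm (max_sum_ge0 f n.+1 x)) ger0_norm.
  by rewrite ge_max addr_ge0 ?max_sum_ge0//= lerD2r ler_norm.
by rewrite addr_ge0 ?max_sum_ge0.
Qed.

(** The maximal ergodic theorem.  If the sums were unbounded on a set of full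
measure, then max_sum n.+1 - max_sum n \o s, whose integral is nonnegative,
would decrease to f. *)
Lemma max_ergodic f : intg f -> \int[m]_x f x < 0 ->
  {ae m, forall w, exists K, forall n, \sum_(i < n) f (iter i s w) <= K}.
Proof.
move=> If f0.
have mf : measurable_fun setT f by apply/measurable_EFinP; exact: measurable_int If.
have mP n : measurable_fun setT (max_sum f n).
  by apply/measurable_EFinP; exact: measurable_int (max_sum_int n If).
pose A := [set w | forall k : nat, exists n, k%:R < max_sum f n w].
have AE : A = \bigcap_k \bigcup_n [set w | k%:R < max_sum f n w].
  by apply/seteqP; split=> w h k; [move=> _; have [n hn] := h k; exists n|have [n _ hn] := h k Logic.I; exists n].
have mA : measurable A.
  rewrite AE; apply: bigcapT_measurable => k; apply: bigcupT_measurable => n.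
  rewrite -[X in measurable X]setTI.
  rewrite (_ : [set w | _] = max_sum f n @^-1` `]k%:R, +oo[%classic).
    by apply: mP => //; exact: measurable_itv.
  by apply/seteqP; split => w /=; rewrite in_itv/= andbT.
have sA : s @^-1` A = A.
  apply/seteqP; split => w /= h k.
    have [n hn] := h (k + `|Num.floor (`|f w|)|.+1)%N.
    exists n.+1 => /=; rewrite lt_max; apply/orP; right.
    have : `|f w| < (`|Num.floor (`|f w|)|.+1)%:R.
      rewrite -natr1; have := floorD1_gt (`|f w|).
      by rewrite intrD -{1}(gez0_abs (_ : 0 <= Num.floor `|f w|)) ?floor_ge0.
    have := lerNnormlW (lexx `|f w|); rewrite natrD in hn.
    lra.
  have [[|n] hn] := h (k + `|Num.floor (`|f w|)|.+1)%N.
    by move: hn; rewrite /= ltNge ler0n.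
  exists n; move: hn; rewrite /= lt_max => /orP[|]; first by rewrite ltNge ler0n.
  have : `|f w| < (`|Num.floor (`|f w|)|.+1)%:R.
    rewrite -natr1; have := floorD1_gt (`|f w|).
    by rewrite intrD -{1}(gez0_abs (_ : 0 <= Num.floor `|f w|)) ?floor_ge0.
  have := ler_norm (f w); rewrite natrD.
  lra.
have [A0|A1] := erg mA sA.
  exists A; split=> // w /= h k; apply: contrapT => hk; apply: h; exists k%:R => n.
  rewrite leNgt; apply/negP => hn; apply: hk; exists n.
  exact: lt_le_trans hn (sum_le_max_sum _ _ _).
exfalso; move: f0; apply/negP; rewrite -leNgt.
pose D n w := max_sum f n.+1 w - max_sum f n (s w).
have DE n w : D n w = Num.max (- max_sum f n (s w)) (f w).
  by rewrite /D /= addr_maxl sub0r addrK.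
have ID n : intg (D n) /\ \int[m]_x D n x >= 0.
  have I1 := max_sum_int n.+1 If; have [I2 E2] := integrable_comp (max_sum_int n If).
  have ID' : intg (D n) by apply: eq_integrable (integrableB measurableT I1 I2).
  split; first exact: ID'.
  rewrite [X in _ <= X](_ : _ = \int[m]_x max_sum f n.+1 x - \int[m]_x max_sum f n (s x)).
    rewrite E2 subr_ge0; apply: le_Rintegral => //; first exact: max_sum_int.
    by move=> x _; exact: max_sumS.
  by rewrite RintegralB.
have aeA : {ae m, forall w, A w}.
  exists (~` A); split=> //; first exact: measurableC.
  by rewrite probability_setC// A1 subee.
have [|||||_ _ cv] := @dominated_convergence _ _ _ m setT measurableT
   (fun n w => (D n w)%:E) (EFin \o f) (fun w => `|(f w)%:E|%E).
- by move=> n; have [/(measurable_int) ] := ID n.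
- exact/measurable_EFinP.
- apply: filterS aeA => w Aw _.
  apply: cvg_near_cst.
  have [n0 hn0] : exists n0, - f w < max_sum f n0 (s w).
    have sAw : A (s w) by have : (s @^-1` A) w by rewrite sA.
    have [n hn] := sAw (`|Num.floor (`|f w|)|.+1).
    exists n; apply: le_lt_trans hn.
    rewrite -natr1; have := floorD1_gt (`|f w|); have := ler_norm (- f w); rewrite normrN.
    rewrite intrD -{1}(gez0_abs (_ : 0 <= Num.floor `|f w|)) ?floor_ge0//.
    by rewrite pmulrn; lra.
  exists n0 => // n /= nn0; congr EFin; rewrite DE; apply/max_idPr.
  by rewrite lerNl ltW// (lt_le_trans hn0)// max_sum_mono.
- exact: integrable_abse.
- apply: aeW => w n _; rewrite lee_fin DE /=.
  have := max_sum_ge0 f n (s w) => h.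
  by case: (leP (- max_sum f n (s w)) (f w)) => h2; rewrite !ler_norml; apply/andP; split;
    [have := ler_norm (- f w); rewrite normrN; lra|exact: ler_norm|have := ler_norm (- f w); rewrite normrN; lra|have := normr_ge0 (f w); lra].
rewrite /Rintegral; apply: fine_ge0.
rewrite -(cvg_lim _ cv)//; apply: lime_ge; first by apply/cvg_ex; eexists; exact: cv.
near=> n; have [I1 I2] := ID n.
have h := fineK (integrable_fin_num measurableT I1).
by change (0 <= \int[m]_x (EFin \o D n) x)%E; rewrite -h lee_fin; exact: I2.
Unshelve. all: by end_near.
Qed.

Lemma le_Rint_cst f (c : R) : intg f -> \int[m]_x (f x - c) = \int[m]_x f x - c.
Proof.
move=> If; have Ic : intg (fun=> c) by exact: finite_measure_integrable_cst.
rewrite RintegralB//; congr (_ - _).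
by rewrite /Rintegral integral_cst// [X in (_ * X)%E]probability_setT mule1.
Qed.

(** Birkhoff's theorem, with an error term linear in n of arbitrarily small slope and
a constant depending on the point: apply [max_ergodic] to f and - f, diminished by
slightly more than their integrals. *)
Lemma birkhoff1 f : intg f -> {ae m, forall w, forall e, 0 < e -> exists K, forall n,
  `|\sum_(i < n) f (iter i s w) - n%:R * \int[m]_x f x| <= e * n%:R + K}.
Proof.
move=> If; set c := \int[m]_x f x.
have Ic (k : R) : intg (fun=> k) by exact: finite_measure_integrable_cst.
have IN : intg (fun x => - f x) by apply: eq_integrable (integrableN If).
have EN : \int[m]_x (- f x) = - c.
  rewrite (_ : (fun x => - f x) = (fun x => -1 * f x)); last by apply/funext => x; rewrite mulN1r.
  by rewrite RintegralZl// mulN1r.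
have H : {ae m, forall w, forall k : nat, exists K, forall n,
    `|\sum_(i < n) f (iter i s w) - n%:R * c| <= k.+1%:R^-1 * n%:R + K}.
  apply/ae_foralln => k; set e := k.+1%:R^-1 : R.
  have e0 : 0 < e by rewrite invr_gt0.
  have I1 : intg (fun x => f x - (c + e)) by apply: eq_integrable (integrableB measurableT If (Ic (c + e))).
  have I2 : intg (fun x => - f x - (- c + e)) by apply: eq_integrable (integrableB measurableT IN (Ic (- c + e))).
  have n1 : \int[m]_x (f x - (c + e)) < 0 by rewrite le_Rint_cst// -/c; lra.
  have n2 : \int[m]_x (- f x - (- c + e)) < 0 by rewrite le_Rint_cst// EN; lra.
  have A1 := max_ergodic I1 n1; have A2 := max_ergodic I2 n2.
  apply: filterS2 A1 A2 => w [K1 h1] [K2 h2].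
  exists (Num.max K1 K2) => n; have := h1 n; have := h2 n.
  have -> : \sum_(i < n) (f (iter i s w) - (c + e)) = \sum_(i < n) f (iter i s w) - n%:R * (c + e).
    by rewrite sumrB sumr_const card_ord mulr_natl.
  have -> : \sum_(i < n) (- f (iter i s w) - (- c + e)) = - \sum_(i < n) f (iter i s w) - n%:R * (- c + e).
    by rewrite sumrB sumr_const card_ord mulr_natl sumrN.
  have := le_max K1 K1 K2; have := le_max K2 K1 K2; rewrite !lexx orbT /= => m2 m1.
  rewrite ler_norml; move: m1 m2; move: (Num.max K1 K2) => K m1 m2 k1 k2.
  by apply/andP; split; lra.
apply: filterS H => w h e e0; have [k hk] := ltr_add_invr e0; rewrite add0r in hk.
have [K hK] := h k; exists K => n; apply: le_trans (hK n) _.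
by rewrite lerD2r; apply: ler_wpM2r => //; exact: ltW.
Qed.

End OneSided.

(** ** Two-sided orbits *)

Variables (s sV : Om -> Om).
Hypothesis sK : cancel s sV.
Hypothesis sVK : cancel sV s.
Hypothesis ms : measurable_fun setT s.
Hypothesis msV : measurable_fun setT sV.
Hypothesis inv : forall A, measurable A -> m (s @^-1` A) = m A.
Hypothesis erg : forall A, measurable A -> s @^-1` A = A -> m A = 0%E \/ m A = 1%E.

Lemma invV A : measurable A -> m (sV @^-1` A) = m A.
Proof.
move=> mA; have mB : measurable (sV @^-1` A) by rewrite -[X in measurable X]setTI; exact: msV.
rewrite -inv//; congr (m _); apply/seteqP; split=> w /=; by rewrite sK.
Qed.

Lemma ergV A : measurable A -> sV @^-1` A = A -> m A = 0%E \/ m A = 1%E.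
Proof.
move=> mA AE; apply: erg => //; rewrite -{1}AE.
by apply/seteqP; split=> w /=; rewrite sK.
Qed.

Definition orb (w : Om) (k : int) : Om :=
  match k with Posz n => iter n s w | Negz n => iter n.+1 sV w end.

Lemma orbS w k : orb w (k + 1) = s (orb w k).
Proof.
case: k => [n|[|n]].
- by rewrite -PoszD addn1.
- by rewrite NegzE addNr /= sVK.
- rewrite (_ : Negz n.+1 + 1 = Negz n); first by rewrite /= sVK.
  by rewrite !NegzE -[n.+2]addn1 PoszD opprD subrK.
Qed.

Lemma orbP w k : orb w (k - 1) = sV (orb w k).
Proof. by rewrite -{2}(subrK 1 k) orbS sK. Qed.

Lemma orbD w i j : orb (orb w i) j = orb w (i + j).
Proof.
elim/int_ind: j => [|n IH|n IH].
- by rewrite addr0.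
- by rewrite -addn1 PoszD addrA !orbS IH.
- by rewrite -addn1 PoszD opprD addrA !orbP IH.
Qed.

Lemma orb0 w : orb w 0 = w. Proof. by []. Qed.

Lemma orb_iterV w n : orb w (- n%:Z) = iter n sV w.
Proof. by case: n => [|n] //; rewrite -NegzE. Qed.

Lemma ae_orb (P : Om -> Prop) : {ae m, forall w, P w} -> {ae m, forall w, forall k, P (orb w k)}.
Proof.
move=> h; have h1 := ae_iter ms inv h; have h2 := ae_iter msV invV h.
by apply: filterS2 h1 h2 => w k1 k2 [n|n]; [exact: k1|exact: k2].
Qed.

(** Birkhoff sums over the integers.  The negative part has the sign that makes this
an additive cocycle, so that the sum over any window of the orbit is a difference
of two of its values. *)
Definition bsum phi w (k : int) : R :=
  match k with
  | Posz n => \sum_(i < n) phi (iter i s w)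
  | Negz n => - \sum_(i < n.+1) phi (iter i.+1 sV w) end.

Lemma bsumS phi w k : bsum phi w (k + 1) = bsum phi w k + phi (orb w k).
Proof.
case: k => [n|[|n]].
- by rewrite -PoszD addn1 /= big_ord_recr.
- by rewrite NegzE addNr /= big_ord0 big_ord1 addNr.
- rewrite (_ : Negz n.+1 + 1 = Negz n); last by rewrite !NegzE -[n.+2]addn1 PoszD opprD subrK.
  rewrite /bsum [in RHS]big_ord_recr/= opprD -addrA [X in _ + X](_ : _ = 0) ?addr0//.
  by rewrite addNr.
Qed.

Lemma absz_leD (i j : int) : `|(i + j)%R|%N%:R <= `|i|%N%:R + `|j|%N%:R :> R.
Proof. by rewrite !natr_absz -rmorphD ler_int; exact: ler_normD. Qed.

(** Averages over backward windows of an orbit.  The position i of the window enters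
the error linearly, with a small slope, because the sum over the window is a
difference of values of [bsum]. *)
Lemma birkhoff2 phi : intg phi -> {ae m, forall w, forall e, 0 < e -> exists K,
  forall (i : int) (n : nat),
  `|\sum_(j < n) phi (orb w (i - j%:Z)) - n%:R * \int[m]_x phi x| <=
     e * (`|i|%N%:R + n%:R) + K}.
Proof.
move=> If; have [If' E'] := integrable_comp msV invV If.
have A1 := birkhoff1 ms inv erg If; have A2 := birkhoff1 msV invV ergV If'.
apply: filterS2 A1 A2 => w h1 h2 e e0; set c := \int[m]_x phi x in h1 E' *.
have e20 : 0 < e / 2 by rewrite divr_gt0.
have [K1 k1] := h1 _ e20; have [K2 k2] := h2 _ e20.
pose K := Num.max K1 K2.
have C k : `|bsum phi w k - k%:~R * c| <= e / 2 * `|k|%N%:R + K.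
  case: k => n.
    by apply: le_trans (k1 n) _; rewrite lerD2l le_max lexx.
  apply: le_trans (_ : _ <= e / 2 * n.+1%:R + K2) _; last by rewrite lerD2l le_max lexx orbT.
  have := k2 n.+1; rewrite /= E'; rewrite -normrN opprB NegzE mulrNz; congr (_ <= _).
  by congr (`|_|); rewrite -pmulrn; under [in RHS]eq_bigr do rewrite -iterS; ring.
have W i n : \sum_(j < n) phi (orb w (i - j%:Z)) = bsum phi w (i + 1) - bsum phi w (i + 1 - n%:Z).
  elim: n => [|n IH]; first by rewrite big_ord0 subr0 subrr.
  rewrite big_ord_recr/= IH.
  have := bsumS phi w (i - n%:Z); rewrite addrAC => ->.
  have -> : i + 1 - n.+1%:Z = i - n%:Z by rewrite -addn1 PoszD; lra.
  by lra.
exists (e + 2 * K) => i n; rewrite W.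
have := C (i + 1); have := C (i + 1 - n%:Z).
rewrite !rmorphB !rmorphD /= -!pmulrn.
have b1 : `|(i + 1)%R|%N%:R <= `|i|%N%:R + 1 :> R by apply: le_trans (absz_leD _ _) _.
have b2 : `|(i + 1 - n%:Z)%R|%N%:R <= `|i|%N%:R + 1 + n%:R :> R.
  by apply: le_trans (absz_leD _ _) _; rewrite abszN lerD2r.
move=> c1 c2.
have d1 : e / 2 * `|(i + 1)%R|%N%:R <= e / 2 * (`|i|%N%:R + 1) by rewrite ler_pM2l.
have d2 : e / 2 * `|(i + 1 - n%:Z)%R|%N%:R <= e / 2 * (`|i|%N%:R + 1 + n%:R) by rewrite ler_pM2l.
move: c1 c2; rewrite !ler_norml => /andP[u1 u2] /andP[v1 v2].
have en : 0 <= e * n%:R by rewrite mulr_ge0// ltW.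
by apply/andP; split; lra.
Qed.

(** Functions that grow subexponentially along almost every orbit, in
logarithmic scale. *)
Definition subexp (g : Om -> R) := {ae m, forall w, forall e, 0 < e ->
  exists K, forall k : int, g (orb w k) <= e * `|k|%N%:R + K}.

Lemma subexp_integrable phi : intg phi -> subexp phi.
Proof.
move=> /birkhoff2; apply: filterS => w h e e0.
have [K hK] := h _ e0; exists (e + K + \int[m]_x phi x) => k.
have := hK k 1%N; rewrite big_ord1 subr0 mul1r ler_norml => /andP[_]; lra.
Qed.

Lemma subexp_add g1 g2 : subexp g1 -> subexp g2 -> subexp (fun w => g1 w + g2 w).
Proof.
apply: filterS2 => w h1 h2 e e0; have e20 : 0 < e / 2 by rewrite divr_gt0.
have [K1 k1] := h1 _ e20; have [K2 k2] := h2 _ e20; exists (K1 + K2) => k.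
have := k1 k; have := k2 k; lra.
Qed.

Lemma subexp_scale c g : 0 <= c -> subexp g -> subexp (fun w => c * g w).
Proof.
move=> c0; apply: filterS => w h e e0.
have e2 : 0 < e / (c + 1) by rewrite divr_gt0// ltr_wpDl.
have [K hK] := h _ e2; exists (c * K) => k.
apply: le_trans (ler_wpM2l c0 (hK k)) _; rewrite mulrDr lerD2r mulrA.
apply: ler_wpM2r => //; rewrite mulrCA ger_pMr// ler_pdivrMr ?ltr_wpDl//; lra.
Qed.

Lemma subexp_cst c : subexp (fun=> c).
Proof. by apply: aeW => w e e0; exists c => k; rewrite lerDr mulr_ge0// ltW. Qed.

(** M is the largest deficit, over all n, of the number of visits to E during the
last n steps with respect to half of the expected number n m(E). *)
Lemma visits E : measurable E -> (0 < m E)%E -> exists M : Om -> R, exists p : R,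
  [/\ 0 < p, subexp M & {ae m, forall w, forall n : nat, 0 <= M w /\
    p * n%:R - M w <= \sum_(j < n) (\1_E (orb w (- j%:Z)) : R)}].
Proof.
move=> mE E0.
have IE : intg (\1_E) by exact: integrable_indic.
pose c := \int[m]_x (\1_E x : R).
have cE : c = fine (m E) by rewrite /c /Rintegral integral_indic// setIT.
have c0 : 0 < c by rewrite cE fine_gt0// E0/= (le_lt_trans (probability_le1 _ _))// ltry.
pose p := c / 2; have p0 : 0 < p by rewrite divr_gt0.
pose Sn w n : R := \sum_(j < n) (\1_E (orb w (- j%:Z)) : R).
pose M w := sup [set x | exists n : nat, x = p * n%:R - Sn w n].
have B := birkhoff2 IE.
have bnd w : (forall e, 0 < e -> exists K, forall (i : int) (n : nat),
  `|\sum_(j < n) (\1_E (orb w (i - j%:Z)) : R) - n%:R * c| <= e * (`|i|%N%:R + n%:R) + K) ->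
  forall e, 0 < e -> exists K, forall (i : int) n, p * n%:R - Sn (orb w i) n <= e * `|i|%N%:R + K.
  move=> h e e0; pose e' := Num.min e p.
  have e'0 : 0 < e' by rewrite lt_min e0.
  have e'e : e' <= e by rewrite ge_min lexx.
  have e'p : e' <= p by rewrite ge_min lexx orbT.
  have [K hK] := h _ e'0; exists K => i n; have := hK i n.
  rewrite /Sn; under [X in _ - X <= _]eq_bigr do rewrite orbD.
  rewrite ler_norml => /andP[H _].
  have H1 : e' * `|i|%N%:R <= e * `|i|%N%:R by apply: ler_wpM2r.
  have H2 : e' * n%:R <= p * n%:R by apply: ler_wpM2r.
  have H3 : n%:R * c = p * n%:R + p * n%:R by rewrite /p; lra.
  rewrite mulrDr in H; lra.
have fin w : (forall e, 0 < e -> exists K, forall (i : int) (n : nat),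
  `|\sum_(j < n) (\1_E (orb w (i - j%:Z)) : R) - n%:R * c| <= e * (`|i|%N%:R + n%:R) + K) ->
  forall i n, p * n%:R - Sn (orb w i) n <= M (orb w i).
  move=> /bnd /(_ _ ltr01)[K hK] i n; apply: ub_le_sup; last by exists n.
  by exists (1 * `|i|%N%:R + K) => _ [k ->].
exists M, p; split=> //.
  apply: filterS B => w h e e0; have [K hK] := bnd w h e e0; exists K => k.
  apply: ge_sup; first by exists (p * 0%:R - Sn (orb w k) 0%N), 0%N.
  by move=> _ [n ->].
apply: filterS B => w /fin h n; split.
  by have := h 0 0%N; rewrite /Sn big_ord0 mulr0 subr0.
by have := h 0 n; rewrite orb0 /Sn; lra.
Qed.

(** The truncations of psi are integrable, so their differences along the orbits have
integral 0.  These differences are bounded below by an integrable function, which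
gives integrability of the limit by Fatou's lemma, and are dominated by their limit
in absolute value. *)
Lemma coboundary (psi : Om -> R) : measurable_fun setT psi ->
  intg (fun w => Num.max (- (psi w - psi (s w))) 0) ->
  intg (fun w => psi w - psi (s w)) /\ \int[m]_x (psi x - psi (s x)) = 0.
Proof.
move=> mpsi Ineg; pose u w := psi w - psi (s w).
pose cl (n : nat) x : R := Num.max (Num.min x n%:R) (- n%:R).
have mcl n : measurable_fun setT (cl n \o psi).
  by apply: measurable_maxr => //; apply: measurable_minr.
have clb n x : `|cl n x| <= n%:R.
  rewrite /cl ler_norml le_max lexx orbT ge_max ge_min lexx orbT /=.
  by have := ler0n R n; lra.
have Icl n : intg (cl n \o psi).
  apply: measurable_bounded_integrable => //; first by rewrite (le_lt_trans (probability_le1 _ _))// ltry.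
  exists n%:R; split; first exact: num_real.
  by move=> x nx w _; apply: le_trans (clb n _) (ltW nx).
pose D n w := cl n (psi w) - cl n (psi (s w)).
have ID n : intg (D n) /\ \int[m]_x D n x = 0.
  have [I2 E2] := integrable_comp ms inv (Icl n).
  split; first by apply: eq_integrable (integrableB measurableT (Icl n) I2).
  by apply: etrans (RintegralB measurableT (Icl n) I2) _; rewrite [X in _ - X]E2 subrr.
have Db n w : `|D n w| <= `|u w|.
  rewrite /D /u /cl; apply: le_trans (lip_max (- n%:R) _ _) _; exact: lip_min.
have clm n x y : x <= y -> cl n x <= cl n y.
  move=> xy; have h : Num.min x n%:R <= Num.min y n%:R.
    by rewrite le_min !ge_min xy lexx orbT.
  by rewrite /cl ge_max !le_max h lexx orbT.
pose neg w : R := Num.max (- u w) 0.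
have Dn n w : 0 <= D n w + neg w.
  rewrite /neg; case: (leP (psi (s w)) (psi w)) => h.
    by rewrite addr_ge0// ?le_max ?lexx ?orbT// subr_ge0 clm.
  have := Db n w; rewrite ler_norml => /andP[+ _].
  have u0 : u w < 0 by rewrite /u; lra.
  rewrite (ltr0_norm u0) opprK => k.
  by apply: le_trans (_ : _ <= D n w + - u w) _; [lra|rewrite lerD2l le_max lexx].
have mu : measurable_fun setT u by apply: measurable_funB => //; exact: measurableT_comp.
have clE x : exists N : nat, forall n, (N <= n)%N -> cl n x = x.
  exists (Num.bound `|x|) => n Nn.
  have : `|x| <= n%:R.
    apply: le_trans (ltW (archi_boundP (normr_ge0 x))) _; by rewrite ler_nat.
  by rewrite ler_norml => /andP[h1 h2]; rewrite /cl (min_idPl h2) (max_idPl h1).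
have Dcv w : exists N : nat, forall n, (N <= n)%N -> D n w = u w.
  have [N1 h1] := clE (psi w); have [N2 h2] := clE (psi (s w)); exists (maxn N1 N2) => n.
  by rewrite geq_max => /andP[n1 n2]; rewrite /D h1// h2.
have mneg : measurable_fun setT neg by apply: measurable_maxr => //; exact: measurable_funN.
have mD n : measurable_fun setT (D n) by apply/measurable_EFinP; exact: measurable_int (ID n).1.
have E0 n : (\int[m]_x (D n x)%:E = 0)%E.
  by rewrite -[LHS](fineK (integrable_fin_num measurableT (ID n).1)); congr EFin; exact: (ID n).2.
have Ipos : intg (fun w => u w + neg w).
  apply/integrableP; split; first by apply/measurable_EFinP; exact: measurable_funD.
  have pos0 w : 0 <= u w + neg w.
    by have [N hN] := Dcv w; have := Dn N w; rewrite hN.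
  rewrite (eq_integral (fun w => limn_einf (fun n => (D n w + neg w)%:E))); last first.
    move=> w _; rewrite gee0_abs ?lee_fin//.
    suff cv : (fun n => (D n w + neg w)%:E) @ \oo --> (u w + neg w)%:E.
      by rewrite (cvg_limn_einf_sup cv).1.
    apply: cvg_near_cst; have [N hN] := Dcv w.
    by exists N => // n /= Nn; rewrite hN.
  apply: le_lt_trans (fatou _ _ _ _) _ => //.
  - by move=> n; apply/measurable_EFinP; exact: measurable_funD.
  - by move=> n w _; rewrite lee_fin.
  rewrite (_ : (fun n => _) = (fun n => \int[m]_x (neg x)%:E)%E).
    have cv : (fun n : nat => \int[m]_x (neg x)%:E)%E @ \oo --> (\int[m]_x (neg x)%:E)%E by exact: cvg_cst.
    by rewrite (cvg_limn_einf_sup cv).1 -(fineK (integrable_fin_num measurableT Ineg)) ltry.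
  apply/funext => n; under eq_integral do rewrite EFinD.
  rewrite integralD//; last exact: (ID n).1.
  by rewrite E0 add0e.
have Iu : intg u.
  apply: eq_integrable (integrableB measurableT Ipos Ineg) => // w _.
  by rewrite /= -EFinB addrK.
split=> //.
have [|||||_ _ cv] := @dominated_convergence _ _ _ m setT measurableT
   (fun n w => (D n w)%:E) (EFin \o u) (fun w => `|(u w)%:E|%E).
- by move=> n; apply/measurable_EFinP.
- exact/measurable_EFinP.
- apply: aeW => w _; apply: cvg_near_cst; have [N hN] := Dcv w.
  by exists N => // n /= Nn; rewrite hN.
- exact: integrable_abse.
- by apply: aeW => w n _; rewrite lee_fin.
rewrite /Rintegral -(cvg_lim _ cv)// (_ : [sequence _]_n = (fun=> 0%E)) ?lim_cst//.
by apply/funext => n /=; rewrite E0.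
Qed.

End Ergodic.

(** * The random map *)

Section RandomMap.
Context {R : realType} {d : measure_display} {Om : measurableType d} (m : probability Om R)
  (S : system R Om).
Hypothesis hS : random_open_map m S.
Implicit Types (w : Om) (j : nat) (f h : R -> R).
Local Notation a := (lo S).
Local Notation b := (hi S).
Local Notation leb := (@lebesgue_measure R).

Lemma rm_ab : a < b. Proof. exact: rom_I hS. Qed.

(** The properties of a label that integrability of the logarithms provides for
almost every point; the estimates on one map rest on them. *)
Definition good j := finite_set (partX S j) /\ 0 < Einf (dom S) (weight S j).

Definition pieces j : set R := \bigcup_(Z in partX S j) Z.

Lemma partX_itv j Z : partX S j Z -> [/\ is_interval Z, (0 < leb Z)%E & Z `<=` compl_hole S j].
Proof. by case: (rom_partX hS j) => -[h _ _] _ _; exact: h. Qed.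

Lemma mono_sub (A Z : set R) (T : R -> R) : Z `<=` A ->
  monotone_continuous_on A T -> monotone_continuous_on Z T.
Proof.
move=> ZA [c mn]; split; first exact: continuous_subspaceW ZA c.
by case: mn => mn; [left|right] => x y /ZA ? /ZA ?; exact: mn.
Qed.

Lemma compl_hole_meas j : measurable (compl_hole S j : set (measurableTypeR R)).
Proof.
have [_ [D fD [iD E]]] := rom_hole hS j; rewrite /compl_hole E.
apply: measurableD; first exact: Icc_meas.
apply: fin_bigcup_measurable => // J /iD iJ; exact: (@is_interval_measurable R).
Qed.

Lemma bigcup_itv_meas (Q : set (set R)) : finite_set Q -> (forall Z, Q Z -> is_interval Z) ->
  measurable (\bigcup_(Z in Q) Z : set (measurableTypeR R)).
Proof.
by move=> fQ iQ; apply: fin_bigcup_measurable => // Z /iQ iZ; apply: (@is_interval_measurable R).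
Qed.

(** An element of the monotonicity partition that lies in the complement of the
hole belongs to the coarsest refinement: replace by it the elements of the
refinement that it contains. *)
Lemma full_partX j A : finite_set (partX S j) -> partT S j A -> full S j A -> A `<=` compl_hole S j -> partX S j A.
Proof.
move=> fQ PA fA AX.
have [[iQ tQ mQ] rQ cQ] := rom_partX hS j.
have [fP [iP tP mP]] := rom_partT hS j.
pose Q' : set (set R) := [set Z | Z = A \/ (partX S j Z /\ Z `&` A = set0)].
have dis Z : partX S j Z -> Z `<=` A \/ Z `&` A = set0.
  move=> QZ; have [A' PA' ZA'] := rQ _ QZ.
  case: (pselect (Z `&` A = set0)) => [|/eqP/set0P[x [Zx Ax]]]; first by right.
  by left; rewrite -(tP A' A PA' PA)//; exists x; split => //; exact: ZA'.
have iQ'0 Z : Q' Z -> is_interval Z by move=> [->|[/iQ[]//]]; case: (iP _ PA).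
have iQ' : interval_partition (compl_hole S j) Q'.
  split.
  - move=> Z [->|[/iQ//]]; have [h1 h2 h3] := iP _ PA; by split.
  - move=> Z Z' [->|[QZ Z0]] [->|[QZ' Z0']] //.
    + by rewrite /= => -[x [Ax Zx]]; exfalso; rewrite -[False]/(set0 x) -Z0'.
    + by rewrite /= => -[x [Ax Zx]]; exfalso; rewrite -[False]/(set0 x) -Z0.
    + exact: tQ.
  - apply/eqP; rewrite eq_le measure_ge0 andbT -mQ; apply: le_measure; rewrite ?inE.
    + apply: measurableD; first exact: compl_hole_meas.
      apply: bigcup_itv_meas => [|Z /iQ'0 //].
      apply: (@sub_finite_set _ _ (A |` partX S j)) => [Z [->|[QZ _]]|]; [by left|by right|].
      by rewrite finite_setU.
    + apply: measurableD; first exact: compl_hole_meas.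
      by apply: bigcup_itv_meas => // Z /iQ[].
    + move=> x [Xx nx]; split=> // -[Z QZ Zx]; apply: nx.
      case: (dis _ QZ) => [ZA|Z0]; first by exists A; [left|exact: ZA].
      by exists Z => //; right.
have rQ' : refines Q' (partT S j).
  by move=> Z [->|[/rQ//]]; exists A.
have [Z QZ AZ] := cQ _ iQ' rQ' A (or_introl erefl).
have [A' PA' ZA'] := rQ _ QZ.
have [iA A0 _] := iP _ PA.
have [x Ax] : A !=set0.
  by apply/set0P/eqP => E; move: A0; rewrite E measure0 ltxx.
have E : A' = A by apply: (tP A' A PA' PA); exists x; split=> //; exact/ZA'/AZ.
by rewrite (_ : A = Z)//; apply/seteqP; split=> //; rewrite -E.
Qed.

Lemma full_exists j : finite_set (partX S j) -> exists2 A, partX S j A & fullb a b (mapT S j) A.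
Proof.
move=> fQ; have [A [PA fA AX]] := rom_full hS j; exists A; first exact: full_partX.
exact/asboolP.
Qed.

Lemma bd_label j : good j ->
  branch_data a b (mapT S j) (weight S j) (partX S j) (pieces j).
Proof.
case=> fQ _; split.
- exact: rm_ab.
- exact: rom_map hS j.
- exact: fQ.
- by move=> Z QZ; have [h1 h2 h3] := partX_itv QZ; split=> // x Zx; exists Z.
- by move=> x [Z QZ Zx]; have [_ _ h3] := partX_itv QZ; have [] := h3 _ Zx.
- apply: fin_bigcup_measurable => // Z /partX_itv[iZ _ _].
  by apply: (@is_interval_measurable R).
- by case: (rom_partX hS j) => -[].
- move=> Z QZ; have [_ rQ _] := rom_partX hS j; have [A PA ZA] := rQ _ QZ.
  exact: mono_sub ZA (rom_mono hS PA).
- exact: full_exists fQ.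
- exact: (rom_weight hS j).1.
- exact: (rom_weight hS j).2.
Qed.

Lemma transferE w : transfer S w = Lop (T_ S w) (g_ S w) (Z_ S w).
Proof. by []. Qed.

Definition goodw w := good (label S w).

Section OneFibre.
Variable w : Om.
Hypothesis gw : goodw w.
Let bd : branch_data a b (T_ S w) (g_ S w) (Z_ S w) (pieces (label S w)) := bd_label gw.
Let ab := rm_ab.

Lemma tr_linear : linear_op (transfer S w). Proof. exact: Lop_linear bd. Qed.

Lemma tr_BV f : inBV a b f -> inBV a b (transfer S w f). Proof. by move=> h; exact: (Lop_BV bd h). Qed.

Lemma tr_coc f h : coc a b (fun x => f x = h x) ->
  coc a b (fun x => transfer S w f x = transfer S w h x).
Proof. by move=> fh; exact: (Lop_coc bd fh). Qed.

Lemma g_BV : inBV a b (g_ S w). Proof. exact: bd_BV bd. Qed.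

Lemma finZ : finite_set (Z_ S w). Proof. exact: bd_fin bd. Qed.

Let gi := Einf (X_ S w) (g_ S w).

Lemma X_meas : measurable (X_ S w : set (measurableTypeR R)).
Proof. exact: compl_hole_meas. Qed.

Lemma X_pos : (0 < leb (X_ S w))%E.
Proof.
have [A QA _] := full_exists gw.1; have [iA A0 AX] := partX_itv QA.
apply: lt_le_trans A0 _; have := @le_measure _ _ _ leb A (X_ S w); rewrite !inE; apply => //.
- by apply: (@is_interval_measurable R).
- exact: X_meas.
Qed.

Lemma gi_spec : ae_on (X_ S w) (fun x => gi <= g_ S w x) /\
  forall c, ae_on (X_ S w) (fun x => c <= g_ S w x) -> c <= gi.
Proof.
have [B _ bB] := BV_bnd ab g_BV.
have sX x : X_ S w x -> Icc a b x by case.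
apply: (@Einf_spec _ _ _ B (- B)).
- exact: X_meas.
- exact: X_pos.
- by apply: aeW => x /sX/bB; rewrite ler_norml => /andP[].
- by apply: aeW => x /sX/bB; rewrite ler_norml => /andP[].
Qed.

Lemma ae_dom_X (P : R -> Prop) : coc a b P -> ae_on (X_ S w) P.
Proof. by move=> /coc_ae; rewrite /ae_on; apply: (@filterS _ _ (ae_filter_ringOfSetsType _)) => x h [ix _]; exact: h. Qed.

Lemma Einf_dom_gi : Einf (dom S) (g_ S w) <= gi.
Proof. by apply: gi_spec.2; apply: ae_dom_X; exact: BV_Einf g_BV. Qed.

Lemma gi_gt0 : 0 < gi.
Proof. by apply: lt_le_trans Einf_dom_gi; case: gw. Qed.

Lemma gi_coc : coc a b (fun x => pieces (label S w) x -> gi <= g_ S w x).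
Proof.
have H Z : Z_ S w Z -> coc a b (fun x => Z x -> gi <= g_ S w x).
  move=> QZ; have [iZ _ ZX] := partX_itv QZ.
  pose u x := Num.min (g_ S w x - gi) 0 * (\1_Z x : R).
  have bu : inBV a b u.
    apply: (BV_mul ab); last exact: BV_itv.
    by apply: (BV_lip ab (lip_min 0)); apply: BV_sub => //; [exact: g_BV|exact: BV_cst].
  have u0 : ae_on (Icc a b) (fun x => u x = 0).
    have := gi_spec.1; apply: (@filterS _ _ (ae_filter_ringOfSetsType _)) => x h ix.
    rewrite /u indicE; case: (boolP (x \in Z)) => [/set_mem Zx|_]; last by rewrite mulr0.
    by have := h (ZX _ Zx); rewrite -subr_ge0 => k; rewrite mulr1; apply/min_idPr.
  apply: coc_sub (BV_ae0 ab bu u0) => x _ ux Zx; move: ux.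
  rewrite /u indicE mem_set// mulr1 => h; rewrite -subr_ge0.
  by have : Num.min (g_ S w x - gi) 0 <= g_ S w x - gi; [rewrite ge_min lexx|rewrite h].
have : countable (\bigcup_(Z in Z_ S w) [set x | Icc a b x /\ ~ (Z x -> gi <= g_ S w x)]).
  apply: bigcup_countable => [|Z QZ]; last exact: H.
  exact/finite_set_countable/finZ.
apply: sub_countable; apply: subset_card_le => x [ix /not_implyP[[Z QZ Zx] ng]].
by exists Z => //; split=> // h; exact/ng/h.
Qed.

Lemma Einf_g_gt0 : 0 < Einf (dom S) (g_ S w). Proof. by case: gw. Qed.

Lemma gi_le_norm : gi <= norm_oo a b (g_ S w).
Proof.
have cn := ae_dom_X (BV_norm_oo ab g_BV).
have [x _ [h1 h2]] := ae_on_pick X_meas X_pos (ae_on2 gi_spec.1 cn (fun _ _ u1 u2 => conj u1 u2)).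
exact: le_trans h1 (le_trans (ler_norm _) h2).
Qed.

Lemma norm_g_gt0 : 0 < norm_oo a b (g_ S w).
Proof. exact: lt_le_trans gi_gt0 gi_le_norm. Qed.

Lemma contigP D : contig a b (T_ S w) (Z_ S w) D <-> contiguous S w D.
Proof.
split=> -[h1 h2]; split.
- by move=> Z /h1[QZ /asboolP].
- by move=> Z [QZ fZ]; apply: h2 => //; exact/asboolP.
- by move=> Z /h1[QZ nf]; split=> //; exact/asboolP.
- by move=> Z QZ /asboolP fZ; exact: h2.
Qed.

Lemma card_contig D : contiguous S w D -> (#|` fset_set D| <= card_Z S w)%N.
Proof.
move=> [h _]; have fD : finite_set D by apply: sub_finite_set finZ => Z /h[].
by apply/fsubset_leq_card; rewrite -fset_set_sub//; [move=> Z /h[]|exact: finZ].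
Qed.

Lemma xi_sup : has_sup ([set (#|` fset_set D|%N)%:R | D in [set D | contiguous S w D]] : set R).
Proof.
split; last by exists (card_Z S w)%:R => _ [D /card_contig cD <-]; rewrite ler_nat.
exists (#|` fset_set (set0 : set (set R))|)%:R, set0 => //; split=> // Z [QZ _] hull.
have [x Zx] := bd_ne bd QZ.
have [[y [Y]] ] := Rhull_bounds (hull _ Zx); by [].
Qed.

Lemma xi_contig D : contig a b (T_ S w) (Z_ S w) D -> (#|` fset_set D|%N)%:R <= xi1 S w.
Proof. by move=> /contigP cD; apply: sup_upper_bound; [exact: xi_sup|exists D]. Qed.

Lemma xi_ge0 : 0 <= xi1 S w.
Proof.
have [[u [D cD _]] _] := xi_sup.
by apply: le_trans (xi_contig (D:=D) _) => //; exact/contigP.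
Qed.

Lemma xi_card : xi1 S w <= (card_Z S w)%:R.
Proof.
apply: ge_sup; first exact: xi_sup.1.
by move=> _ [D /card_contig cD <-]; rewrite ler_nat.
Qed.

Lemma fullE : [set Z | Z_ S w Z /\ fullb a b (T_ S w) Z] = full_elements S w.
Proof.
by apply/seteqP; split=> Z [QZ fZ]; split=> //; move/asboolP: fZ.
Qed.

Lemma bf_card : (0 < b_f S w <= card_Z S w)%N.
Proof.
have fF : finite_set (full_elements S w) by apply: sub_finite_set finZ => Z [].
apply/andP; split; last first.
  by apply/fsubset_leq_card; rewrite -fset_set_sub//; [move=> Z []|exact: finZ].
have [A QA fA] := full_exists gw.1; rewrite cardfs_gt0; apply/fset0Pn; exists A.
by rewrite in_fset_set//; apply/mem_set; split=> //; move/asboolP: fA.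
Qed.

Lemma tr_kcone al f : 0 < al -> kcone a b al f ->
  kcone a b (c_1 S w * al + d_1 S w) (transfer S w f).
Proof.
move=> al0 kf.
have nb0 : (0 : R) < (b_f S w)%:R by rewrite ltr0n; case/andP: bf_card.
have := Lop_kcone bd xi_ge0 xi_contig gi_gt0 gi_coc al0.
by rewrite fullE; move=> /(_ f nb0 norm_g_gt0 kf).
Qed.

Lemma tr_Einf f : inBV a b f -> coc a b (fun x => 0 <= f x) ->
  Einf (dom S) (g_ S w) * Einf (dom S) f <= Einf (dom S) (transfer S w f).
Proof.
move=> bf f0; have := Lop_Einf bd xi_ge0 xi_contig gi_gt0 gi_coc bf f0; rewrite fullE.
apply: le_trans; have E0 : 0 <= Einf (dom S) f by apply: le_Einf => //; exact: ab.
apply: ler_pM => //; [exact/ltW/Einf_g_gt0|exact: Einf_dom_gi|].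
by rewrite ler_peMl// ler1n; case/andP: bf_card.
Qed.

Lemma tr_upper f B : 0 <= B -> coc a b (fun x => f x <= B) ->
  coc a b (fun y => transfer S w f y <= (card_Z S w)%:R * (B * norm_oo a b (g_ S w))).
Proof. by move=> B0 h; exact: (Lop_upper bd B0 h). Qed.

Lemma e_ge3 : 3 <= e_ S w.
Proof.
have n0 := norm_g_gt0; have g0 := gi_gt0; have v0 := var_ge0 ab (g_ S w); have x0 := xi_ge0.
have h1 : 3 <= 3 + 3 * (var a b (g_ S w) / norm_oo a b (g_ S w)) :> R.
  by rewrite lerDl mulr_ge0// divr_ge0// ltW.
have h2 : 1 <= 1 + 2 * xi1 S w by rewrite lerDl mulr_ge0.
have h3 : 1 <= norm_oo a b (g_ S w) / gi by rewrite ler_pdivlMr// mul1r gi_le_norm.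
have h12 : 3 <= (3 + 3 * (var a b (g_ S w) / norm_oo a b (g_ S w))) * (1 + 2 * xi1 S w).
  by rewrite -[3]mulr1; apply: ler_pM => //; rewrite mulr1.
by rewrite -[3]mulr1; apply: ler_pM.
Qed.

Lemma c_gt0 : 0 < c_1 S w.
Proof.
rewrite divr_gt0//; first by apply: lt_le_trans e_ge3.
by rewrite ltr0n; case/andP: bf_card.
Qed.

Lemma c_le_d : c_1 S w <= d_1 S w.
Proof.
rewrite ler_pdivrMr ?ltr0n; last by case/andP: bf_card.
by rewrite ler_peMr ?ler1n; [|apply: le_trans e_ge3|case/andP: bf_card].
Qed.

(** With [ln_c_bounds], this makes the logarithms of [d_1] and [c_1] integrable. *)
Lemma ln_d_bounds : 0 <= ln (d_1 S w) <=
  var a b (g_ S w) / norm_oo a b (g_ S w) + ln (card_Z S w)%:R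
   + ln (norm_oo a b (g_ S w)) - ln (Einf (dom S) (g_ S w)) + 4.
Proof.
have e3 := e_ge3; apply/andP; split; first by rewrite ln_ge0//; apply: le_trans e3; lra.
have n0 := norm_g_gt0; have g0 := gi_gt0; have v0 := var_ge0 ab (g_ S w); have x0 := xi_ge0.
have G0 := Einf_g_gt0; have xc := xi_card.
have card1 : (1 : R) <= (card_Z S w)%:R by rewrite ler1n; case/andP: bf_card => /leq_trans; apply.
have lng : ln (Einf (dom S) (g_ S w)) <= ln gi by rewrite ler_ln ?posrE// Einf_dom_gi.
set t := var a b (g_ S w) / _; have t0 : 0 <= t by rewrite divr_ge0// ltW.
have lnx (x : R) : 0 <= x -> ln (1 + x) <= x by move=> x0'; apply: le_ln1Dx; lra.
have l1 : ln (3 + 3 * t) <= 2 + t.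
  have -> : 3 + 3 * t = (1 + 2) * (1 + t) by ring.
  rewrite lnM ?posrE; [|lra|lra].
  by apply: lerD; apply: lnx => //; lra.
have l2 : ln (1 + 2 * xi1 S w) <= 2 + ln (card_Z S w)%:R.
  apply: (@le_trans _ _ (ln ((1 + 2) * (card_Z S w)%:R))); first by rewrite ler_ln ?posrE; lra.
  by rewrite lnM ?posrE; [rewrite lerD2r; apply: lnx; lra|lra|lra].
rewrite /d_1 /e_ -/gi -/t lnM ?posrE; last by rewrite divr_gt0.
  rewrite lnM ?posrE; [|lra|lra]; rewrite ln_div ?posrE//; lra.
apply: mulr_gt0; lra.
Qed.

Lemma ln_c_bounds : ln (d_1 S w) - ln (card_Z S w)%:R <= ln (c_1 S w) <= ln (d_1 S w).
Proof.
have d0 : 0 < d_1 S w by apply: lt_le_trans e_ge3.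
have /andP[b0 bc] := bf_card.
have b0' : (0 : R) < (b_f S w)%:R by rewrite ltr0n.
have c0' : (0 : R) < (card_Z S w)%:R by rewrite ltr0n (leq_trans b0).
apply/andP; split; last by rewrite ler_ln ?posrE ?c_gt0// c_le_d.
rewrite /c_1 ln_div ?posrE// lerD2l lerN2 ler_ln ?posrE// ler_nat.
exact: bc.
Qed.

End OneFibre.
End RandomMap.

(** * Growth along orbits *)

Section Fibred.
Context {d : measure_display} {Om : measurableType d}.

(** Functions with countably many values and measurable fibres.  Whatever is computed
from finitely many labels along an orbit is measurable, with no assumption on the
computation. *)
Definition fibred (T : countType) (W : Om -> T) := forall t, measurable (W @^-1` [set t]).

Lemma fibred_preimage (T : countType) (W : Om -> T) (P : set T) : fibred W -> measurable (W @^-1` P).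
Proof.
move=> fW; rewrite (_ : W @^-1` P =
  \bigcup_(n in [set n | exists2 t : T, P t & choice.pickle t = n]) (W @^-1` [set t | choice.pickle t = n])).
  apply: bigcup_measurable => n [t _ <-].
  rewrite (_ : [set t0 | _] = [set t]); first exact: fW.
  by apply/seteqP; split=> u /= [] => [/(pcan_inj choice.pickleK)|->].
apply/seteqP; split=> w /=.
  by move=> Pw; exists (choice.pickle (W w)) => //; exists (W w).
by move=> [n [t Pt <-]] /= /(pcan_inj choice.pickleK) ->.
Qed.

Lemma fibred_meas (T : countType) (W : Om -> T) d' (U : measurableType d') (G : T -> U) :
  fibred W -> measurable_fun setT (G \o W).
Proof.
by move=> fW _ Y mY; rewrite setTI comp_preimage; exact: fibred_preimage.
Qed.

Lemma fibred_map (T U : countType) (W : Om -> T) (G : T -> U) : fibred W -> fibred (G \o W).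
Proof. by move=> fW t; rewrite comp_preimage; exact: fibred_preimage. Qed.

Lemma fibred_comp (T : countType) (W : Om -> T) (s : Om -> Om) : measurable_fun setT s ->
  fibred W -> fibred (W \o s).
Proof. by move=> ms fW t; rewrite comp_preimage -[X in measurable X]setTI; exact: ms. Qed.

Lemma fibred_pair (T U : countType) (W : Om -> T) (V : Om -> U) : fibred W -> fibred V ->
  fibred (fun w => (W w, V w)).
Proof.
move=> fW fV [t u]; rewrite (_ : _ @^-1` _ = W @^-1` [set t] `&` V @^-1` [set u]).
  exact: measurableI.
by apply/seteqP; split=> w /= [-> ->].
Qed.

Lemma iter_meas (s : Om -> Om) n : measurable_fun setT s -> measurable_fun setT (iter n s).
Proof.
by move=> ms; elim: n => [|n IH] //=; [exact: measurable_id|exact: (measurableT_comp ms IH)].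
Qed.

End Fibred.

Lemma geo_sum {R : realType} (rho : R) n : 0 < rho < 1 -> \sum_(j < n) rho ^+ j <= (1 - rho)^-1.
Proof.
move=> /andP[r0 r1]; have h : 0 < 1 - rho by rewrite subr_gt0.
rewrite -[leRHS]mul1r ler_pdivlMr// mulrC.
suff -> : (1 - rho) * \sum_(j < n) rho ^+ j = 1 - rho ^+ n.
  by rewrite gerBl exprn_ge0// ltW.
elim: n => [|n IH]; first by rewrite big_ord0 expr0 mulr0 subrr.
by rewrite big_ord_recr/= mulrDr IH exprS; ring.
Qed.

Section Growth.
Context {R : realType} {d : measure_display} {Om : measurableType d} (m : probability Om R)
  (S : system R Om).
Hypothesis hS : random_open_map m S.
Hypothesis hphi : strongly_contracting m S.
Implicit Types (w : Om) (j : nat).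
Local Notation a := (lo S).
Local Notation b := (hi S).
Local Notation s := (sigma S).
Local Notation sV := (sigmaV S).
Local Notation orb := (orb s sV).
Local Notation subexp := (subexp m s sV).

Lemma sK : cancel s sV. Proof. by case: (rom_ergodic hS) => -[]. Qed.
Lemma sVK : cancel sV s. Proof. by case: (rom_ergodic hS) => -[]. Qed.
Lemma ms : measurable_fun setT s. Proof. by case: (rom_ergodic hS) => _ []. Qed.
Lemma msV : measurable_fun setT sV. Proof. by case: (rom_ergodic hS) => _ []. Qed.
Lemma minv A : measurable A -> m (s @^-1` A) = m A.
Proof. by case: (rom_ergodic hS) => _ _ h _; exact: h. Qed.
Lemma merg A : measurable A -> s @^-1` A = A -> m A = 0%E \/ m A = 1%E.
Proof. by case: (rom_ergodic hS) => _ _ _; exact. Qed.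

Lemma past_orb n w : past S n w = orb w (- n%:Z). Proof. by rewrite orb_iterV. Qed.
Lemma future_orb n w : future S n w = orb w n%:Z. Proof. by []. Qed.

Lemma ae_orbit (P : Om -> Prop) : {ae m, forall w, P w} -> {ae m, forall w, forall k, P (orb w k)}.
Proof. exact: (ae_orb sK ms msV minv). Qed.

Lemma fibred_label : fibred (label S).
Proof. exact: rom_index hS. Qed.

Lemma label_meas d' (U : measurableType d') (F : Om -> U) :
  (forall w w', label S w = label S w' -> F w = F w') -> measurable_fun setT F.
Proof.
move=> FE; rewrite (_ : F = (fun j => F (xget point [set w | label S w = j])) \o label S).
  exact: fibred_meas fibred_label.
apply/funext => w /=; apply: FE.
by case: xgetP => [w' _ /= ->//|/(_ w)]; case.
Qed.

Lemma lne_gt0_fin (x : R) : lne x%:E \is a fin_num -> 0 < x.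
Proof. by rewrite /lne; case: leP. Qed.

(** An infinite partition would have cardinal 0 in [card_Z], and the extended
logarithm of a number that is not positive is -oo. *)
Lemma ae_good : {ae m, forall w, goodw S w}.
Proof.
have [I1 _ I3 _ _] := hphi.
have A1 := integrable_ae measurableT I1; have A3 := integrable_ae measurableT I3.
apply: filterS2 A1 A3 => w /(_ I)/lne_gt0_fin h1 /(_ I)/lne_gt0_fin h3; split=> //.
apply: contrapT => nf; move: h1; by rewrite /card_Z /Z_ /fset_set; case: pselect => // _; rewrite ltxx.
Qed.

Lemma integrable_lne (G : nat -> R) : m.-integrable setT (fun w => lne (G (label S w))%:E) ->
  m.-integrable setT (EFin \o (fun w => ln (G (label S w)))).
Proof.
move=> I1; apply: (le_integrable measurableT _ _ I1).
  by apply: label_meas => w w' /= ->.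
by move=> w _ /=; rewrite /lne; case: (leP (G (label S w)) 0) => ? /=; rewrite ?leey ?lexx.
Qed.

(** The value 0 is taken on the negligible set of bad points, on which no bound is
available, so that integrability holds without exception. *)
Definition lnd w : R := if `[<goodw S w>] then ln (d_1 S w) else 0.
Definition lnc w : R := if `[<goodw S w>] then ln (c_1 S w) else 0.

Let d_label w w' : label S w = label S w' -> d_1 S w = d_1 S w'.
Proof.
move=> e; rewrite /d_1 /e_ /X_ /g_ /xi1 /contiguous /full_elements /nonfull_elements /Z_.
by rewrite e.
Qed.

Let c_label w w' : label S w = label S w' -> c_1 S w = c_1 S w'.
Proof.
by move=> e; rewrite /c_1 -!/(d_1 S _) (d_label e) /b_f /full_elements /Z_ e.
Qed.

Let lnd_meas : measurable_fun setT (EFin \o lnd).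
Proof. by apply: label_meas => w w' e; rewrite /= /lnd (d_label e) /goodw e. Qed.

Let lnc_meas : measurable_fun setT (EFin \o lnc).
Proof. by apply: label_meas => w w' e; rewrite /= /lnc (c_label e) /goodw e. Qed.

Let Ivar : m.-integrable setT (EFin \o (fun w => var a b (g_ S w) / norm_oo a b (g_ S w))).
Proof. by case: hphi. Qed.
Let Icard : m.-integrable setT (EFin \o (fun w => ln (card_Z S w)%:R)).
Proof. by case: hphi => + _ _ _ _; exact: (integrable_lne (G:=fun j => (#|` fset_set (partX S j)|%N)%:R)). Qed.
Let Inorm : m.-integrable setT (EFin \o (fun w => ln (norm_oo a b (g_ S w)))).
Proof. by case: hphi => _ + _ _ _; exact: (integrable_lne (G:=fun j => norm_oo a b (weight S j))). Qed.
Let IEinf : m.-integrable setT (EFin \o (fun w => ln (Einf (dom S) (g_ S w)))).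
Proof. by case: hphi => _ _ + _ _; exact: (integrable_lne (G:=fun j => Einf (dom S) (weight S j))). Qed.

Lemma lnd_integrable : m.-integrable setT (EFin \o lnd).
Proof.
have I1 := integrable_abse Ivar; have I2 := integrable_abse Icard.
have I3 := integrable_abse Inorm; have I4 := integrable_abse IEinf.
have I5 : m.-integrable setT (fun _ : Om => (4 : R)%:E) by exact: finite_measure_integrable_cst.
have I12 := integrableD measurableT I1 I2; have I34 := integrableD measurableT I3 I4.
have II := integrableD measurableT (integrableD measurableT I12 I34) I5.
apply: (le_integrable measurableT lnd_meas _ II) => w _ /=.
rewrite lee_fin /lnd; case: asboolP => [gw|_]; last by rewrite normr0.
have /andP[h0 h1] := ln_d_bounds hS gw.
rewrite (ger0_norm h0); apply: le_trans h1 _; apply: le_trans (ler_norm _).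
have := ler_norm (var a b (g_ S w) / norm_oo a b (g_ S w)).
have := ler_norm (ln (card_Z S w)%:R : R); have := ler_norm (ln (norm_oo a b (g_ S w))).
have := ler_norm (- ln (Einf (dom S) (g_ S w))); rewrite normrN.
lra.
Qed.

Lemma lnc_integrable : m.-integrable setT (EFin \o lnc).
Proof.
have II := integrableD measurableT (integrable_abse lnd_integrable) (integrable_abse Icard).
apply: (le_integrable measurableT lnc_meas _ II) => w _ /=.
rewrite lee_fin /lnc /lnd; case: asboolP => [gw|_]; last by rewrite !normr0.
have /andP[h0 h1] := ln_c_bounds hS gw; have /andP[h2 _] := ln_d_bounds hS gw.
rewrite [leRHS]ger0_norm ?addr_ge0// ler_norml.
have := ler_norm (ln (card_Z S w)%:R : R); have := ler_norm (ln (d_1 S w)).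
have := normr_ge0 (ln (card_Z S w)%:R : R).
by move=> ? ? ?; apply/andP; split; lra.
Qed.

Lemma lnc_integral : (\int[m]_w lne (c_1 S w)%:E)%E = (\int[m]_w lnc w)%:E.
Proof.
rewrite /Rintegral fineK; last exact: integrable_fin_num lnc_integrable.
apply: ae_eq_integral => //.
- by apply: label_meas => w w' e; rewrite (c_label e).
- apply: filterS ae_good => w gw _; change (lne (c_1 S w)%:E = (lnc w)%:E).
  rewrite lne_EFin ?(c_gt0 hS)// /lnc.
  by case: asboolP.
Qed.

Lemma lnc_integral_lt0 : \int[m]_w lnc w < 0.
Proof. by case: hphi => _ _ _ _; rewrite lnc_integral lte_fin. Qed.

Section Aperture.
Variable gamma : R.
Hypothesis g01 : 0 < gamma < 1.
Hypothesis gc : \int[m]_w lnc w < ln gamma.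

Let g0 : 0 < gamma. Proof. by case/andP: g01. Qed.

Definition a_term w j : R := gamma ^- j.+1 * d_1 S (past S j.+1 w)
   * \prod_(1 <= k < j.+1) c_1 S (past S k w).

Definition good_orbit w := forall k, goodw S (orb w k).

Lemma ae_good_orbit : {ae m, forall w, good_orbit w}. Proof. exact: ae_orbit ae_good. Qed.

Lemma good_orbitP w k : good_orbit w -> good_orbit (orb w k).
Proof. by move=> h l; rewrite orbD//; [exact: sK|exact: sVK]. Qed.

Lemma a_termE w j : good_orbit w -> a_term w j =
  expR (- (j.+1%:R * ln gamma) + lnd (orb w (- j.+1%:Z)) + \sum_(k < j) lnc (orb w (- 1 - k%:Z))).
Proof.
move=> gw; rewrite !expRD /a_term; congr (_ * _ * _).
- by rewrite expRN mulrC expRM_natr lnK.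
- rewrite /lnd asboolT; last exact: gw.
  rewrite -past_orb lnK// posrE.
  by rewrite past_orb; apply: lt_le_trans (e_ge3 hS (gw _)).
- rewrite big_add1 big_mkord /= expR_sum; apply: eq_bigr => k _.
  rewrite /lnc asboolT; last exact: gw.
  rewrite -(_ : past S k.+1 w = orb w (- 1 - k%:Z)).
    by rewrite lnK// posrE past_orb; exact: (c_gt0 hS (gw _)).
  by rewrite past_orb -addn1 PoszD opprD addrC.
Qed.

Lemma a_term_gt0 w j : good_orbit w -> 0 < a_term w j.
Proof. by move=> /a_termE ->; exact: expR_gt0. Qed.

(** By Birkhoff's theorem the logarithm of the j-th term at sigma^i w differs from
j (int log c_1 - log gamma) by an error of small slope in |i| + j; as the coefficient
of j is negative, the series is dominated by a geometric one. *)
Lemma a_partial_bound : {ae m, forall w, good_orbit w /\ forall e, 0 < e -> exists K, forall (i : int) n,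
  \sum_(j < n) a_term (orb w i) j <= expR (e * `|i|%N%:R + K)}.
Proof.
have B1 := birkhoff2 sK ms msV minv merg lnc_integrable.
have B2 := subexp_integrable sK ms msV minv merg lnd_integrable.
apply: filterS3 ae_good_orbit B1 B2 => w gw h1 h2; split=> // e e0.
have gc' := gc; set c := \int[m]_w lnc w in gc' h1.
pose de := ln gamma - c; have de0 : 0 < de by rewrite subr_gt0.
pose e' := Num.min (e / 2) (de / 4).
have e'0 : 0 < e' by rewrite lt_min !divr_gt0.
have [e'1 e'2] : e' <= e / 2 /\ e' <= de / 4 by rewrite /e' !ge_min !lexx orbT.
have [K1 k1] := h1 _ e'0; have [K2 k2] := h2 _ e'0.
pose rho := expR (- (de / 2)).
have r01 : 0 < rho < 1 by rewrite expR_gt0 expR_lt1/= oppr_lt0 divr_gt0.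
pose K3 := K1 + K2 + de - ln gamma + e'.
exists (K3 + ln ((1 - rho)^-1)) => i n.
have r1 : 0 < (1 - rho)^-1 by rewrite invr_gt0 subr_gt0; case/andP: r01.
rewrite addrA expRD lnK ?posrE//.
apply: le_trans (_ : \sum_(j < n) expR (e * `|i|%N%:R + K3) * rho ^+ j <= _); last first.
  by rewrite -mulr_sumr ler_pM2l ?expR_gt0// geo_sum.
apply: ler_sum => j _; rewrite a_termE; last exact: good_orbitP.
rewrite -expRM_natr -expRD ler_expR.
under eq_bigr do rewrite (orbD sK sVK) addrA.
rewrite (orbD sK sVK).
have := k2 (i + - j.+1%:Z).
have := k1 (i - 1) j.
have u1 := absz_leD (R:=R) i (- 1); have u2 := absz_leD (R:=R) i (- j.+1%:Z).
rewrite abszN /= in u1; rewrite abszN /= in u2.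
have v1 : e' * `|(i + - 1)%R|%N%:R <= e' * (`|i|%N%:R + 1) by rewrite ler_pM2l.
have v2 : e' * `|(i - j.+1%:Z)%R|%N%:R <= e' * (`|i|%N%:R + j.+1%:R) by rewrite ler_pM2l.
rewrite ler_norml => /andP[_ w1] w2.
have i0 : 0 <= `|i|%N%:R :> R by []. have j0 : 0 <= (j : nat)%:R :> R by [].
have x1 : e' * `|i|%N%:R <= e / 2 * `|i|%N%:R by rewrite ler_wpM2r.
have x2 : e' * j%:R <= de / 4 * j%:R by rewrite ler_wpM2r.
move: w1 w2 v1 v2 x1 x2; rewrite -[j.+1%:R]natr1.
have K3E : K3 = K1 + K2 + de - ln gamma + e' by []; have deE : de = ln gamma - c by [].
clearbody K3 de e' c; move: (\sum_(_ < _) _) (lnd _) `|_|%N%:R `|_|%N%:R => X Y Z U.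
clear -K3E deE e'2 de0; set J := (j : nat)%:R; set N := `|_|%N%:R; clearbody J N.
set G := ln gamma in K3E deE *; clearbody G; move=> *; nra.
Qed.

Lemma a_term0 w : a_term (s w) 0 = gamma^-1 * d_1 S w.
Proof. by rewrite /a_term big_geq// mulr1 expr1 /past/= sK. Qed.

Lemma a_termS w j : a_term (s w) j.+1 = gamma^-1 * c_1 S w * a_term w j.
Proof.
have P k : past S k.+1 (s w) = past S k w by rewrite /past iterSr sK.
rewrite /a_term P big_nat_recl//= /past/= sK -/(past S _ _).
under eq_bigr do rewrite -[sV (iter _ _ _)]/(past S _.+1 (s w)) P.
by rewrite [gamma ^+ j.+2]exprS invfM; ring.
Qed.

Lemma a_series w B : good_orbit w -> (forall n, \sum_(j < n) a_term w j <= B) ->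
  (\sum_(0 <= j <oo) (a_term w j)%:E)%E = (a_ S gamma w)%:E /\ 0 <= a_ S gamma w <= B.
Proof.
move=> gw hB; have t0 j : (0 <= (a_term w j)%:E)%E by rewrite lee_fin ltW// a_term_gt0.
have lB : (\sum_(0 <= j <oo) (a_term w j)%:E <= B%:E)%E.
  apply: lime_le; first exact: is_cvg_nneseries.
  by near=> n; rewrite big_mkord sumEFin lee_fin.
have l0 : (0 <= \sum_(0 <= j <oo) (a_term w j)%:E)%E by exact: nneseries_ge0.
have E : (\sum_(0 <= j <oo) (a_term w j)%:E)%E = (a_ S gamma w)%:E.
  rewrite /a_ fineK// ge0_fin_numE//; exact: le_lt_trans lB (ltry _).
by split=> //; rewrite -!lee_fin -E l0 lB.
Unshelve. all: by end_near. Qed.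

(** The recursion separates the first term of the series from the others, which form
a multiple of the series at the preceding point.  It is designed so that the operator maps the
cone of parameter a_w into the cone of parameter gamma times that of sigma w. *)
Lemma aperture : {ae m, forall w, good_orbit w /\ forall k, 1 <= a_ S gamma (orb w k) /\
  a_ S gamma (s (orb w k)) = gamma^-1 * (c_1 S (orb w k) * a_ S gamma (orb w k) + d_1 S (orb w k))}.
Proof.
apply: filterS a_partial_bound => w [gw h]; split=> //.
have H k : exists B, forall n, \sum_(j < n) a_term (orb w k) j <= B.
  by have [K hK] := h _ ltr01; eexists => n; exact: hK.
have rec k : a_ S gamma (s (orb w k)) =
    gamma^-1 * (c_1 S (orb w k) * a_ S gamma (orb w k) + d_1 S (orb w k)).
  have [B hB] := H k; have [B' hB'] := H (k + 1).
  have [E _] := a_series (good_orbitP k gw) hB.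
  rewrite -(orbS sVK); have [E' _] := a_series (good_orbitP (k + 1) gw) hB'.
  apply: EFin_inj; rewrite -E' nneseries_recl//; last first.
    by move=> j _; rewrite lee_fin ltW// a_term_gt0//; exact: good_orbitP.
  rewrite -(nneseries_addn 1); last first.
    by move=> j; rewrite lee_fin ltW// a_term_gt0//; exact: good_orbitP.
  under eq_eseriesr do rewrite addn1 (orbS sVK) a_termS EFinM.
  rewrite nneseriesZl; last by move=> j _; rewrite lee_fin ltW// a_term_gt0//; exact: good_orbitP.
  by rewrite E (orbS sVK) a_term0 -EFinM -EFinD; congr EFin; ring.
move=> k; split=> //.
have [B hB] := H (k - 1); have [_ /andP[a0 _]] := a_series (good_orbitP (k - 1) gw) hB.
have gk := gw (k - 1).
have := rec (k - 1); rewrite -(orbS sVK) subrK => ->.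
have e3 := e_ge3 hS gk; have c0 := c_gt0 hS gk.
have ca : 0 <= c_1 S (orb w (k - 1)) * a_ S gamma (orb w (k - 1)) by rewrite mulr_ge0// ltW.
have gi : 1 <= gamma^-1 by rewrite invf_ge1//; case/andP: g01 => _ /ltW.
apply: le_trans gi _; rewrite ler_peMr//; first by rewrite invr_ge0 ltW.
by rewrite /d_1; lra.
Qed.

Lemma aperture_subexp : subexp (fun w => ln (1 + a_ S gamma w)).
Proof.
apply: filterS a_partial_bound => w [gw h] e e0.
have [K hK] := h _ e0; pose K' := Num.max K 0; exists (1 + K') => k.
have [_ /andP[a0 aB]] := a_series (good_orbitP k gw) (hK k).
have {}aB : a_ S gamma (orb w k) <= expR (e * `|k|%N%:R + K').
  by apply: le_trans aB _; rewrite ler_expR lerD2l le_max lexx.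
have u0 : 0 <= e * `|k|%N%:R + K' by rewrite addr_ge0 ?mulr_ge0// ?le_max ?lexx ?orbT// ltW.
have : expR 0 <= expR (e * `|k|%N%:R + K') by rewrite ler_expR.
rewrite expR0 => e1.
apply: (@le_trans _ _ (ln ((1 + 1) * expR (e * `|k|%N%:R + K')))).
  by rewrite ler_ln ?posrE; lra.
rewrite lnM ?posrE ?expR_gt0// expRK.
have l2 : ln (1 + 1) <= 1 :> R by apply: le_ln1Dx; lra.
lra.
Qed.

(** The terms depend on finitely many labels.  Their positive parts, which are the
terms themselves at almost every point, form a series of nonnegative functions. *)
Lemma aperture_meas : exists2 a', measurable_fun setT (a' : Om -> R) & {ae m, forall w, a' w = a_ S gamma w}.
Proof.
exists (fun w => fine (\sum_(0 <= j <oo) (Num.max (a_term w j) 0)%:E)%E).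
  apply: (measurableT_comp (fine_measurable measurableT)).
  apply: (@ge0_emeasurable_sum _ _ _ _ _ xpredT) => [j w _ _|j _].
    by rewrite lee_fin le_max lexx orbT.
  apply/measurable_EFinP/measurable_maxr => //; apply: measurable_funM.
    apply: measurable_funM => //.
    apply: (measurableT_comp (f:=d_1 S) _ (iter_meas j.+1 msV)).
    by apply: label_meas => w w' /d_label.
  apply: measurable_prod => k _.
  apply: (measurableT_comp (f:=c_1 S) _ (iter_meas k msV)).
  by apply: label_meas => w w' /c_label.
apply: filterS ae_good_orbit => w gw; rewrite /a_; congr fine.
by apply: eq_eseriesr => j _; rewrite max_l// ltW// a_term_gt0.
Qed.

End Aperture.
End Growth.

(** * Contraction along the cocycle *)

(** The points x with [x, x + 1/n[ in U that share a rational window of length 1/n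
have overlapping intervals: so U is a countable union of intervals. *)
Lemma sorgenfrey_meas {R : realType} (U : set R) :
  (forall x, U x -> exists2 e, 0 < e & forall y, x <= y < x + e -> U y) ->
  measurable (U : set (measurableTypeR R)).
Proof.
move=> hU.
pose V (n : nat) (q : rat) : set R := [set y | exists x, [/\ ratr q <= x, x <= y, y < ratr q + n.+1%:R^-1 &
  forall z, x <= z < x + n.+1%:R^-1 -> U z]].
have -> : U = \bigcup_n \bigcup_q V n q.
  apply/seteqP; split=> y.
    move=> /hU[e e0 he].
    pose n := Num.bound e^-1; have n0 : 0 < n.+1%:R^-1 :> R by rewrite invr_gt0.
    have ne : n.+1%:R^-1 < e.
      rewrite invf_plt ?posrE//; apply: lt_trans (archi_boundP (ltW _)) _; first by rewrite invr_gt0.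
      by rewrite ltr_nat.
    have [q] : exists q : rat, ratr q \in `](y - n.+1%:R^-1), y[ by apply: rat_in_itvoo; rewrite gtrBl.
    rewrite in_itv/= => /andP[q1 q2].
    exists n => //; exists q => //; exists y; split; [exact: ltW|by []|by rewrite -ltrBlDr|].
    by move=> z /andP[z1 z2]; apply: he; rewrite z1/= (lt_trans z2)// ltrD2l.
  move=> [n _ [q _ [x [qx xy yq hz]]]]; apply: hz; rewrite xy/=.
  by apply: lt_le_trans yq _; rewrite lerD2r.
apply: bigcup_measurable => n _; apply: bigcupT_measurable_rat => q.
apply: (@is_interval_measurable R) => y1 y2 [x [h1 h2 h3 h4]] [x' [_ _ h3' _]] z /andP[z1 z2].
by exists x; split=> //; [exact: le_trans z1|exact: le_lt_trans h3'].
Qed.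

(** When P depends on w through the value of W only, the set in question splits into
countably many measurable pieces, one for each value of W. *)
Lemma fibred_param {R : realType} {d : measure_display} {Om : measurableType d} (T : countType)
    (W : Om -> T) (u : Om -> R) (P : Om -> R -> Prop) :
  fibred W -> measurable_fun setT u -> (forall w w' x, W w = W w' -> P w x -> P w' x) ->
  (forall w, measurable ([set x | P w x] : set (measurableTypeR R))) -> measurable [set w | P w (u w)].
Proof.
move=> fW mu hP mP.
rewrite (_ : [set w | P w (u w)] = \bigcup_(n in setT) \bigcup_(t in [set t : T | choice.pickle t = n])
    (W @^-1` [set t] `&` u @^-1` [set x | P (xget point (W @^-1` [set t])) x])).
  apply: bigcup_measurable => n _.
  have [[t tn]|no] := pselect (exists t : T, choice.pickle t = n); last first.
    rewrite (_ : [set t : T | choice.pickle t = n] = set0) ?bigcup_set0//.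
    by apply/seteqP; split=> // t tn; apply: no; exists t.
  rewrite (_ : [set t : T | choice.pickle t = n] = [set t]) ?bigcup_set1.
    apply: measurableI; first exact: fW.
    by rewrite -[X in measurable X]setTI; apply: mu => //; exact: mP.
  by apply/seteqP; split=> t' /=; [rewrite -tn => /(pcan_inj choice.pickleK)|move=> ->].
apply/seteqP; split=> w.
  move=> /= Pw; exists (choice.pickle (W w)) => //; exists (W w) => //; split=> //=.
  by apply: hP Pw; case: xgetP => [w' _ /= <-//|/(_ w)]; case.
move=> [n _ [t _ [/= Ww]]].
by apply: hP; case: xgetP => [w' _ /= ->//|/(_ w)]; case.
Qed.

Lemma pos_union {R : realType} {d : measure_display} {Om : measurableType d} (m : probability Om R)
    (E : nat -> set Om) : (forall n, measurable (E n)) -> {ae m, forall w, exists n, E n w} ->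
  exists n, (0 < m (E n))%E.
Proof.
move=> mE aeE; apply: contrapT => /forallNP h.
have z n : m (E n) = 0%E.
  by apply/eqP; rewrite eq_le measure_ge0 andbT leNgt; apply/negP/h.
have [A [mA A0 hA]] := aeE.
have : m setT = 0%E.
  apply/eqP; rewrite eq_le measure_ge0 andbT.
  have -> : [set: Om] = \bigcup_n E n `|` A.
    apply/seteqP; split=> // w _; apply: contrapT => /not_orP[n1 n2].
    by apply: n2; apply: hA => -[n En]; apply: n1; exists n.
  apply: le_trans (measureU2 _ _ _) _ => //; first exact: bigcup_measurable.
  rewrite [X in (_ + X <= _)%E](_ : _ = 0%E) ?adde0; last exact: A0.
  have mU : measurable (\bigcup_n E n) by exact: bigcup_measurable.
  have nU : m.-negligible (\bigcup_n E n) by apply: negligible_bigcup => k; apply/negligibleP; [exact: mE|exact: z].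
  by rewrite [X in (X <= _)%E](_ : _ = 0%E) => //; exact/(negligibleP _ mU).
by rewrite probability_setT => /eqP; rewrite onee_eq0.
Qed.

Lemma ln_concave {R : realType} (k z : R) : 0 <= k <= 1 -> 0 <= z -> k * ln (1 + z) <= ln (1 + k * z).
Proof.
move=> /andP[k0 k1] z0; set X := 1 + k * z.
have kz : 0 <= k * z by rewrite mulr_ge0.
have X0 : 0 < X by rewrite /X; lra.
have lnle (y : R) : 0 < y -> ln y <= y - 1.
  by move=> y0; rewrite -{1}(subrKC 1 y); apply: le_ln1Dx; lra.
have h1 : ln (1 + z) - ln X <= (1 + z) / X - 1.
  by rewrite -ln_div ?posrE; [apply: lnle; rewrite divr_gt0//; lra|lra|].
have h2 : - ln X <= X^-1 - 1 by rewrite -lnV ?posrE//; apply: lnle; rewrite invr_gt0.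
have e : k * ((1 + z) / X - 1) + (1 - k) * (X^-1 - 1) = 0.
  by rewrite /X; field; rewrite gt_eqF.
have m1 := ler_wpM2l k0 h1.
have k1' : 0 <= 1 - k by lra.
have m2 := ler_wpM2l k1' h2.
move: m1 m2 e; set p := k * (_ / _ - 1); set r := (1 - k) * (_ - 1) => m1 m2 e; lra.
Qed.

Section Contraction.
Context {R : realType} {d : measure_display} {Om : measurableType d} (m : probability Om R)
  (S : system R Om).
Hypothesis hS : random_open_map m S.
Hypothesis hphi : strongly_contracting m S.
Implicit Types (w : Om) (j n : nat).
Local Notation a := (lo S).
Local Notation b := (hi S).
Local Notation s := (sigma S).
Local Notation sV := (sigmaV S).
Local Notation orb := (orb s sV).
Local Notation subexp := (subexp m s sV).
Local Notation BV := (inBV a b).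
Local Notation ab := (rm_ab hS).
Local Notation sK := (sK hS).
Local Notation sVK := (sVK hS).

Lemma future_pastK n w : future S n (past S n w) = w.
Proof. by rewrite future_orb past_orb (orbD sK sVK) addNr. Qed.

Lemma past_futureK n w : past S n (future S n w) = w.
Proof. by rewrite future_orb past_orb (orbD sK sVK) subrr. Qed.

Lemma good_orbit_future n w : good_orbit S w -> good_orbit S (future S n w).
Proof. by rewrite future_orb; exact: (good_orbitP hS). Qed.

Lemma good_orbit_good w : good_orbit S w -> goodw S w.
Proof. by move=> /(_ 0). Qed.

Lemma transfer_nD k n w f : transfer_n S (n + k) w f = transfer_n S n (future S k w) (transfer_n S k w f).
Proof.
elim: n => [//|n IH]; rewrite addSn /= IH; congr (transfer S _ _).
by rewrite /future -iterD.
Qed.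

Lemma trn_linear n w : good_orbit S w -> linear_op (transfer_n S n w).
Proof.
move=> gw; elim: n => [//|n IH] k l f h /=.
by rewrite IH (tr_linear hS)//; exact/good_orbit_good/good_orbit_future.
Qed.

Lemma trn_BV n w f : good_orbit S w -> BV f -> BV (transfer_n S n w f).
Proof.
move=> gw bf; elim: n => [//|n IH] /=.
by apply: (tr_BV hS) IH; exact/good_orbit_good/good_orbit_future.
Qed.

Lemma trn_coc n w f h : good_orbit S w -> coc a b (fun x => f x = h x) ->
  coc a b (fun x => transfer_n S n w f x = transfer_n S n w h x).
Proof.
move=> gw fh; elim: n => [//|n IH] /=.
by apply: (tr_coc hS) IH; exact/good_orbit_good/good_orbit_future.
Qed.

Lemma trn_Einf_gt0 n w f : good_orbit S w -> BV f -> 0 < Einf (dom S) f ->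
  0 < Einf (dom S) (transfer_n S n w f).
Proof.
move=> gw bf f0; elim: n => [//|n IH] /=.
have gn : goodw S (future S n w) by exact/good_orbit_good/good_orbit_future.
have bn := trn_BV n gw bf.
apply: lt_le_trans (tr_Einf hS gn bn _).
  by rewrite mulr_gt0//; exact: Einf_g_gt0.
apply: coc_sub (BV_Einf ab bn) => x _; apply: le_trans; exact: ltW.
Qed.

Section Aperture.
Variable gamma : R.
Hypothesis g01 : 0 < gamma < 1.
Hypothesis gc : \int[m]_w lnc S w < ln gamma.
Local Notation al := (a_ S gamma).
Let g0 : 0 < gamma. Proof. by case/andP: g01. Qed.

(** The condition bears on the whole orbit, so that it is invariant. *)
Definition nice w := forall k, [/\ goodw S (orb w k), 1 <= al (orb w k) &
  al (s (orb w k)) = gamma^-1 * (c_1 S (orb w k) * al (orb w k) + d_1 S (orb w k))].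

Lemma ae_nice : {ae m, forall w, nice w}.
Proof.
by apply: filterS (aperture hS hphi g01 gc) => w [gw h] k; have [h1 h2] := h k; split.
Qed.

Lemma nice_good w : nice w -> good_orbit S w. Proof. by move=> h k; case: (h k). Qed.

Lemma nice_orb w k : nice w -> nice (orb w k).
Proof. by move=> h l; rewrite (orbD sK sVK). Qed.

Lemma nice_future n w : nice w -> nice (future S n w). Proof. by rewrite future_orb; exact: nice_orb. Qed.
Lemma nice_past n w : nice w -> nice (past S n w). Proof. by rewrite past_orb; exact: nice_orb. Qed.

Lemma al_ge1 w : nice w -> 1 <= al w. Proof. by move=> /(_ 0)[]. Qed.
Lemma al_gt0 w : nice w -> 0 < al w. Proof. by move=> /al_ge1; exact: lt_le_trans. Qed.

Lemma al_rec w : nice w -> gamma * al (s w) = c_1 S w * al w + d_1 S w.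
Proof. by move=> /(_ 0)[_ _ ->]; rewrite mulrA divff ?mul1r// gt_eqF. Qed.

Lemma tr_maps w : nice w -> maps_cone a b (transfer S w) (al w) (gamma * al (s w)).
Proof.
move=> nw f kf; rewrite al_rec//.
by apply: (tr_kcone hS) => //; [exact: (good_orbit_good (nice_good nw))|exact: al_gt0].
Qed.

Lemma trn_maps n w : nice w -> maps_cone a b (transfer_n S n w) (al w) (al (future S n w)).
Proof.
move=> nw f kf; elim: n => [//|n IH] /=.
have nn := nice_future n nw.
apply: (kcone_mono ab) (tr_maps nn IH); first by rewrite mulr_gt0// al_gt0//; exact: (nice_future n.+1).
rewrite ger_pMl; first by case/andP: g01 => _ /ltW.
by apply: al_gt0; exact: (nice_future n.+1).
Qed.

(** Along n steps, contraction by k of x - 1, where ln x bounds the projective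
distance.  In this form the composition of contractions multiplies their factors. *)
Definition Contr w n (k : R) := forall f h x, kcone a b (al w) f -> kcone a b (al w) h -> 1 <= x ->
  cmp a b (al w) f h x ->
  cmp a b (al (future S n w)) (transfer_n S n w f) (transfer_n S n w h) (1 + k * (x - 1)).

Lemma Contr_nonexp w n : nice w -> Contr w n 1.
Proof.
move=> nw f h x kf kh x1 c; rewrite mul1r subrKC.
by apply: cmp_nonexp c; [exact/trn_linear/nice_good|exact: trn_maps].
Qed.

Lemma Contr_comp w n1 n2 k1 k2 : nice w -> 0 <= k1 -> Contr w n1 k1 -> Contr (future S n1 w) n2 k2 ->
  Contr w (n2 + n1) (k2 * k1).
Proof.
move=> nw k10 C1 C2 f h x kf kh x1 c; rewrite !transfer_nD.
have -> : future S (n2 + n1) w = future S n2 (future S n1 w) by rewrite /future iterD.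
have x1' : 1 <= 1 + k1 * (x - 1) by rewrite lerDl mulr_ge0// subr_ge0.
have := C2 _ _ _ (trn_maps n1 nw kf) (trn_maps n1 nw kh) x1' (C1 _ _ _ kf kh x1 c).
by congr (cmp _ _ _ _ _ _); ring.
Qed.

Lemma Contr_mono w n k1 k2 : nice w -> k1 <= k2 -> Contr w n k1 -> Contr w n k2.
Proof.
move=> nw k12 C f h x kf kh x1 c; apply: (cmp_mono ab) (C _ _ _ kf kh x1 c).
- by apply/ltW/al_gt0/nice_future.
- exact: trn_maps.
- by rewrite lerD2l ler_wpM2r// subr_ge0.
Qed.

Lemma Contr_step w : nice w -> Contr w 1 (1 - kap gamma (al (s w)) ^+ 2).
Proof.
move=> nw f h x kf kh x1 c.
apply: (cmp_contract ab g01 _ _ _ kf x1 c); first by apply: al_gt0; exact: (nice_future 1).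
- exact: (tr_linear hS (good_orbit_good (nice_good nw))).
- exact: tr_maps.
Qed.

(** The constant is attached to the end point of the orbit segment and is
subexponential along the orbits; hence the estimate can be used both for segments
that end at w and for segments that start at w. *)
Definition contracts theta := exists A : Om -> R, subexp A /\ {ae m, forall w,
  [/\ nice w, 0 <= A w & forall n, Contr (past S n w) n (expR (A w) * theta ^+ n)]}.

(** The aperture is at most A0 on a set of positive measure.  A step that ends there
contracts by the factor k0 = 1 - kap(A0)^2, the other steps do not expand, and
[visits] bounds the number of the former from below. *)
Lemma contracts_visits : exists theta, 0 < theta < 1 /\ contracts theta.
Proof.
have [a' ma' aa'] := aperture_meas hS hphi g01.
pose E N := [set w | a' w <= N%:R].
have mE N : measurable (E N).
  by rewrite /E -[X in measurable X]setTI; exact: measurable_fun_le.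
have [N N0] : exists N, (0 < m (E N))%E.
  apply: pos_union => //; apply: aeW => w; exists (Num.bound `|a' w|).
  by apply/ltW; apply: le_lt_trans (ler_norm _) _; exact: archi_boundP (normr_ge0 _).
have ee := rom_ergodic hS.
have [M [p [p0 sM vis]]] := visits sK sVK (ms hS) (msV hS) (minv hS) (merg hS) (mE N) N0.
pose A0 : R := Num.max N%:R 1.
have A01 : 1 <= A0 by rewrite le_max lexx orbT.
have kA : 0 < kap gamma A0 < 1 by apply: kap_itv => //; exact: lt_le_trans A01.
pose k0 := 1 - kap gamma A0 ^+ 2.
have k01 : 0 < k0 < 1.
  rewrite subr_gt0 exprn_ilt1//; [|by case/andP: kA => /ltW|by case/andP: kA].
  by rewrite gtrBl exprn_gt0//; case/andP: kA.
have lk0 : ln k0 < 0 by rewrite ln_lt0.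
exists (expR (p * ln k0)); split.
  by rewrite expR_gt0 expR_lt1 nmulr_llt0.
exists (fun w => - ln k0 * M w); split.
  by apply: subexp_scale => //; rewrite oppr_ge0 ltW.
have aa'o := ae_orbit hS aa'.
apply: filterS3 ae_nice vis aa'o => w nw vw aw; split=> // [|n].
  by rewrite mulr_ge0 ?oppr_ge0 ?(ltW lk0)//; case: (vw 0%N).
have H : Contr (past S n w) n (expR (ln k0 * \sum_(j < n) (\1_(E N) (orb w (- j%:Z)) : R))).
  have nonexp : forall w, nice w -> Contr w 0 (expR 0) by move=> *; rewrite expR0; exact: Contr_nonexp.
  suff H l : (l <= n)%N -> Contr (past S n w) l
      (expR (ln k0 * \sum_(j < l) (\1_(E N) (orb w (- (n - l + j)%N%:Z)) : R))).
    by have := H n (leqnn n); under eq_bigr do rewrite subnn add0n.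
  elim: l => [_|l IH ln_]; first by rewrite big_ord0 mulr0; exact/nonexp/nice_past.
  have nl : nice (future S l (past S n w)) by exact/nice_future/nice_past.
  have P : s (future S l (past S n w)) = orb w (- (n - l.+1)%N%:Z).
    rewrite -/(future S l.+1 _) future_orb past_orb (orbD sK sVK).
    by rewrite -(orbS sVK); congr (orb w _); clear -ln_; lia.
  rewrite -[l.+1]add1n big_ord_recl mulrDr expRD.
  apply: (Contr_comp (nice_past n nw) (expR_ge0 _)).
    have := IH (ltnW ln_); congr (Contr _ _ (expR (_ * _))).
    apply: eq_bigr => j _; congr (\1_(E N) (orb w (- Posz _))); rewrite lift0.
    by move: (nat_of_ord j) => i; clear -ln_; lia.
  apply: Contr_mono (Contr_step nl) => //; rewrite P /= addn0.
  rewrite indicE; case: (boolP (_ \in _)) => [/set_mem Ew|_]; last first.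
    by rewrite mulr0 expR0 gerBl sqr_ge0.
  rewrite mulr1 lnK ?posrE; last by case/andP: k01.
  rewrite lerB//; have alA : al (orb w (- (n - l.+1)%N%:Z)) <= A0.
    by rewrite -aw le_max; apply/orP; left.
  have a1 : 1 <= al (orb w (- (n - l.+1)%N%:Z)) by apply/al_ge1/nice_orb.
  rewrite ler_pXn2r ?nnegrE//; [|by case/andP: kA => /ltW|].
    have := g01 => /andP[gg0 gg1]; rewrite /kap ler_pM2l ?subr_gt0// lef_pV2 ?posrE.
    - by rewrite lerD2l ler_pM2l.
    - by rewrite !addr_gt0// mulr_gt0//; lra.
    - by rewrite !addr_gt0// mulr_gt0//; lra.
  by apply: ltW; have /andP[] : 0 < kap gamma (al (orb w (- (n - l.+1)%N%:Z))) < 1 by apply: kap_itv => //; lra.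
apply: Contr_mono H; first exact: nice_past.
rewrite -expRM_natr -expRD ler_expR.
have [_ h] := vw n.
rewrite -(ler_nM2l lk0) in h; apply: le_trans h _; lra.
Qed.

End Aperture.
End Contraction.

(** * The rate of contraction of the projective metrics *)

Section Rate.
Context {R : realType} {d : measure_display} {Om : measurableType d} (m : probability Om R)
  (S : system R Om).
Hypothesis hS : random_open_map m S.
Hypothesis hphi : strongly_contracting m S.
Implicit Types (w : Om) (j n l : nat).
Local Notation a := (lo S).
Local Notation b := (hi S).
Local Notation s := (sigma S).
Local Notation sV := (sigmaV S).
Local Notation orb := (orb s sV).
Local Notation BV := (inBV a b).
Local Notation ab := (rm_ab hS).
Local Notation sK := (sK hS).
Local Notation sVK := (sVK hS).

Lemma future_past k n w : (k <= n)%N -> future S (n - k) (past S n w) = past S k w.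
Proof. by move=> kn; rewrite -{2}(subnK kn) /past iterD; exact: (future_pastK hS). Qed.

Lemma transfer_label w w' : label S w = label S w' -> transfer S w = transfer S w'.
Proof. by move=> e; rewrite /transfer /T_ /g_ /Z_ e. Qed.

Definition word l w : seq nat := mkseq (fun i => label S (future S i w)) l.

Lemma word_label l w w' i : (i < l)%N -> word l w = word l w' ->
  label S (future S i w) = label S (future S i w').
Proof. by move=> il E; have := congr1 (fun t => nth 0%N t i) E; rewrite !nth_mkseq. Qed.

Lemma fibred_word l : fibred (word l).
Proof.
elim: l => [|l IH].
  move=> t; rewrite (_ : _ @^-1` _ = if t == [::] then setT else set0); first by case: ifP.
  by apply/seteqP; split=> w; rewrite /= /word /=; [move=> <-; rewrite eqxx|case: eqP => // ->].
have -> : word l.+1 = (fun p : seq nat * nat => rcons p.1 p.2) \o (fun w => (word l w, label S (future S l w))).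
  by apply/funext => w; rewrite /word mkseqS.
apply/fibred_map/fibred_pair => //.
exact: (fibred_comp (iter_meas l (ms hS)) (fibred_label hS)).
Qed.

Lemma word_transfer l w w' : word l w = word l w' -> transfer_n S l w = transfer_n S l w'.
Proof.
move=> E; suff H i : (i <= l)%N -> transfer_n S i w = transfer_n S i w' by exact: H.
elim: i => [//|i IH] il; apply/funext => f /=.
by rewrite IH ?(ltnW il)// (transfer_label (word_label il E)).
Qed.

Section Gamma.
Variables gamma theta : R.
Hypothesis g01 : 0 < gamma < 1.
Hypothesis gc : \int[m]_w lnc S w < ln gamma.
Hypothesis t01 : 0 < theta < 1.
Local Notation al := (a_ S gamma).

(** The recursion of the aperture from an arbitrary initial value x: it depends on
the real number x and on a word of labels only. *)
Fixpoint aper l w (x : R) := if l is k.+1 then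
  gamma^-1 * (c_1 S (future S k w) * aper k w x + d_1 S (future S k w)) else x.

Lemma aper_al l w : nice S gamma w -> aper l w (al w) = al (future S l w).
Proof.
move=> nw; elim: l => [//|l IH] /=; rewrite IH.
by have [_ _ e] := nw (Posz l); exact/esym/e.
Qed.

Lemma aper_affine l w : exists P, forall x y, aper l w y = aper l w x + P * (y - x).
Proof.
elim: l => [|l [P IH]] /=; first by exists 1 => x y; ring.
exists (gamma^-1 * c_1 S (future S l w) * P) => x y; rewrite (IH x y); ring.
Qed.

Lemma aper_word l w w' : word l w = word l w' -> aper l w = aper l w'.
Proof.
move=> E; suff H i : (i <= l)%N -> aper i w = aper i w' by exact: H.
elim: i => [//|i IH] il; apply/funext => x /=; rewrite IH ?(ltnW il)//.
have e := word_label il E.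
suff [-> ->] : c_1 S (future S i w) = c_1 S (future S i w') /\ d_1 S (future S i w) = d_1 S (future S i w') by [].
rewrite /c_1 /d_1 /e_ /X_ /g_ /xi1 /contiguous /b_f /full_elements /nonfull_elements /Z_.
by rewrite e.
Qed.

(** A failure of the contraction by theta^l along l steps from the cone of parameter
x: the images admit neither k1 as a lower constant nor k2 as an upper one.  A small
increase of x preserves a failure, so that the set of these x is a Borel set by
[sorgenfrey_meas]; hence the set of the points from which the contraction takes
place is measurable, although it involves all functions f and h. *)
Definition failure l w x := 0 < x /\ exists (f h : R -> R) (l1 l2 k1 k2 : R),
  [/\ [/\ kcone a b x f, 0 < Einf (dom S) f, kcone a b x h, kcone a b x (fun t => h t - l1 * f t)
        & kcone a b x (fun t => l2 * f t - h t)],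
      [/\ 0 < l1, 0 < l2, 0 < k1, 0 < k2 & (1 + theta ^+ l * (l2 / l1 - 1)) * k1 < k2],
      BV (transfer_n S l w f), BV (transfer_n S l w h)
    & ~ kcone a b (aper l w x) (fun t => transfer_n S l w h t - k1 * transfer_n S l w f t) /\
      ~ kcone a b (aper l w x) (fun t => k2 * transfer_n S l w f t - transfer_n S l w h t)].

(** The final aperture is an affine function of the initial one. *)
Lemma not_kcone_open l w x u : BV u -> ~ kcone a b (aper l w x) u ->
  exists2 e, 0 < e & forall y, x <= y < x + e -> ~ kcone a b (aper l w y) u.
Proof.
move=> bu nk; have [P hP] := aper_affine l w.
have gap : aper l w x * Einf (dom S) u < var a b u.
  by rewrite ltNge; apply/negP => h; apply: nk.
set de := var a b u - aper l w x * Einf (dom S) u.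
have de0 : 0 < de by rewrite subr_gt0.
set Q := `|P * Einf (dom S) u|; have Q0 : 0 <= Q by exact: normr_ge0.
have Q1 : 0 < 1 + Q by lra.
exists (de / (1 + Q)); first by rewrite divr_gt0.
move=> y /andP[xy yx] [_]; rewrite (hP x y) leNgt => /negP; apply.
have h1 : (y - x) * (1 + Q) < de by rewrite -ltr_pdivlMr// ltrBlDl.
have h2 : P * Einf (dom S) u <= Q by exact: ler_norm.
have h3 : (y - x) * (P * Einf (dom S) u) <= (y - x) * Q by rewrite ler_wpM2l// subr_ge0.
have yx0 : 0 <= y - x by rewrite subr_ge0.
have -> : (aper l w x + P * (y - x)) * Einf (dom S) u =
  aper l w x * Einf (dom S) u + (y - x) * (P * Einf (dom S) u) by ring.
move: h1; rewrite mulrDr mulr1 /de => h1.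
move: h1 h3; set A := (y - x) * Q; set B := (y - x) * (P * _); set C := aper _ _ _ * _; lra.
Qed.

Lemma failure_meas l w : measurable ([set x | failure l w x] : set (measurableTypeR R)).
Proof.
apply: sorgenfrey_meas => x [x0 [f [h [l1 [l2 [k1 [k2 [[H1 H2 H3 H4 H5] L bf bh [n1 n2]]]]]]]]].
have [e1 e10 h1] := not_kcone_open (BV_sub ab bh (BV_scale ab k1 bf)) n1.
have [e2 e20 h2] := not_kcone_open (BV_sub ab (BV_scale ab k2 bf) bh) n2.
exists (Num.min e1 e2); first by rewrite lt_min e10.
move=> y /andP[xy]; rewrite -ltrBlDl lt_min !ltrBlDl => /andP[y1 y2].
split; first exact: lt_le_trans xy.
have mo := kcone_mono ab x0 xy.
exists f, h, l1, l2, k1, k2; split; [|exact: L|exact: bf|exact: bh|].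
  by split; [exact: mo H1|exact: H2|exact: mo H3|exact: mo H4|exact: mo H5].
by split; [apply: h1|apply: h2]; rewrite xy.
Qed.

Lemma failure_word l w w' x : word l w = word l w' -> failure l w x -> failure l w' x.
Proof. by move=> E; rewrite /failure (word_transfer E) (aper_word E). Qed.

Let theta_itv l : 0 <= theta ^+ l <= 1.
Proof. by have /andP[t0 t1] := t01; rewrite exprn_ge0 ?(ltW t0)//= exprn_ile1// ltW. Qed.

(** [cmp_extremal] turns the absence of failures into a comparison of the images. *)
Lemma not_failure_Contr l w : nice S gamma w -> ~ failure l w (al w) ->
  Contr S gamma w l (theta ^+ l).
Proof.
move=> nw nF f h x kf kh x1 c.
have gw := nice_good nw; have a0 := al_gt0 nw; have a0' := al_gt0 (nice_future hS l nw).
have lin := trn_linear hS l gw; have mp := trn_maps hS g01 l nw.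
have bf := kcone_BV kf; have bh := kcone_BV kh.
have bLf := trn_BV hS l gw bf; have bLh := trn_BV hS l gw bh.
set X := 1 + _; have tl := theta_itv l.
have X1 : 1 <= X by rewrite lerDl mulr_ge0//; [case/andP: tl|rewrite subr_ge0].
have c' := cmp_nonexp lin mp c.
have [k [k0 h1 h2]] := c.
have triv (E : coc a b (fun t => k * f t = 0)) :
    cmp a b (al (future S l w)) (transfer_n S l w f) (transfer_n S l w h) X.
  have [h1' h2'] : kcone a b (al (future S l w)) (transfer_n S l w (fun t => h t - k * f t)) /\
     kcone a b (al (future S l w)) (transfer_n S l w (fun t => x * k * f t - h t)) by split; apply: mp.
  rewrite (linear_opB1 _ _ _ lin) in h1'; rewrite (linear_opB2 _ _ _ lin) in h2'.
  exists k; split=> //; apply: (kcone_coc ab) h2' => //; first by exact: (BV_sub ab (BV_scale ab (X * k) bLf) bLh).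
  have := trn_coc hS l gw E.
  have := lin k 0 f f; under eq_fun do rewrite mul0r addr0.
  move=> ->; have := lin 0 0 f f; under eq_fun do rewrite mul0r addr0.
  move=> ->; apply: coc_sub => t _; rewrite !mul0r !addr0 => e.
  by rewrite -!mulrA e !mulr0.
have := k0; rewrite le_eqVlt => /predU1P[k00|kp].
  by apply: triv; apply: cocW => t _; rewrite -k00 mul0r.
have := Einf_ge0 ab a0 kf; rewrite le_eqVlt => /predU1P[F0|Fp].
  by apply: triv; apply: coc_sub (kcone_zero ab kf (esym F0)) => t _ ->; rewrite mulr0.
apply: (cmp_extremal ab a0' (mp _ kf) _ bLh X1 c'); first exact: (trn_Einf_gt0 hS l gw bf Fp).
move=> k1 k2 k10 k20 k12; apply: contrapT => /not_orP[n1 n2]; apply: nF; split=> //.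
have xk : 0 < x * k by rewrite mulr_gt0//; apply: lt_le_trans x1.
exists f, h, k, (x * k), k1, k2; split; [|split|exact: bLf|exact: bLh|].
- by split; [exact: kf|exact: Fp|exact: kh|exact: h1|exact: h2].
- exact: kp.
- exact: xk.
- exact: k10.
- exact: k20.
- by rewrite mulfK ?gt_eqF.
- by rewrite !aper_al.
Qed.

(** The hypothesis bounds ln (k2 / k1) by theta^l ln (l2 / l1), which is at most
ln (1 + theta^l (l2 / l1 - 1)) because ln is concave. *)
Lemma not_failure w l : nice S gamma w ->
  (forall f h, cone_a S gamma (past S l w) f -> cone_a S gamma (past S (l + 0) w) h ->
        (Theta_ S gamma w (transfer_n S l (past S l w) f)
           (transfer_n S (l + 0) (past S (l + 0) w) h)
         <= (theta ^+ l)%:E * Theta_ S gamma (past S l w) f (transfer_n S 0 (past S (l + 0) w) h))%E) ->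
  ~ failure l (past S l w) (al (past S l w)).
Proof.
move=> nw hT; case=> _ [f [h [l1 [l2 [k1 [k2 [[H1 H2 H3 H4 H5] [l10 l20 k10 k20 k12] bf bh]]]]]]].
have np := nice_past hS l nw.
rewrite aper_al// (future_pastK hS) => -[n1 n2].
have a0 := al_gt0 np; have a0' := al_gt0 nw.
have bF := kcone_BV H1; have bH := kcone_BV H3.
have Eh : 0 < Einf (dom S) h.
  have e4 := Einf_ge0 ab a0 H4.
  have := Einf_add ab (kcone_BV H4) (BV_scale ab l1 bF).
  have -> : (fun t => h t - l1 * f t + l1 * f t) = h by apply/funext => t; rewrite subrK.
  rewrite (Einf_scale ab (ltW l10) bF).
  by apply: lt_le_trans; rewrite ltr_wpDl// mulr_gt0.
have l12 : 1 <= l2 / l1.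
  rewrite ler_pdivlMr// mul1r.
  have := kcone_add ab (ltW a0) H4 H5.
  under eq_fun do rewrite addrC subrKA -mulrBl.
  move=> k; rewrite leNgt; apply/negP => l21.
  have := Einf_ge0 ab a0 k; rewrite leNgt => /negP; apply.
  have bk := kcone_BV k.
  have h0 : coc a b (fun t => (l2 - l1) * f t <= (l2 - l1) * Einf (dom S) f).
    by apply: coc_sub (BV_Einf ab bF) => t' _; rewrite ler_nM2l// subr_lt0.
  by apply: le_lt_trans (Einf_le ab bk h0) _; rewrite nmulr_rlt0// subr_lt0.
have cf : cone_a S gamma (past S l w) f by exact: (kcone_cone ab).
have ch : cone_a S gamma (past S (l + 0) w) h by rewrite addn0; exact: (kcone_cone ab).
have := hT _ _ cf ch; rewrite addn0 /=.
have T1 : (Theta_ S gamma (past S l w) f h <= (ln (l2 / l1))%:E)%E by exact: (Theta_le ab).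
have tl := theta_itv l.
have tl0 : (0 <= (theta ^+ l)%:E)%E by rewrite lee_fin; case/andP: tl.
move=> /le_trans /(_ (lee_wpmul2l tl0 T1)); rewrite -EFinM => T2.
have kLf : kcone a b (al w) (transfer_n S l (past S l w) f).
  by have := trn_maps hS g01 l np H1; rewrite (future_pastK hS).
have := Theta_ge ab a0' kLf bh k10 k20 n1 n2 T2.
have z0 : 0 <= l2 / l1 - 1 by rewrite subr_ge0.
have := ln_concave tl z0; rewrite subrKC => c1 c2.
have p0 : 0 < 1 + theta ^+ l * (l2 / l1 - 1).
  by rewrite ltr_pwDl// mulr_ge0//; case/andP: tl.
have := le_trans c2 c1; rewrite ler_ln ?posrE ?divr_gt0// ler_pdivrMr//.
by rewrite leNgt k12.
Qed.

(** For some N, the set E of the points that end no failing segment of length at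
least N has positive measure.  By [visits], the orbit was in E some
i steps ago, where i is at most p^-1 M + 1.  The segment contracts at the rate
theta up to this visit and does not expand afterwards: the lost factor theta^i is
absorbed by the constant. *)
Lemma contracts_rate : {ae m, forall w, exists l0 : nat, forall l : nat, (l0 <= l)%N ->
    forall f h : R -> R, cone_a S gamma (past S l w) f -> cone_a S gamma (past S (l + 0) w) h ->
        (Theta_ S gamma w (transfer_n S l (past S l w) f)
           (transfer_n S (l + 0) (past S (l + 0) w) h)
         <= (theta ^+ l)%:E * Theta_ S gamma (past S l w) f (transfer_n S 0 (past S (l + 0) w) h))%E} ->
  contracts m S gamma theta.
Proof.
move=> hT; have /andP[t0 t1] := t01.
have [a' ma' aa'] := aperture_meas hS hphi g01.
pose G l := [set w | failure l (past S l w) (a' (past S l w))].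
have mp l : measurable_fun setT (past S l) by exact: (iter_meas l (msV hS)).
have mG l : measurable (G l).
  apply: (@fibred_param _ _ _ _ (word l \o past S l) (a' \o past S l) (fun w => failure l (past S l w))).
  - exact: fibred_comp (mp l) (fibred_word l).
  - exact: measurableT_comp.
  - by move=> w w' x /=; exact: failure_word.
  - by move=> w; exact: failure_meas.
pose E N := ~` \bigcup_(l in [set l | (N <= l)%N]) G l.
have mE N : measurable (E N) by apply/measurableC/bigcup_measurable.
have aa'o := ae_orbit hS aa'; have an := ae_nice hS hphi g01 gc.
have [N N0] : exists N, (0 < m (E N))%E.
  apply: pos_union => //; apply: filterS3 hT an aa'o => w [l0 hl] nw aw.
  exists l0 => -[l /= l0l]; rewrite /G /= past_orb aw -past_orb.
  exact: not_failure nw (hl _ l0l).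
have [M [p [p0 sM vis]]] := visits sK sVK (ms hS) (msV hS) (minv hS) (merg hS) (mE N) N0.
have lt0 : 0 < - ln theta by rewrite oppr_gt0 ln_lt0.
exists (fun w => - ln theta * (p^-1 * M w + (1 + N%:R))); split.
  apply: subexp_scale; first exact: ltW.
  apply: subexp_add; last exact: subexp_cst.
  by apply: subexp_scale => //; rewrite invr_ge0 ltW.
apply: filterS3 an vis aa'o => w nw vw aw.
have M0 : 0 <= M w by case: (vw 0%N).
have pM0 : 0 <= p^-1 * M w by rewrite mulr_ge0// invr_ge0 ltW.
have N0' : 0 <= N%:R :> R by [].
have A0 : 0 <= - ln theta * (p^-1 * M w + (1 + N%:R)) by rewrite mulr_ge0 ?(ltW lt0)//; lra.
split=> // n.
(* Without a visit to E during the last J' steps, the lower bound of the number of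
   visits would be positive for a sum that vanishes. *)
pose J := Num.bound (p^-1 * M w).
have [i [Ei iJ]] : exists i, E N (orb w (- i%:Z)) /\ i%:R <= p^-1 * M w + 1.
  apply: contrapT => no.
  have Jb : p^-1 * M w < J%:R by exact: archi_boundP.
  have [J' [hJ hJ']] : exists J' : nat, p^-1 * M w < J'%:R /\ J'%:R <= p^-1 * M w + 1.
    have ex : exists k : nat, p^-1 * M w < k%:R by exists J.
    exists (ex_minn ex); case: ex_minnP => k hk mk; split=> //.
    case: k hk mk => [|k] hk mk; first by lra.
    rewrite -natr1 lerD2r leNgt; apply/negP => h; have := mk k h; by rewrite ltnn.
  have [_ +] := vw J'; rewrite leNgt => /negP; apply.
  rewrite big1 ?subr_gt0 => [|[k kJ] _ /=].
    by move: hJ; rewrite -(ltr_pM2l p0) mulrA divff ?gt_eqF// mul1r.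
  rewrite indicE; case: (boolP (_ \in _)) => // /set_mem Ek; exfalso; apply: no; exists k; split=> //.
  by apply: le_trans hJ'; rewrite ler_nat ltnW.
have [ni|ni] := leqP (i + N) n; last first.
  have np := nice_past hS n nw; apply: (Contr_mono hS g01 np _ (Contr_nonexp hS g01 n np)).
  rewrite -[theta]lnK ?posrE// -expRM_natr -expRD -[leLHS]expR0 ler_expR expRK.
  have : n%:R <= i%:R + N%:R :> R by rewrite -natrD ler_nat ltnW.
  move=> h; rewrite mulNr addrC -mulrBr nmulr_rge0 ?ln_lt0//; lra.
have ni' : (i <= n)%N by apply: leq_trans ni; rewrite leq_addr.
have Nni : (N <= n - i)%N by rewrite leq_subRL.
set w1 := past S n w.
have np := nice_past hS n nw.
have fE : future S (n - i) w1 = past S i w.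
  exact: future_past.
have wE : past S (n - i) (past S i w) = w1 by rewrite -fE (past_futureK hS).
have C1 : Contr S gamma w1 (n - i) (theta ^+ (n - i)).
  apply: not_failure_Contr np _ => F; apply: Ei; exists (n - i)%N => //.
  by rewrite /G /= -past_orb wE /w1 past_orb aw -past_orb.
have C2 : Contr S gamma (future S (n - i) w1) i 1.
  by rewrite fE; exact: (Contr_nonexp hS g01 i (nice_past hS i nw)).
have := Contr_comp hS g01 np (exprn_ge0 _ (ltW t0)) C1 C2.
rewrite (subnKC ni') mul1r => C; apply: (Contr_mono hS g01 np _ C).
rewrite -[theta]lnK ?posrE// -!expRM_natr -expRD ler_expR expRK natrB//.
have h : 0 <= - ln theta * (p^-1 * M w + (1 + N%:R) - i%:R) by rewrite mulr_ge0 ?(ltW lt0)//; lra.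
lra.
Qed.

End Gamma.
End Rate.

(** * Measures with a density *)

Section Density.
Local Open Scope ereal_scope.
Context {R : realType} {d : measure_display} {T : measurableType d} (nu : {measure set T -> \bar R})
  (k : T -> R).
Hypothesis mk : measurable_fun setT k.

Let kp x : \bar R := (Num.max (k x) 0%R)%:E.

Let kp_ge0 x : 0 <= kp x. Proof. by rewrite lee_fin le_max lexx orbT. Qed.

Let mkp D : measurable_fun D kp.
Proof. by apply: measurable_funTS; apply/measurable_EFinP; exact: measurable_maxr. Qed.

(** The positive part makes this a measure for every measurable k. *)
Definition mdens of measurable_fun setT k := fun A => \int[nu]_(x in A) kp x.
Local Notation dens := (mdens mk).

Let mdens0 : dens set0 = 0. Proof. exact: integral_set0. Qed.
Let mdens_ge0 A : 0 <= dens A. Proof. by apply: integral_ge0 => x _; exact: kp_ge0. Qed.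
Let mdens_sigma : semi_sigma_additive dens.
Proof. by apply: semi_sigma_additive_nng_induced => //; exact: mkp. Qed.

HB.instance Definition _ := isMeasure.Build _ _ _ dens mdens0 mdens_ge0 mdens_sigma.

Import HBNNSimple.

Let mdens_ge0_integral D (f : T -> \bar R) : measurable D -> measurable_fun D f ->
  (forall x, D x -> 0 <= f x) ->
  \int[dens]_(x in D) f x = \int[nu]_(x in D) (f x * kp x).
Proof.
move=> mD mf f0; pose h := nnsfun_approx mD mf.
have lf : \int[dens]_(x in D) f x = limn (fun n => \int[dens]_(x in D) (h n x)%:E).
  rewrite -monotone_convergence//.
  - apply: eq_integral => x /[!inE] Dx; apply/esym/cvg_lim => //.
    exact: cvg_nnsfun_approx.
  - by move=> n; exact/measurable_EFinP/measurable_funP.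
  - by move=> n x _; rewrite lee_fin.
  - by move=> x _ i j ij; rewrite lee_fin; exact/lefP/nd_nnsfun_approx.
have rf : \int[nu]_(x in D) (f x * kp x) = limn (fun n => \int[nu]_(x in D) ((h n x)%:E * kp x)).
  rewrite -monotone_convergence//.
  - apply: eq_integral => x /[!inE] Dx; apply/esym/cvg_lim => //.
    by apply: cvgeZr => //; exact: cvg_nnsfun_approx.
  - move=> n; apply: emeasurable_funM => //; exact/measurable_EFinP/measurable_funP.
  - by move=> n x _; rewrite mule_ge0// lee_fin.
  - by move=> x _ i j ij; rewrite lee_wpmul2r// lee_fin; exact/lefP/nd_nnsfun_approx.
rewrite lf rf; congr (limn _); apply/funext => n.
under [LHS]eq_integral do rewrite fimfunE -fsumEFin//.
rewrite ge0_integral_fsum//; last 2 first.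
- by move=> y; exact/measurable_EFinP/measurable_funM.
- by move=> y x _; rewrite nnfun_muleindic_ge0.
under [RHS]eq_integral => x _.
  rewrite fimfunE -fsumEFin// ge0_mule_fsuml; last by move=> y; exact: nnfun_muleindic_ge0.
  over.
rewrite ge0_integral_fsum//; last 2 first.
- move=> y; apply: emeasurable_funM => //; exact/measurable_EFinP/measurable_funM.
- by move=> y x _; rewrite mule_ge0// nnfun_muleindic_ge0.
apply: eq_fsbigr => y yr.
have y0 : (0 <= y)%R by move: yr; rewrite inE => -[x _ <-].
have mB : measurable (h n @^-1` [set y]) by exact: measurable_sfunP.
rewrite integralZl_indic_nnsfun// integral_indic//.
under [RHS]eq_integral do rewrite EFinM -muleA.
rewrite ge0_integralZl//; last 2 first.
- by apply: emeasurable_funM => //; exact/measurable_EFinP/measurable_indic.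
- by move=> x _; rewrite mule_ge0// lee_fin.
congr (_ * _); rewrite setIC -[LHS]/(\int[nu]_(x in _) kp x) integral_mkcondr; apply: eq_integral => x _.
by rewrite patchE indicE; case: ifP => _; rewrite ?mul1e ?mul0e.
Qed.

Lemma mdens_integral D (f : T -> R) : measurable D -> measurable_fun D f ->
  \int[dens]_(x in D) (f x)%:E = \int[nu]_(x in D) (f x * Num.max (k x) 0)%:E.
Proof.
move=> mD mf; have mf' : measurable_fun D (EFin \o f) by exact/measurable_EFinP.
rewrite [LHS]integralE [RHS]integralE.
rewrite mdens_ge0_integral//; last exact: measurable_funepos.
rewrite mdens_ge0_integral//; last exact: measurable_funeneg.
have k0 x : (0 <= Num.max (k x) 0)%R by rewrite le_max lexx orbT.
congr (_ - _); apply: eq_integral => x _; rewrite ?funeposE ?funenegE /kp -?EFinN /= -EFin_max -EFinM -?EFin_max.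
  by congr EFin; rewrite maxr_pMl// mul0r.
by congr EFin; rewrite maxr_pMl// mul0r mulNr.
Qed.

End Density.

(** * A non-atomic measure on the interval *)

Section OneMeasure.
Context {R : realType} (a b : R).
Hypothesis ab : a < b.
Variable nu : probability (measurableTypeR R) R.
Local Notation I := (Icc a b).
Local Notation BV := (inBV a b).
Local Notation coc := (coc a b).
Hypothesis nu_I : nu I = 1%E.
Hypothesis nu_pt : forall x, nu [set x] = 0%E.
Implicit Types (f h : R -> R).
Local Notation intg f := (nu.-integrable I (EFin \o f)).
Local Notation E f := (\int[nu]_(x in I) f x).

Lemma I_meas : measurable (I : set (measurableTypeR R)). Proof. exact: Icc_meas. Qed.

Lemma countable_null (A : set R) : countable A -> nu.-negligible (A : set (measurableTypeR R)).
Proof.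
move=> /countable_injP[f injf].
rewrite (_ : A = \bigcup_n [set x | A x /\ f x = n]); last first.
  by apply/seteqP; split=> x; [move=> Ax; exists (f x)|move=> [n _ []]].
apply: negligible_bigcup => n.
have [[x [Ax fx]]|no] := pselect (exists x, A x /\ f x = n).
  exists [set x]; split; [exact: measurable_set1|exact: nu_pt|].
  by move=> y [Ay fy] /=; apply: injf; rewrite ?inE// fx fy.
rewrite (_ : [set x | _] = set0); first exact: negligible_set0.
by apply/seteqP; split=> // x Ax; apply: no; exists x.
Qed.

Lemma coc_nu (P : R -> Prop) : coc P -> {ae nu, forall x, I x -> P x}.
Proof.
move=> /countable_null; apply: negligibleS => x nP; apply: contrapT => h; apply: nP => ix.
by apply: contrapT => nP; apply: h.
Qed.

Lemma bnd_int f B : measurable_fun (I : set (measurableTypeR R)) f -> (forall x, I x -> `|f x| <= B) -> intg f.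
Proof.
move=> mf fB.
have IB : nu.-integrable I (fun _ : measurableTypeR R => B%:E).
  by apply: integrableS (finite_measure_integrable_cst _ _ measurableT) => //; exact: I_meas.
apply: (le_integrable I_meas _ _ IB); first exact/measurable_EFinP.
move=> x ix; rewrite /= lee_fin; apply: le_trans (fB _ ix) _; exact: ler_norm.
Qed.

Lemma BV_int f : BV f -> intg f.
Proof.
move=> bf; have [B _ fB] := BV_bnd ab bf; apply: bnd_int fB; exact: (BV_measurable ab bf).
Qed.

Lemma int_mulBV f h : intg f -> BV h -> intg (fun x => f x * h x).
Proof.
move=> If bh; have [B B0 hB] := BV_bnd ab bh.
have mf := measurable_int _ If; have mh := BV_measurable ab bh.
have IB := integrableZl I_meas B If.
apply: (le_integrable I_meas _ _ IB).
  apply/measurable_EFinP; apply: measurable_funM => //; exact/measurable_EFinP.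
move=> x ix /=; rewrite lee_fin !normrM mulrC (ger0_norm (ltW B0)).
by rewrite ler_wpM2r// hB.
Qed.

Lemma intD f g : intg f -> intg g -> intg (fun x => f x + g x).
Proof. exact: (integrableD I_meas). Qed.

Lemma intB f g : intg f -> intg g -> intg (fun x => f x - g x).
Proof. exact: (integrableB I_meas). Qed.

Lemma intZ c f : intg f -> intg (fun x => c * f x).
Proof. exact: (integrableZl I_meas). Qed.

Lemma int_abs f : intg f -> intg (fun x => `|f x|).
Proof. exact: integrable_abse. Qed.

Lemma E_mono f g : intg f -> intg g -> coc (fun x => f x <= g x) -> E f <= E g.
Proof.
move=> If Ig fg; rewrite -subr_ge0 -(RintegralB I_meas Ig If).
have mgf : measurable_fun (I : set (measurableTypeR R)) (fun x => g x - f x).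
  by apply/measurable_EFinP; exact: measurable_int (intB Ig If).
have -> : E (fun x => g x - f x) = E (fun x => Num.max (g x - f x) 0).
  rewrite /Rintegral; congr fine; apply: ae_eq_integral; first exact: I_meas.
  - exact/measurable_EFinP.
  - by apply/measurable_EFinP; exact: measurable_maxr.
  - by apply: (@filterS _ _ (ae_filter_ringOfSetsType _)) (coc_nu fg) => x h ix; rewrite max_l// subr_ge0 h.
by apply: Rintegral_ge0 => x _; rewrite le_max lexx orbT.
Qed.

Lemma E_eq f g : intg f -> intg g -> coc (fun x => f x = g x) -> E f = E g.
Proof.
move=> If Ig fg; apply/eqP; rewrite eq_le !E_mono//; apply: coc_sub fg => x _ ->//.
Qed.

Lemma E_cst c : E (fun=> c) = c.
Proof. by rewrite (Rintegral_cst _ I_meas) [X in fine X](_ : _ = 1%E) ?mulr1//; exact: nu_I. Qed.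

Lemma E_Einf f : BV f -> Einf I f <= E f.
Proof.
move=> bf; rewrite -[leLHS]E_cst; apply: E_mono; [exact/BV_int/BV_cst|exact: BV_int|].
exact: (BV_Einf ab bf).
Qed.

Lemma int_fin f : intg f -> (\int[nu]_(x in I) (f x)%:E)%E = (E f)%:E.
Proof. by move=> If; rewrite fineK//; exact: (integrable_fin_num I_meas If). Qed.

End OneMeasure.

(** * Duality between the transfer operators and the composition with the maps *)

(** The bounded half-open intervals form a generating pi-system. *)
Lemma itv_measure_unique {R : realType} (m1 m2 : {measure set (measurableTypeR R) -> \bar R}) :
  (forall J, is_interval J -> m1 J = m2 J) -> (m1 setT < +oo)%E ->
  forall A, measurable A -> m1 A = m2 A.
Proof.
move=> h fin A mA.
pose g (k : nat) : set (measurableTypeR R) := `](1 *- k), k%:R]%classic.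
apply: (@measure_unique _ R (measurableTypeR R) (@ocitv R) g) mA => //.
- exact: ocitvI.
- by move=> k; exact: is_ocitv.
- exact: bigcup_itvT.
- by move=> _ [x _ <-]; apply: h; exact: interval_is_interval.
- move=> k; apply: le_lt_trans fin; apply: le_measure; rewrite ?inE//.
  exact: measurable_itv.
Qed.

Section Indicators.
Context {R : realType} (a b : R).
Hypothesis ab : a < b.
Local Notation BV := (inBV a b).

Lemma BV_indic_union (Q : set (set R)) : finite_set Q -> (forall Z, Q Z -> is_interval Z) ->
  BV (\1_(\bigcup_(Z in Q) Z)).
Proof.
move=> /finite_seqP[r ->]; elim: r => [_|Z r IH h].
  rewrite (_ : \bigcup_(Z in _) Z = set0); first by rewrite indic0; exact: BV_cst.
  by apply/seteqP; split=> // x [].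
have -> : \bigcup_(Z' in [set` Z :: r]) Z' = Z `|` \bigcup_(Z' in [set` r]) Z'.
  apply/seteqP; split=> x.
    by move=> [Z' /=]; rewrite inE => /predU1P[->|Zr] Zx; [left|right; exists Z'].
  by move=> [Zx|[Z' /= Zr Zx]]; [exists Z => //=; rewrite mem_head|exists Z' => //=; rewrite inE Zr orbT].
set U := \bigcup_(_ in [set` r]) _.
have bZ : BV (\1_Z) by apply: (BV_itv ab); apply: h; rewrite /= mem_head.
have bU : BV (\1_U) by apply: IH => Z' Zr; apply: h; rewrite /= inE; apply/orP; right.
apply: (BV_eq ab) (BV_sub ab (BV_add ab bZ bU) (BV_mul ab bZ bU)) => x _.
rewrite !indicE in_setU; case: (x \in Z); case: (x \in U) => /=; ring.
Qed.

End Indicators.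

Section Duality.
Context {R : realType} {d : measure_display} {Om : measurableType d} (m : probability Om R)
  (S : system R Om).
Hypothesis hS : random_open_map m S.
Local Notation a := (lo S).
Local Notation b := (hi S).
Local Notation I := (dom S).
Local Notation BV := (inBV a b).
Local Notation ab := (rm_ab hS).
Implicit Types (f h : R -> R).

Lemma mono_meas (A : set R) (T : R -> R) : is_interval A -> monotone_continuous_on A T ->
  measurable_fun (A : set (measurableTypeR R)) T.
Proof.
move=> iA [_ mT]; apply: (measurability _ (RGenOInfty.measurableE R)) => _ [_ [x ->] <-].
apply: (@is_interval_measurable R) => u v [Au Tu] [Av Tv] z /andP[uz zv].
have Az : A z by apply: (iA u v) => //; rewrite uz.
split=> //; move: Tu Tv; rewrite /= !in_itv/= !andbT => Tu Tv.
move: uz; rewrite le_eqVlt => /predU1P[<-//|uz]; move: zv; rewrite le_eqVlt => /predU1P[->//|zv].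
by case: mT => mT; [apply: lt_trans Tu _|apply: lt_trans Tv _]; exact: mT.
Qed.

(** The part of I not covered by the monotonicity partition is null and is the
complement of finitely many intervals: it is countable. *)
Lemma map_meas j : measurable_fun (I : set (measurableTypeR R)) (mapT S j).
Proof.
have [fP [iP tP nP]] := rom_partT hS j.
set U := \bigcup_(A in partT S j) A.
have bU : BV (fun x => 1 - \1_U x).
  by apply: (BV_sub ab (BV_cst ab 1)); apply: (BV_indic_union ab) => // A /iP[].
have cF : countable (I `\` U).
  have mU : measurable (U : set (measurableTypeR R)).
    by apply: bigcup_itv_meas => // A /iP[].
  have : coc a b (fun x => 1 - \1_U x = 0 :> R).
    apply: (BV_ae0 ab bU).
    exists (I `\` U); split=> //; first by apply: measurableD => //; exact: Icc_meas.
    move=> x /= h; apply: contrapT => nx; apply: h => ix.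
    rewrite indicE; case: (boolP (x \in U)) => [_|/negP nU]; first by rewrite subrr.
    by exfalso; apply: nx; split=> // Ux; apply: nU; exact/mem_set.
  apply: sub_countable; apply: subset_card_le => x [ix nU]; split=> //.
  by rewrite indicE memNset// subr0 => /eqP; rewrite oner_eq0.
move=> mI Y mY.
have -> : I `&` mapT S j @^-1` Y =
    (\bigcup_(A in partT S j) (A `&` mapT S j @^-1` Y)) `|` ((I `\` U) `&` mapT S j @^-1` Y).
  apply/seteqP; split=> x.
    move=> [ix Yx]; have [[A PA Ax]|nU] := pselect (U x); first by left; exists A.
    by right; split.
  by move=> [[A PA [Ax Yx]]|[[ix _] Yx]]; split=> //; have [_ _] := iP _ PA; exact.
apply: measurableU.
  apply: fin_bigcup_measurable => // A PA; have [iA _ _] := iP _ PA.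
  by apply: (mono_meas iA (rom_mono hS PA)) => //; exact: (@is_interval_measurable R).
apply: countable_measurable; first by move=> x; exact: measurable_set1.
by apply: sub_countable cF; apply: subset_card_le => x [].
Qed.

Section OneStep.
Variables (w : Om) (P Q : probability (measurableTypeR R) R) (lam : R).
Hypothesis gw : goodw S w.
Hypothesis P_I : P I = 1%E.
Hypothesis lam0 : 0 < lam.
Local Notation T := (T_ S w).
Local Notation L := (transfer S w).
Local Notation EP f := (\int[P]_(x in I) f x).
Local Notation EQ f := (\int[Q]_(x in I) f x).
Local Notation intP f := (P.-integrable I (EFin \o f)).
Local Notation intQ f := (Q.-integrable I (EFin \o f)).
Hypothesis dual : forall f, BV f -> EQ (L f) = lam * EP f.

Let X := pieces S (label S w).
Let bd : branch_data a b T (g_ S w) (Z_ S w) X := bd_label hS gw.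
Let mI := I_meas a b.
Let mX : measurable (X : set (measurableTypeR R)) := bd_mX bd.

(** On each branch, T x = y identifies the indicator of T^-1 J at x with the indicator
of J at y.  T^-1 J is an interval on each element of the partition, so its
indicator has bounded variation. *)
Lemma transfer_indic (J : set R) h : is_interval J -> BV h ->
  BV (fun x => \1_(X `&` T @^-1` J) x * h x) /\
  L (fun x => \1_(X `&` T @^-1` J) x * h x) = (fun y => \1_J y * L h y).
Proof.
move=> iJ bh; split.
  apply: (BV_mul ab) => //.
  rewrite (_ : _ `&` _ = \bigcup_(Z in (fun Z => Z `&` T @^-1` J) @` Z_ S w) Z).
    apply: (BV_indic_union ab); first exact/finite_image/(bd_fin bd).
    move=> _ [Z QZ <-] u v [Zu Ju] [Zv Jv] z /andP[uz zv].
    have [iZ _ _] := bd_itv bd QZ; have Zz : Z z by apply: (iZ u v) => //; rewrite uz.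
    split=> //; rewrite /=; move: Ju Jv => /= Ju Jv.
    move: uz; rewrite le_eqVlt => /predU1P[<-//|uz]; move: zv; rewrite le_eqVlt => /predU1P[->//|zv].
    have [_ mono] := bd_mono bd QZ.
    case: mono => mono; have h1 := mono _ _ Zu Zz uz; have h2 := mono _ _ Zz Zv zv.
      by apply: (iJ (T u) (T v)) => //; rewrite !ltW.
    by apply: (iJ (T v) (T u)) => //; rewrite !ltW.
  apply/seteqP; split=> x.
    by move=> [[Z QZ Zx] Jx]; exists (Z `&` T @^-1` J) => //; exists Z.
  by move=> [_ [Z QZ <-] [Zx Jx]]; split=> //; exists Z.
apply/funext => y; rewrite !transferE /Lop fsbig_finite//=; last exact: bd_fin bd.
rewrite [in RHS]fsbig_finite//=; last exact: bd_fin bd.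
rewrite mulr_sumr; apply: eq_big_seq => Z; rewrite in_fset_set; last exact: bd_fin bd.
move=> /set_mem QZ.
have [[x Zx <-]|nT] := pselect ((T @` Z) y); last by rewrite !branch_out// mulr0.
rewrite !(branch_in bd _ QZ Zx) /= mulrA; congr (_ * _ * _).
rewrite !indicE; congr (nat_of_bool _)%:R; apply/idP/idP => /set_mem.
  by move=> [_ Jx]; exact/mem_set.
by move=> Jx; apply/mem_set; split=> //; exists Z.
Qed.

(** The transfer operator ignores the complement of X, so the functions 1 and 1_X have
the same image, and therefore the same integral by duality. *)
Lemma pieces_full : {ae P, forall x, I x -> X x}.
Proof.
have i1 : intP (cst 1) by apply: (BV_int ab); exact: (BV_cst ab).
have [b1 E1] := transfer_indic (J:=setT) (h:=cst 1) (fun _ _ _ _ _ _ => Logic.I) (BV_cst ab 1).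
have := dual b1; rewrite E1.
under eq_Rintegral do rewrite indicT mul1r.
rewrite (dual (BV_cst ab 1)) => /(mulfI _) -/(_ _); rewrite gt_eqF// => /(_ isT).
rewrite (E_cst P_I) => e.
have mIX : measurable (I `&` X : set (measurableTypeR R)) by exact: measurableI.
have PX : P (I `&` X) = 1%E.
  have -> : P (I `&` X) = (\int[P]_(x in I) (\1_X x)%:E)%E by rewrite integral_indic// setIC.
  rewrite (int_fin (f:=\1_X)); first by congr EFin; rewrite e; apply: eq_Rintegral => x _; rewrite preimage_setT setIT mulr1.
  by move: (BV_int ab P b1); apply: eq_integrable => // x _; rewrite /= preimage_setT setIT mulr1.
exists (I `\` X); split; first exact: measurableD.
  have PIoo : (P I < +oo)%E by rewrite [X in (X < _)%E](_ : _ = 1%E) ?ltry//; exact: P_I.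
  have E2 := measureD mI mX PIoo; rewrite [LHS]E2 [X in (X - _)%E](_ : _ = 1%E); last exact: P_I.
  by rewrite [X in (_ - X)%E](_ : _ = 1%E) ?subee//; exact: PX.
by move=> x /not_implyP[ix nx]; split.
Qed.

Let kP h x : R := ((fun x => lam * h x) \_ X) x.
Let kQ h y : R := (L h \_ I) y.

Let mkP h : BV h -> measurable_fun setT (kP h : measurableTypeR R -> R).
Proof.
move=> bh; apply/(measurable_restrictT _ mX); apply: measurable_funM => //.
by apply: measurable_funS mI _ (BV_measurable ab bh); exact: bd_X bd.
Qed.

Let mkQ h : BV h -> measurable_fun setT (kQ h : measurableTypeR R -> R).
Proof.
by move=> bh; apply/(measurable_restrictT _ mI); exact: (BV_measurable ab (tr_BV hS gw bh)).
Qed.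

Let T' : measurableTypeR R -> measurableTypeR R := T \_ X.
Let mT' : measurable_fun setT T'.
Proof.
apply/(measurable_restrictT _ mX).
by apply: measurable_funS mI _ (map_meas _); exact: bd_X bd.
Qed.

Let Lh_ge0 h y : (forall x, I x -> 0 <= h x) -> 0 <= L h y.
Proof.
move=> h0; rewrite transferE /Lop fsbig_finite//=; last exact: bd_fin bd.
rewrite big_seq_cond; apply: sumr_ge0 => Z; rewrite andbT in_fset_set; last exact: bd_fin bd.
move=> /set_mem QZ; have [[x Zx <-]|nT] := pselect ((T @` Z) y); last by rewrite branch_out.
rewrite (branch_in bd _ QZ Zx) /= mulr_ge0//; first exact/h0/(bd_sub bd QZ Zx).
by apply/ltW/(bd_pos bd)/(bd_sub bd QZ Zx).
Qed.

(* The image by the map of the measure of density lam h, and the measure of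
density L h, agree on intervals. *)
Let dual_ge0 f h : measurable_fun (I : set (measurableTypeR R)) f -> (forall x, I x -> 0 <= f x) ->
  BV h -> (forall x, I x -> 0 <= h x) ->
  (\int[P]_(x in I) (f (T x) * h x * lam)%:E = \int[Q]_(y in I) (f y * L h y)%:E)%E.
Proof.
move=> mf f0 bh h0.
have subX x : X x -> I x by exact: (bd_X bd).
have kP0 x : Num.max (kP h x) 0 = kP h x.
  rewrite max_l// /kP patchE; case: ifP => // /set_mem/subX ix.
  by rewrite mulr_ge0 ?h0// ltW.
have kQ0 x : Num.max (kQ h x) 0 = kQ h x.
  by rewrite max_l// /kQ patchE; case: ifP => // _; exact: Lh_ge0.
pose M1 : {measure set (measurableTypeR R) -> \bar R} := pushforward (mdens P (mkP bh)) T'.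
pose M2 : {measure set (measurableTypeR R) -> \bar R} := mdens Q (mkQ bh).
have M1E A : M1 mT' A = (\int[P]_(x in I) (lam * (\1_(X `&` T @^-1` A) x * h x))%:E)%E.
  change (M1 mT' A) with (\int[P]_(x in T' @^-1` A) (Num.max (kP h x) 0)%:E)%E.
  rewrite integral_mkcond [RHS]integral_mkcond; apply: eq_integral => x _.
  rewrite !patchE kP0 /kP /T' patchE indicE.
  have [xX|xX] := boolP (x \in X); last first.
    rewrite [x \in _ `&` _]memNset ?mul0r ?mulr0; last by move=> [/mem_set]; rewrite (negbTE xX).
    by do 2 case: ifP => //.
  rewrite [x \in I]mem_set; last exact/subX/set_mem.
  have -> : (x \in X `&` T @^-1` A) = (x \in T' @^-1` A).
    apply/idP/idP => /set_mem => [[_ Ax]|Ax]; apply/mem_set; first by rewrite /= /T' patchE xX.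
    by split; [exact/set_mem|move: Ax; rewrite /= /T' patchE xX].
  by case: ifP; rewrite ?mul1r ?mul0r ?mulr0.
have M2E A : M2 A = (\int[Q]_(x in I) (\1_A x * L h x)%:E)%E.
  change (M2 A) with (\int[Q]_(x in A) (Num.max (kQ h x) 0)%:E)%E.
  rewrite integral_mkcond [RHS]integral_mkcond; apply: eq_integral => x _.
  rewrite !patchE kQ0 /kQ patchE indicE.
  by do 2 case: ifP => //; rewrite ?mul1r ?mul0r.
have M1J J : is_interval J -> M1 mT' J = M2 J.
  move=> iJ; have [bk Lk] := transfer_indic iJ bh; have ik := BV_int ab P bk.
  rewrite M1E M2E (int_fin (intZ lam ik)) (RintegralZl lam mI ik) -dual// Lk int_fin//.
  by rewrite -Lk; apply: (BV_int ab); exact: (tr_BV hS gw bk).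
have M12 A : measurable A -> M1 mT' A = M2 A.
  apply: itv_measure_unique => //.
  have [bk _] := transfer_indic (J:=setT) (fun _ _ _ _ _ _ => Logic.I) bh.
  by rewrite M1E (int_fin (intZ lam (BV_int ab P bk))) ltry.
pose f' : measurableTypeR R -> R := f \_ I.
have mf' : measurable_fun setT f' by apply/(measurable_restrictT _ mI).
have f'0 x : 0 <= f' x by rewrite /f' patchE; case: ifP => // /set_mem/f0.
have -> : (\int[Q]_(y in I) (f y * L h y)%:E = \int[M2]_y (f' y)%:E)%E.
  rewrite [RHS]mdens_integral// [LHS]integral_mkcond; apply: eq_integral => x _.
  by rewrite kQ0 /kQ /f' !patchE; case: ifP; rewrite ?mul0r.
rewrite -(eq_measure_integral (m1 := M1 mT') M2); last by move=> A mA _; exact: M12.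
rewrite ge0_integral_pushforward//; last 2 first.
- by apply/measurable_EFinP.
- by move=> y _; rewrite lee_fin.
rewrite preimage_setT mdens_integral//; last by apply: measurableT_comp.
rewrite [LHS]integral_mkcond; apply: ae_eq_integral => //.
- apply/(measurable_restrictT _ mI)/measurable_EFinP; apply: measurable_funM => //.
  apply: measurable_funM; last exact: (BV_measurable ab bh).
  by apply: (measurable_comp mI _ mf (map_meas _)) => _ [x ix <-]; exact: (rom_map hS _ ix).
- apply/measurable_EFinP; apply: measurable_funM; first exact: measurableT_comp.
  by apply: measurable_maxr => //; exact: mkP.
apply: (@filterS _ _ (ae_filter_ringOfSetsType _)) pieces_full => x IX _.
rewrite kP0 /kP /T' /f' /= !patchE.
have [/set_mem ix|nx] := boolP (x \in I).
  rewrite [x \in X]mem_set; last exact: IX.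
  by rewrite mem_set; [rewrite -mulrA [lam * _]mulrC|exact: (rom_map hS _ ix)].
by rewrite [x \in X]memNset ?mulr0// => /subX/mem_set; rewrite (negbTE nx).
Qed.

Let funpos f (x : R) := Num.max (f x) 0.
Let funneg f (x : R) := Num.max (- f x) 0.

(** The duality for f = 1 extends to indicators of intervals by [transfer_indic],
hence to nonnegative functions by uniqueness of measures; then split f and h into
positive and negative parts. *)
Lemma dual_step f h : intQ f -> BV h ->
  intP (fun x => f (T x) * h x) /\ lam * EP (fun x => f (T x) * h x) = EQ (fun y => f y * L h y).
Proof.
move=> If.
have mf : measurable_fun (I : set (measurableTypeR R)) f by apply/measurable_EFinP; exact: measurable_int If.
have mfT : measurable_fun (I : set (measurableTypeR R)) (f \o T).
  by apply: (measurable_comp mI _ mf (map_meas _)) => _ [x ix <-]; exact: (rom_map hS _ ix).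
have pos (u : R -> R) : intQ u -> (forall x, 0 <= u x) -> measurable_fun (I : set (measurableTypeR R)) u ->
    forall h, BV h -> (forall x, I x -> 0 <= h x) ->
    intP (fun x => u (T x) * h x) /\ lam * EP (fun x => u (T x) * h x) = EQ (fun y => u y * L h y).
  move=> Iu u0 mu h' bh h0.
  have muT : measurable_fun (I : set (measurableTypeR R)) (u \o T).
    by apply: (measurable_comp mI _ mu (map_meas _)) => _ [x ix <-]; exact: (rom_map hS _ ix).
  have IQ := int_mulBV ab Iu (tr_BV hS gw bh).
  have e := dual_ge0 mu (fun x _ => u0 x) bh h0.
  have I1 : intP (fun x => u (T x) * h' x * lam).
    apply/integrableP; split.
      apply/measurable_EFinP; apply: measurable_funM => //.
      by apply: measurable_funM => //; exact: (BV_measurable ab bh).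
    under eq_integral => x /set_mem ix.
      rewrite /= ger0_norm; last by rewrite !mulr_ge0// ?h0// ltW.
      over.
    by rewrite e int_fin// ltry.
  have I2 : intP (fun x => u (T x) * h' x).
    apply: eq_integrable (intZ lam^-1 I1) => // x _ /=.
    by rewrite mulrC mulfK// gt_eqF.
  split=> //; rewrite mulrC -(RintegralZr lam mI I2).
  by move: e; rewrite (int_fin I1) (int_fin IQ) => -[].
have gen h' : BV h' -> (forall x, I x -> 0 <= h' x) ->
    intP (fun x => f (T x) * h' x) /\ lam * EP (fun x => f (T x) * h' x) = EQ (fun y => f y * L h' y).
  move=> bh h0.
  have mp : measurable_fun (I : set (measurableTypeR R)) (funpos f) by exact: measurable_maxr.
  have mn : measurable_fun (I : set (measurableTypeR R)) (funneg f).
    by apply: measurable_maxr => //; exact: measurableT_comp.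
  have bnd (u : R -> R) : measurable_fun (I : set (measurableTypeR R)) u -> (forall x, `|u x| <= `|f x|) -> intQ u.
    move=> mu uf; apply: (le_integrable mI _ _ If); first exact/measurable_EFinP.
    by move=> x _; rewrite /= lee_fin.
  have Ip : intQ (funpos f).
    apply: bnd => // x; rewrite /funpos; by case: (leP (f x) 0) => // _; rewrite normr0.
  have In : intQ (funneg f).
    apply: bnd => // x; rewrite /funneg; by case: (leP (- f x) 0) => // _; rewrite ?normr0 ?normrN.
  have [P1 P2] := pos _ Ip (fun x => ltac:(by rewrite /funpos le_max lexx orbT)) mp _ bh h0.
  have [N1 N2] := pos _ In (fun x => ltac:(by rewrite /funneg le_max lexx orbT)) mn _ bh h0.
  have fE x : f x = funpos f x - funneg f x.
    rewrite /funpos /funneg; case: (leP (f x) 0) => fx; first by rewrite max_l ?oppr_ge0// sub0r opprK.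
    by rewrite max_r ?oppr_le0 ?(ltW fx)// subr0.
  have bL := tr_BV hS gw bh.
  split.
    by apply: eq_integrable (intB P1 N1) => // x _ /=; rewrite [in RHS]fE mulrBl.
  transitivity (lam * (EP (fun x => funpos f (T x) * h' x) - EP (fun x => funneg f (T x) * h' x))).
    by congr (_ * _); rewrite -RintegralB//; apply: eq_Rintegral => x _; rewrite fE mulrBl.
  rewrite mulrBr P2 N2 -(RintegralB mI (int_mulBV ab Ip bL) (int_mulBV ab In bL)).
  by apply: eq_Rintegral => x _; rewrite [in RHS]fE mulrBl.
move=> bh; have [B B0 hB] := BV_bnd ab bh.
have bB := BV_cst ab B; have bhB := BV_add ab bh bB.
have [I1 E1] := gen _ bhB (fun x ix => ltac:(have := hB _ ix; rewrite ler_norml => /andP[]; lra)).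
have [I2 E2] := gen _ bB (fun _ _ => ltW B0).
have lin : L h = (fun y => L (fun x => h x + B) y - L (fun=> B) y).
  have := linear_opB1 1 (fun x => h x + B) (fun=> B) (tr_linear hS gw).
  under eq_fun do rewrite mul1r addrK.
  by move=> ->; apply/funext => y; rewrite mul1r.
split; first by apply: eq_integrable (intB I1 I2) => // x _ /=; rewrite -mulrBr addrK.
transitivity (lam * (EP (fun x => f (T x) * (h x + B)) - EP (fun x => f (T x) * B))).
  by congr (_ * _); rewrite -RintegralB//; apply: eq_Rintegral => x _; rewrite -mulrBr addrK.
rewrite mulrBr E1 E2 -(RintegralB mI).
- by apply: eq_Rintegral => x _; rewrite [in RHS]lin mulrBr.
- exact: (int_mulBV ab If (tr_BV hS gw bhB)).
- exact: (int_mulBV ab If (tr_BV hS gw bB)).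
Qed.

End OneStep.
End Duality.

(** * Equivariant densities and decay of correlations *)

Section Correlations.
Context {R : realType} {d : measure_display} {Om : measurableType d} (m : probability Om R)
  (S : system R Om).
Hypothesis hS : random_open_map m S.
Hypothesis hphi : strongly_contracting m S.
Variables (q : Om -> R -> R) (nu : Om -> probability (measurableTypeR R) R).
Hypothesis hq : equivariant_density m S q.
Hypothesis hnu : conformal_measure m S nu.
Implicit Types (w : Om) (n : nat) (f h : R -> R).
Local Notation a := (lo S).
Local Notation b := (hi S).
Local Notation I := (dom S).
Local Notation s := (sigma S).
Local Notation sV := (sigmaV S).
Local Notation orb := (orb s sV).
Local Notation BV := (inBV a b).
Local Notation ab := (rm_ab hS).
Local Notation coc := (coc a b).
Local Notation sK := (sK hS).
Local Notation sVK := (sVK hS).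
Local Notation mI := (I_meas a b).
Local Notation E w f := (\int[nu w]_(x in I) f x).
Local Notation intg w f := ((nu w).-integrable I (EFin \o f)).

Definition conf w := [/\ nu w I = 1%E, forall x, nu w [set x] = 0%E,
  forall f, BV f -> E (s w) (transfer S w f) = lam_plus S nu w * E w f & goodw S w].

Definition conf_orbit w := forall k, conf (orb w k).

Lemma ae_conf : {ae m, forall w, conf_orbit w}.
Proof.
have A : {ae m, forall w, conf w}.
  by apply: filterS2 hnu (ae_good hphi) => w [h1 h2 _ h3] gw; split.
exact: (ae_orbit hS A).
Qed.

Lemma conf_at w : conf_orbit w -> conf w. Proof. by move=> /(_ 0). Qed.
Lemma conf_future n w : conf_orbit w -> conf_orbit (future S n w).
Proof. by move=> h k; rewrite future_orb (orbD sK sVK). Qed.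
Lemma conf_good w : conf_orbit w -> good_orbit S w. Proof. by move=> h k; case: (h k). Qed.

Lemma E_Einf_ge w f : conf w -> BV f -> Einf I f <= E w f.
Proof. by move=> [h1 h2 _ _] bf; exact: (E_Einf ab h1 h2 bf). Qed.

Lemma lam_plus_gt0 w : conf_orbit w -> 0 < lam_plus S nu w.
Proof.
move=> cw; have [h1 h2 h3 gw] := conf_at cw; have c1 := conf_at (conf_future 1 cw).
have b1 : BV (transfer S w (cst 1)) by apply: (tr_BV hS gw); exact: BV_cst ab 1.
apply: lt_le_trans (E_Einf_ge c1 b1).
have := tr_Einf hS gw (BV_cst ab 1) (cocW (fun _ _ => ler01)).
by rewrite (Einf_cst ab) mulr1; apply: lt_le_trans; exact: Einf_g_gt0.
Qed.

Definition lam_n n w := \prod_(i < n) lam_plus S nu (future S i w).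

Lemma lam_n_gt0 n w : conf_orbit w -> 0 < lam_n n w.
Proof. by move=> cw; apply: prodr_gt0 => i _; exact/lam_plus_gt0/conf_future. Qed.

Lemma dual_n n w f h : conf_orbit w -> intg (future S n w) f -> BV h ->
  intg w (fun x => f (Tn S n w x) * h x) /\
  lam_n n w * E w (fun x => f (Tn S n w x) * h x) = E (future S n w) (fun x => f x * transfer_n S n w h x).
Proof.
move=> cw; have gw := conf_good cw; elim: n f => [|n IH] f If bh.
  rewrite /lam_n big_ord0 mul1r; split=> //; have [h1 h2 _ _] := conf_at cw.
  exact: (int_mulBV ab If bh).
have cn := conf_future n cw; have [p1 p2 p3 gn] := conf_at cn.
have st h' (bh' : BV h') := dual_step hS gn p1 (lam_plus_gt0 cn) p3 If bh'.
have bn := trn_BV hS n gw bh.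
have [J1 _] := st _ (BV_cst ab 1); have mI' := mI.
have {}J1 : intg (future S n w) (f \o T_ S (future S n w)).
  by apply: eq_integrable J1 => // x _ /=; rewrite mulr1.
have [K1 K2] := IH _ J1 bh; have [_ L2] := st _ bn; split; first exact: K1.
have -> : lam_n n.+1 w = lam_n n w * lam_plus S nu (future S n w) by rewrite /lam_n big_ord_recr.
by rewrite mulrAC -[RHS]L2 mulrC; congr (_ * _); exact: K2.
Qed.

Section Gamma.
Variable gamma : R.
Hypothesis g01 : 0 < gamma < 1.
Hypothesis gc : \int[m]_w lnc S w < ln gamma.
Local Notation al := (a_ S gamma).
Let g0 : 0 < gamma. Proof. by case/andP: g01. Qed.

Definition dens w := [/\ kcone a b (gamma * al w) (q w), Einf I (q w) = 1 &
  coc (fun x => transfer S w (q w) x = lam_minus S q w * q (s w) x)].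

(** The functions whose limit is q lie, after one step or more, in the cone of
parameter gamma a.  Their infima are 1, and the variation is lower semicontinuous. *)
Lemma dens_limit w : nice S gamma w -> BV (q w) ->
  norm_oo a b (fun x => transfer_n S n (past S n w) (cst 1) x
            / Einf I (transfer_n S n (past S n w) (cst 1)) - q w x) @[n --> \oo] --> 0 ->
  kcone a b (gamma * al w) (q w) /\ Einf I (q w) = 1.
Proof.
move=> nw bq cvg.
pose u n x := transfer_n S n (past S n w) (cst 1) x / Einf I (transfer_n S n (past S n w) (cst 1)).
have b1 := BV_cst ab 1.
have np n := nice_past hS n nw.
have e0 n : 0 < Einf I (transfer_n S n (past S n w) (cst 1)).
  by apply: (trn_Einf_gt0 hS n (nice_good (np n)) b1); rewrite (Einf_cst ab).
have bu n : BV (u n).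
  have := BV_scale ab (Einf I (transfer_n S n (past S n w) (cst 1)))^-1 (trn_BV hS n (nice_good (np n)) b1).
  by apply: (BV_eq ab) => x _; rewrite mulrC.
have Eu n : Einf I (u n) = 1.
  rewrite (_ : u n = fun x => (Einf I (transfer_n S n (past S n w) (cst 1)))^-1 *
     transfer_n S n (past S n w) (cst 1) x); last by apply/funext => x; rewrite mulrC.
  rewrite (Einf_scale ab) ?invr_ge0 ?(ltW (e0 n))//; last exact: (trn_BV hS n (nice_good (np n)) b1).
  by rewrite mulVf// gt_eqF.
set ep := fun n => norm_oo a b (fun x => u n x - q w x).
have {}cvg : ep @ \oo --> 0 by exact: cvg.
have hu n : coc (fun x => `|u n x - q w x| <= ep n) by exact: (BV_norm_oo ab (BV_sub ab (bu n) bq)).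
have small e : 0 < e -> exists n, ep n <= e.
  move=> ep0; move/cvgrPdist_le : cvg => /(_ _ ep0)[N _ h]; exists N.
  by have := h N (leqnn N); rewrite sub0r normrN; apply: le_trans; exact: ler_norm.
have Eq : Einf I (q w) = 1.
  have h1 n : Einf I (q w) <= 1 + ep n.
    rewrite -lerBlDr -(Eu n); apply: (le_Einf ab (bu n)).
    apply: coc2 (hu n) (BV_Einf ab bq) _ => x _; rewrite ler_norml => /andP[]; lra.
  have h2 n : 1 - ep n <= Einf I (q w).
    apply: (le_Einf ab bq); apply: coc2 (hu n) (BV_Einf ab (bu n)) _ => x _.
    rewrite ler_norml Eu => /andP[]; lra.
  apply/eqP; rewrite eq_le; apply/andP; split; apply/ler_addgt0Pr => e ep0; have [n hn] := small _ ep0.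
    by apply: le_trans (h1 n) _; rewrite lerD2l.
  by have := h2 n; lra.
split=> //; split=> //; rewrite Eq mulr1.
apply: (@var_lim _ _ _ ab (fun n => u n.+1)) => // [n|].
  have nV := nice_past hS 1 nw.
  have k1 : kcone a b (al (past S n (past S 1 w))) (cst 1).
    split; first exact: b1.
    rewrite [var _ _ _](var_cst ab 1) [Einf _ _](Einf_cst ab 1) mulr1.
    by apply/ltW/(al_gt0 (gamma:=gamma))/(nice_past hS).
  have := tr_maps hS g01 nV.
  have := trn_maps hS g01 n (nice_past hS n nV) k1; rewrite (future_pastK hS) => k2 /(_ _ k2) k3.
  have pE : past S n.+1 w = past S n (past S 1 w) by rewrite /past iterSr.
  have E1 : transfer S (past S 1 w) (transfer_n S n (past S n (past S 1 w)) (cst 1)) =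
     transfer_n S n.+1 (past S n.+1 w) (cst 1).
    by rewrite pE /= (future_pastK hS).
  rewrite E1 in k3.
  have k4 := kcone_scale ab (ltW (e0 n.+1)) k3.
  have i0 : 0 <= (Einf I (transfer_n S n.+1 (past S n.+1 w) (cst 1)))^-1 by rewrite invr_ge0 ltW.
  have [_] := kcone_scale ab i0 k3.
  rewrite (_ : (fun x => _ * _) = u n.+1); last by apply/funext => x; rewrite mulrC.
  by rewrite [X in _ * X](Eu n.+1) mulr1 /past /= sVK.
have := coc_all hu; apply: coc_sub => x _ h.
have : u n x @[n --> \oo] --> q w x.
  apply/cvgrPdist_le => e ep0; near=> n.
  rewrite distrC; apply: le_trans (h n) _; apply: le_trans (ler_norm _) _.
  by rewrite -[ep n]subr0; near: n; move/cvgrPdist_le : cvg => /(_ _ ep0); apply: filterS => k; rewrite distrC.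
by rewrite (cvg_shiftS (u ^~ x)).
Unshelve. all: by end_near. Qed.

Definition dens_orbit w := forall k, dens (orb w k).

Lemma ae_dens : {ae m, forall w, dens_orbit w}.
Proof.
suff A : {ae m, forall w, dens w} by exact: (ae_orbit hS A).
have n1 := ae_nice hS hphi g01 gc; have q1 := ae_orbit hS hq.
apply: filterS2 n1 q1 => w nw qw.
have [b0 c0 e0] := qw 0; have [b1 _ _] := qw 1.
have [h1 h2] := dens_limit nw b0 c0; split=> //.
have gw := good_orbit_good (nice_good nw).
by apply: (BV_ae_eq ab) e0; [exact: (tr_BV hS gw b0)|exact: (BV_scale ab _ b1)].
Qed.

Lemma dens_future n w : dens_orbit w -> dens_orbit (future S n w).
Proof. by move=> h k; rewrite future_orb (orbD sK sVK). Qed.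
Lemma dens_at w : dens_orbit w -> dens w. Proof. by move=> /(_ 0). Qed.

Lemma q_BV w : dens w -> BV (q w). Proof. by move=> [/kcone_BV]. Qed.

Definition regular w := [/\ nice S gamma w, conf_orbit w & dens_orbit w].

Lemma ae_regular : {ae m, forall w, regular w}.
Proof.
by apply: filterS3 (ae_nice hS hphi g01 gc) ae_conf ae_dens => w h1 h2 h3; split.
Qed.

Lemma regular_future n w : regular w -> regular (future S n w).
Proof. by move=> [h1 h2 h3]; split; [exact: (nice_future hS)|exact: conf_future|exact: dens_future]. Qed.
Lemma q_bnd w : nice S gamma w -> dens w -> coc (fun x => 1 <= q w x <= 1 + al w).
Proof.
move=> nw [kq Eq _]; apply: coc_sub (kcone_bnd ab kq) => x _.
rewrite [Einf _ _]Eq mulr1 => /andP[-> /le_trans]; apply; rewrite lerD2l ger_pMl; last exact: al_gt0.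
by case/andP: g01 => _ /ltW.
Qed.

Lemma q_iter n w : regular w -> exists2 M, 0 < M &
  coc (fun x => transfer_n S n w (q w) x = M * q (future S n w) x).
Proof.
move=> [nw cw dw]; have bq := q_BV (dens_at dw).
have gw := nice_good nw.
have [M hM] : exists M, coc (fun x => transfer_n S n w (q w) x = M * q (future S n w) x).
  elim: n => [|n [M IH]]; first by exists 1; apply: cocW => x _; rewrite mul1r.
  exists (M * lam_minus S q (future S n w)).
  have gn := good_orbit_good (good_orbit_future hS n gw).
  have [_ _ h] := dens_at (dens_future n dw).
  apply: coc2 (tr_coc hS gn IH) h _ => x _ /= -> hx.
  have := tr_linear hS gn M 0 (q (future S n w)) (fun=> 0).
  under eq_fun do rewrite mul0r addr0.
  by move=> ->; rewrite mul0r addr0 hx mulrA.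
exists M => //; have [kn En _] := dens_at (dens_future n dw).
have bn := trn_BV hS n gw bq.
have e : 0 < Einf I (transfer_n S n w (q w)).
  by apply: (trn_Einf_gt0 hS n gw bq); have [_ -> _] := dens_at dw.
have M0 : 0 <= M.
  rewrite leNgt; apply/negP => Mn; have := e; rewrite ltNge => /negP; apply.
  apply: (Einf_le ab bn).
  apply: coc2 hM (q_bnd (nice_future hS n nw) (dens_at (dens_future n dw))) _ => x _ -> /andP[q1 _].
  by rewrite nmulr_rle0// (le_trans _ q1).
have := e.
rewrite (Einf_eq ab bn (BV_scale ab M (kcone_BV kn)) hM) (Einf_scale ab M0 (kcone_BV kn)).
by rewrite [Einf _ _]En mulr1.
Qed.

Lemma E_q_ge1 w : regular w -> 1 <= E w (q w).
Proof.
move=> [_ cw dw]; have [k e _] := dens_at dw; rewrite -[leLHS]e.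
by apply: E_Einf_ge; [exact: conf_at|exact: kcone_BV k].
Qed.

(** For the measures of density q / nu(q), the correlation of f o T^n and h / q. *)
Definition corr n w f h := E w (fun x => f (Tn S n w x) * h x) / E w (q w) -
  (E (future S n w) (fun x => f x * q (future S n w) x) / E (future S n w) (q (future S n w))) *
  (E w h / E w (q w)).

(** If h is at projective distance at most ln x0 from the density, then after n
contracting steps its image is almost proportional to the density.  The part
proportional to the density cancels in the correlation. *)
Lemma corr_cone n w k x0 sh f h : regular w -> 0 <= k -> Contr S gamma w n k -> 1 <= x0 ->
  kcone a b (al w) h -> cmp a b (al w) (q w) h x0 -> coc (fun x => h x <= sh) ->
  intg (future S n w) f ->
  `|corr n w f h| <= 2 * (k * (x0 - 1)) * sh * (1 + al (future S n w)) *
     E (future S n w) (fun x => `|f x|).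
Proof.
move=> rw k0 C x01 kh cqh hsh If; have [nw cw dw] := rw.
have [ne ce de] := regular_future n rw; have re : regular (future S n w) by split.
set e := future S n w in If ne ce de re *.
have gw := nice_good nw; have bh := kcone_BV kh; have bq := q_BV (dens_at dw); have bqe := q_BV (dens_at de).
have [p1 p2 _ _] := conf_at cw; have [r1 r2 _ _] := conf_at ce.
have kq : kcone a b (al w) (q w).
  have [kq _ _] := dens_at dw; apply: (kcone_mono ab) kq; first by rewrite mulr_gt0// al_gt0.
  by rewrite ger_pMl ?al_gt0//; case/andP: g01 => _ /ltW.
have [M M0 hM] := q_iter n rw.
have := C _ _ _ kq kh x01 cqh; set de1 := k * (x0 - 1).
have d0 : 0 <= de1 by rewrite mulr_ge0// subr_ge0.
move=> /(cmp_bnd ab (al_gt0 ne))[l l0 hl].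
have bLh := trn_BV hS n gw bh; have bLq := trn_BV hS n gw bq.
set Lh := transfer_n S n w h in hl bLh *; set A := al e in hl *.
have A0 : 0 < 1 + A by have := al_gt0 ne; rewrite -/A; lra.
(* Lh / M = l q + rho, with a small nonnegative remainder rho *)
pose rho x := M^-1 * Lh x - l * q e x.
have brho : BV rho := BV_sub ab (BV_scale ab M^-1 bLh) (BV_scale ab l bqe).
have hrho : coc (fun x => 0 <= rho x <= de1 * l * q e x).
  apply: coc2 hl hM _ => x _ /andP[u1 u2] v; rewrite [transfer_n _ _ _ _ _]v in u1 u2.
  rewrite /rho subr_ge0 -(ler_pM2l M0) -[X in _ && X](ler_pM2l M0).
  rewrite mulrBr !mulVKf ?gt_eqF//.
  by apply/andP; split; [move: u1|move: u2]; rewrite -/e; lra.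
set F := E e (fun x => `|f x|).
have F0 : 0 <= F by apply: Rintegral_ge0 => x _.
have qb := q_bnd ne (dens_at de).
have Iqe := BV_int ab (nu e) bqe; have Irho := BV_int ab (nu e) brho.
have IfQ := int_mulBV ab If bqe; have IfR := int_mulBV ab If brho; have IF := int_abs If.
set Z := E e (q e); have Z1 : 1 <= Z by exact: E_q_ge1.
have bound u c : BV u -> 0 <= c -> coc (fun x => `|u x| <= c) -> `|E e (fun x => f x * u x)| <= c * F.
  move=> bu c0 uc; apply: le_trans (le_normr_Rintegral mI (int_mulBV ab If bu)) _.
  rewrite -(RintegralZl c mI IF); apply: (E_mono r2); [exact: int_abs (int_mulBV ab If bu)|exact: intZ|].
  by apply: coc_sub uc => x _ h'; rewrite normrM mulrC ler_wpM2r.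
have b1 : `|E e (fun x => f x * q e x)| <= (1 + A) * F.
  apply: bound => //; first exact: ltW.
  by apply: coc_sub qb => x _ /andP[h1 h2]; rewrite ger0_norm//; lra.
have dl : 0 <= de1 * l := mulr_ge0 d0 l0; have dlA : 0 <= de1 * l * (1 + A) := mulr_ge0 dl (ltW A0).
have b2 : `|E e (fun x => f x * rho x)| <= de1 * l * (1 + A) * F.
  apply: bound => //; apply: coc2 hrho qb _ => x _ /andP[h1 h2] /andP[_ h3]; rewrite ger0_norm//.
  by apply: le_trans h2 _; rewrite ler_wpM2l.
have b3 : 0 <= E e rho <= de1 * l * Z.
  rewrite -[X in X <= _ <= _](E_cst r1) -(RintegralZl (de1 * l) mI Iqe).
  apply/andP; split; apply: (E_mono r2) => //; [exact: (BV_int ab _ (BV_cst ab 0))| |exact: intZ|].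
    by apply: coc_sub hrho => x _ /andP[].
  by apply: coc_sub hrho => x _ /andP[].
have L0 := lam_n_gt0 n cw; set La := lam_n n w in L0 *.
have W1 := E_q_ge1 rw; set W := E w (q w) in W1 *.
have I1 : intg e (fun=> 1) by exact: (BV_int ab _ (BV_cst ab 1)).
have one h' : BV h' -> La * E w h' = E e (transfer_n S n w h').
  move=> bh'; have [_] := dual_n cw I1 bh'.
  under eq_Rintegral do rewrite mul1r.
  by under [X in _ = X -> _]eq_Rintegral do rewrite mul1r.
have eW : La * W = M * Z.
  rewrite (one _ bq) -(RintegralZl M mI Iqe); apply: (E_eq r2) => //; first exact: (BV_int ab).
  exact: intZ.
have LhE u : intg e u -> E e (fun x => u x * Lh x) = M * (E e (fun x => u x * rho x) + l * E e (fun x => u x * q e x)).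
  move=> Iu; rewrite -(RintegralZl l mI (int_mulBV ab Iu bqe)).
  have i1 := int_mulBV ab Iu brho; have i2 := intZ l (int_mulBV ab Iu bqe).
  rewrite -(RintegralD mI i1 i2) -(RintegralZl M mI (intD i1 i2)); apply: eq_Rintegral => x _.
  by rewrite /rho; field; rewrite gt_eqF.
have eh : La * E w h = M * (E e rho + l * Z).
  rewrite (one _ bh); have := LhE _ I1.
  have m1 u : E e (fun x => 1 * u x) = E e u by apply: eq_Rintegral => x _; rewrite mul1r.
  by rewrite !m1.
have [_ ef] := dual_n cw If bh; rewrite -/La -/Lh -/e LhE// in ef.
have ln' : l <= sh.
  have h1 : l * W <= E w h.
    rewrite -(ler_pM2l L0) eh mulrCA eW mulrCA ler_pM2l//.
    by case/andP: b3 => b3 _; rewrite lerDr.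
  have h2 : E w h <= sh.
    rewrite -[leRHS](E_cst p1); apply: (E_mono p2) hsh; [exact: (BV_int ab)|exact: (BV_int ab _ (BV_cst ab sh))].
  by apply: le_trans (le_trans h1 h2); rewrite ler_peMr.
have Z0 : 0 < Z by apply: lt_le_trans Z1. have W0 : 0 < W by apply: lt_le_trans W1.
have -> : corr n w f h = E e (fun x => f x * rho x) / Z - E e (fun x => f x * q e x) / Z * (E e rho / Z).
  rewrite /corr -/e -/Z -/W.
  have -> : E w (fun x => f (Tn S n w x) * h x) = La^-1 * (M * (E e (fun x => f x * rho x) + l * E e (fun x => f x * q e x))).
    by rewrite -ef mulrA mulVf ?mul1r// gt_eqF.
  have -> : E w h = La^-1 * (M * (E e rho + l * Z)) by rewrite -eh mulrA mulVf ?mul1r// gt_eqF.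
  have -> : W = La^-1 * (M * Z) by rewrite -eW mulrA mulVf ?mul1r// gt_eqF.
  by field; rewrite !gt_eqF.
have [b30 b31] := andP b3.
have Zi : `|Z^-1| = Z^-1 by rewrite gtr0_norm ?invr_gt0.
have c1 : `|E e (fun x => f x * rho x) / Z| <= de1 * l * (1 + A) * F.
  rewrite normrM Zi ler_pdivrMr//.
  by apply: le_trans b2 _; rewrite ler_peMr// mulr_ge0.
have c2 : `|E e (fun x => f x * q e x) / Z * (E e rho / Z)| <= de1 * l * (1 + A) * F.
  have rZ : 0 <= E e rho / Z by rewrite divr_ge0// ltW.
  rewrite normrM (ger0_norm rZ).
  have -> : de1 * l * (1 + A) * F = ((1 + A) * F) * (de1 * l) by ring.
  apply: ler_pM => //.
    rewrite normrM Zi ler_pdivrMr//.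
    by apply: le_trans b1 _; rewrite ler_peMr// (mulr_ge0 (ltW A0) F0).
  by rewrite ler_pdivrMr.
apply: le_trans (ler_normB _ _) _; apply: le_trans (lerD c1 c2) _.
have -> : de1 * l * (1 + A) * F + de1 * l * (1 + A) * F = 2 * de1 * l * ((1 + A) * F) by ring.
have -> : 2 * de1 * sh * (1 + A) * F = 2 * de1 * sh * ((1 + A) * F) by ring.
have AF : 0 <= (1 + A) * F := mulr_ge0 (ltW A0) F0.
by apply: ler_wpM2r => //; apply: ler_wpM2l => //; exact: (mulr_ge0 _ d0).
Qed.

End Gamma.
End Correlations.

(** * Tempered constants *)

Section Tempering.
Context {R : realType} {d : measure_display} {Om : measurableType d} (m : probability Om R)
  (S : system R Om).
Hypothesis hS : random_open_map m S.
Local Notation orb := (orb (sigma S) (sigmaV S)).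
Local Notation sK := (sK hS).
Local Notation sVK := (sVK hS).

(** Let M w be the supremum along the orbit of w of L discounted at the rate eta.  It
is subexponential, because the discount absorbs the distance between two points of
the orbit; take the exponential of 2 M. *)
Lemma tempering (L : Om -> R) eta : subexp m (sigma S) (sigmaV S) L -> {ae m, forall w, 0 <= L w} ->
  0 < eta -> exists C : Om -> R, [/\ forall w, 0 < C w, tempered m S C &
    {ae m, forall w, forall k : int, expR (L w + L (orb w k)) <= C w * expR (eta * `|k|%N%:R)}].
Proof.
move=> sL L0 eta0.
pose V w := ([set L (orb w k) - eta * `|k|%N%:R | k in [set: int]] : set R).
pose M w := sup (V w).
exists (fun w => expR (2 * M w)).
have hs w : (exists K, forall k, L (orb w k) <= eta * `|k|%N%:R + K) -> has_sup (V w).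
  move=> [K hK]; split; first by exists (L (orb w 0) - eta * `|0%:Z|%N%:R); exists 0.
  by exists K => _ [k _ <-]; have := hK k; lra.
have le_M w k : has_sup (V w) -> L (orb w k) - eta * `|k|%N%:R <= M w.
  by move=> h; apply: sup_upper_bound => //; exists k.
have L0o := ae_orbit hS L0.
have good : {ae m, forall w, [/\ forall k, 0 <= L (orb w k), forall k, has_sup (V (orb w k)) &
    forall e, 0 < e -> exists K, forall j, M (orb w j) <= e * `|j|%N%:R + K]}.
  apply: filterS2 sL L0o => w h h0.
  have step e : 0 < e -> e <= eta -> exists K, forall j, (forall k, L (orb (orb w j) k) <=
      eta * `|k|%N%:R + (e * `|j|%N%:R + K)).
    move=> e0 ee; have [K hK] := h _ e0; exists K => j k.
    rewrite (orbD sK sVK); apply: le_trans (hK _) _.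
    have u1 : e * `|(j + k)%R|%N%:R <= e * (`|j|%N%:R + `|k|%N%:R) by rewrite ler_pM2l// absz_leD.
    have u2 : e * `|k|%N%:R <= eta * `|k|%N%:R by rewrite ler_wpM2r.
    lra.
  split=> // [k|e e0].
    have [K hK] := step _ eta0 (lexx _); apply: hs.
    by exists (eta * `|k|%N%:R + K) => l; exact: hK.
  pose e' := Num.min e eta; have e'0 : 0 < e' by rewrite lt_min e0.
  have [K hK] := step e' e'0 (ltac:(by rewrite ge_min lexx orbT)).
  exists K => j; apply: ge_sup; first by exists (L (orb (orb w j) 0) - eta * `|0%:Z|%N%:R); exists 0.
  move=> _ [k _ <-]; have := hK j k.
  have : e' * `|j|%N%:R <= e * `|j|%N%:R by rewrite ler_wpM2r// ge_min lexx.
  lra.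
split.
- by move=> w; exact: expR_gt0.
- apply: filterS good => w [h0 h1 h2].
  have M0 j : 0 <= M (orb w j).
    apply: le_trans (le_M _ 0 (h1 j)); rewrite mulr0 subr0 (orbD sK sVK) addr0; exact: h0.
  have lim (v : nat -> int) : (forall n, `|v n|%N = n) ->
      ((n%:R^-1)%:E * lne `|expR (2 * M (orb w (v n)))|%:E @[n --> \oo] --> 0)%E.
    move=> vn.
    have -> : (fun n => (n%:R^-1)%:E * lne `|expR (2 * M (orb w (v n)))|%:E)%E =
        EFin \o (fun n => n%:R^-1 * (2 * M (orb w (v n)))).
      have lnE (x : R) : lne (`|expR x|%:E) = x%:E.
        by rewrite gtr0_norm ?expR_gt0// lne_EFin ?expR_gt0// expRK.
      by apply/funext => n; rewrite lnE.
    apply/cvg_EFin; first by near=> n.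
    apply/cvgrPdist_le => e e0; have e40 : 0 < e / 4 by rewrite divr_gt0.
    have [K hK] := h2 _ e40.
    near=> n.
    have n0 : 0 < n%:R :> R by rewrite ltr0n; near: n; exact: nbhs_infty_gt.
    rewrite sub0r normrN ger0_norm; last by rewrite !mulr_ge0 ?invr_ge0// ltW.
    change (n%:R^-1 * (2 * M (orb w (v n))) <= e); rewrite mulrC ler_pdivrMr//.
    have := hK (v n); rewrite vn.
    have : 4 * K <= e * n%:R.
      rewrite mulrC -ler_pdivrMl//.
      by apply: ltW; near: n; apply: nbhs_infty_gtr.
    lra.
  split.
    by apply: (lim (fun n => n%:Z)) => n.
  under eq_fun do rewrite past_orb.
  by apply: (lim (fun n => - n%:Z)) => n; rewrite abszN.
- apply: filterS good => w [h0 h1 h2] k.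
  rewrite -expRD ler_expR.
  have := le_M _ 0 (h1 0); have := le_M _ k (h1 0).
  rewrite mulr0 subr0; change (orb (orb w 0) 0) with w; change (orb w 0) with w; lra.
Unshelve. all: by end_near. Qed.

End Tempering.

(** * The equilibrium measures *)

Section Equilibrium.
Context {R : realType} {d : measure_display} {Om : measurableType d} (m : probability Om R)
  (S : system R Om).
Hypothesis hS : random_open_map m S.
Hypothesis hphi : strongly_contracting m S.
Variables (q : Om -> R -> R) (nu : Om -> probability (measurableTypeR R) R).
Hypothesis hq : equivariant_density m S q.
Hypothesis hnu : conformal_measure m S nu.
Implicit Types (w : Om) (n : nat) (f h : R -> R).
Local Notation a := (lo S).
Local Notation b := (hi S).
Local Notation I := (dom S).
Local Notation s := (sigma S).
Local Notation sV := (sigmaV S).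
Local Notation orb := (orb s sV).
Local Notation BV := (inBV a b).
Local Notation ab := (rm_ab hS).
Local Notation coc := (coc a b).
Local Notation mI := (I_meas a b).
Local Notation E w f := (\int[nu w]_(x in I) f x).
Local Notation intg w f := ((nu w).-integrable I (EFin \o f)).

Definition kq w : measurableTypeR R -> R := (fun x => q w x / E w (q w)) \_ I.

(** The measure of density q / nu(q). The normalization and the default value
only matter at the exceptional points where the construction fails. *)
Definition equi w : probability (measurableTypeR R) R :=
  match pselect (measurable_fun setT (kq w)) with
  | left mk => mnormalize (mdens (nu w) mk) (nu w)
  | right _ => nu w
  end.

Section Gamma.
Variable gamma : R.
Hypothesis g01 : 0 < gamma < 1.
Hypothesis gc : \int[m]_w lnc S w < ln gamma.
Local Notation al := (a_ S gamma).
Local Notation regular := (regular S q nu gamma).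
Let g0 : 0 < gamma. Proof. by case/andP: g01. Qed.

Let aereg := ae_regular hS hphi hq hnu g01 gc.

Lemma reg_nice w : regular w -> nice S gamma w. Proof. by case. Qed.
Lemma reg_conf w : regular w -> conf S nu w. Proof. by move=> [_ /conf_at]. Qed.
Lemma reg_dens w : regular w -> dens S q gamma w. Proof. by move=> [_ _ /dens_at]. Qed.
Lemma reg_q w : regular w -> BV (q w). Proof. by move=> /reg_dens/q_BV. Qed.

Lemma kq_meas w : BV (q w) -> measurable_fun setT (kq w).
Proof.
move=> bq; apply/(measurable_restrictT _ mI); apply: measurable_funM => //.
exact: (BV_measurable ab bq).
Qed.

Let pos_part w : regular w -> coc (fun x => Num.max (kq w x) 0 = q w x * (E w (q w))^-1).
Proof.
move=> rw; have Z := E_q_ge1 hS rw.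
apply: coc_sub (q_bnd hS g01 (reg_nice rw) (reg_dens rw)) => x ix /andP[q1 _].
rewrite /kq patchE mem_set// max_l// divr_ge0//; [exact: le_trans q1|exact: le_trans Z].
Qed.

Lemma equi_int w f : regular w -> measurable_fun (I : set (measurableTypeR R)) f ->
  (\int[equi w]_(x in I) (f x)%:E = \int[nu w]_(x in I) (f x * q w x * (E w (q w))^-1)%:E)%E.
Proof.
move=> rw mf; have mk := kq_meas (reg_q rw); have [p1 p2 _ _] := reg_conf rw.
have mIq : measurable_fun (I : set (measurableTypeR R)) (q w) := BV_measurable ab (reg_q rw).
have key (u : R -> R) : measurable_fun (I : set (measurableTypeR R)) u ->
    (\int[nu w]_(x in I) (u x * Num.max (kq w x) 0)%:E = \int[nu w]_(x in I) (u x * q w x * (E w (q w))^-1)%:E)%E.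
  move=> mu; apply: ae_eq_integral; first exact: mI.
  - apply/measurable_EFinP; apply: measurable_funM => //; apply: measurable_maxr => //.
    exact: measurable_funTS.
  - by apply/measurable_EFinP; do 2 apply: measurable_funM => //.
  - apply: (@filterS _ _ (ae_filter_ringOfSetsType _)) (coc_nu p2 (pos_part rw)) => x h ix.
    by rewrite h// mulrA.
rewrite /equi; case: pselect => [mk'|/(_ mk)//].
have tot : mdens (nu w) mk' setT = 1%E.
  have -> : mdens (nu w) mk' setT = (\int[nu w]_(x in I) (1 * Num.max (kq w x) 0)%:E)%E.
    rewrite [RHS]integral_mkcond; apply: eq_integral => x _; rewrite patchE mul1r.
    by case: ifPn => // nx; rewrite /kq patchE (negbTE nx) maxxx.
  rewrite (key (fun=> 1))//.
  have i1 := BV_int ab (nu w) (BV_scale ab (E w (q w))^-1 (reg_q rw)).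
  have -> : (\int[nu w]_(x in I) (1 * q w x * (E w (q w))^-1)%:E = (E w (fun x => (E w (q w))^-1 * q w x))%:E)%E.
    by rewrite -(int_fin i1); apply: eq_integral => x _; rewrite mul1r mulrC.
  rewrite (RintegralZl _ mI (BV_int ab _ (reg_q rw))) mulVf// gt_eqF//.
  exact: lt_le_trans (E_q_ge1 hS rw).
have -> : (\int[mnormalize (mdens (nu w) mk') (nu w)]_(x in I) (f x)%:E = \int[mdens (nu w) mk']_(x in I) (f x)%:E)%E.
  apply: eq_measure_integral => A mA _.
  change (mnormalize (mdens (nu w) mk') (nu w) A = mdens (nu w) mk' A).
  have tot' : (mdens (nu w) mk' : {measure set _ -> \bar R}) setT = 1%E := tot.
  by rewrite /mnormalize tot' onee_eq0/= invr1 mule1.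
by rewrite (mdens_integral _ mk' mI mf) key.
Qed.

Lemma equi_intE w f : regular w -> intg w f ->
  (\int[equi w]_(x in I) (f x)%:E = (E w (fun x => f x * q w x) / E w (q w))%:E)%E.
Proof.
move=> rw If; have mf : measurable_fun (I : set (measurableTypeR R)) f.
  by apply/measurable_EFinP; exact: measurable_int If.
have IfQ := int_mulBV ab If (reg_q rw).
rewrite (equi_int rw mf) -(RintegralZr _ mI IfQ) -int_fin//.
have mI' := mI.
by apply: eq_integrable (intZ (E w (q w))^-1 IfQ) => // x _ /=; rewrite mulrC.
Qed.

Lemma equi_equilibrium : equilibrium_measure m S q nu equi.
Proof.
apply: filterS aereg => w rw f If.
by rewrite (equi_intE rw If) (int_fin (int_mulBV ab If (reg_q rw))) EFinM.
Qed.

(** Duality with h = q expresses nu_w((f o T) q) through nu_(sigma w)(f q), up to a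
factor that the case f = 1 determines.  A function that is integrable for mu is integrable for
nu, since q >= 1. *)
Lemma equi_equivariant : equivariant_measure m S equi.
Proof.
apply: filterS aereg => w rw f If.
have rs : regular (s w) by exact: (regular_future hS 1 rw).
have mf : measurable_fun (I : set (measurableTypeR R)) f.
  by apply/measurable_EFinP; exact: measurable_int If.
have bq := reg_q rw; have bqs := reg_q rs; have [p1 p2 _ _] := reg_conf rs.
have Zs := E_q_ge1 hS rs; have Zw := E_q_ge1 hS rw.
have Ifs : intg (s w) f.
  apply/integrableP; split; first exact/measurable_EFinP.
  have /integrableP[_] := If.
  have mfn : measurable_fun (I : set (measurableTypeR R)) (fun x => `|f x|) by exact: measurableT_comp.
  rewrite [X in (X < _)%E -> _](equi_int rs mfn) => fin.
  have mq : measurable_fun (I : set (measurableTypeR R)) (q (s w)) := BV_measurable ab bqs.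
  have fin2 : (\int[nu (s w)]_(x in I) (`|f x| * Num.max (q (s w) x) 1)%:E < +oo)%E.
    have -> : (\int[nu (s w)]_(x in I) (`|f x| * Num.max (q (s w) x) 1)%:E =
        (E (s w) (q (s w)))%:E * \int[nu (s w)]_(x in I) (`|f x| * Num.max (q (s w) x) 1 * (E (s w) (q (s w)))^-1)%:E)%E.
      rewrite -ge0_integralZl//; first last.
      - by rewrite lee_fin (le_trans _ Zs).
      - by move=> x _; rewrite lee_fin !mulr_ge0// ?le_max ?ler01 ?orbT// invr_ge0 (le_trans _ Zs).
      - apply/measurable_EFinP; do 2 apply: measurable_funM => //; exact: measurable_maxr.
      - exact: mI.
      apply: eq_integral => x _; rewrite -EFinM; congr EFin; rewrite [RHS]mulrC divfK// gt_eqF//.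
      exact: lt_le_trans Zs.
    apply: lte_mul_pinfty; [by rewrite lee_fin (le_trans _ Zs)|by []|].
    congr (_ < _)%E: fin; apply: ae_eq_integral; first exact: mI.
    - by apply/measurable_EFinP; do 2 apply: measurable_funM => //.
    - by apply/measurable_EFinP; do 2 apply: measurable_funM => //; exact: measurable_maxr.
    - apply: (@filterS _ _ (ae_filter_ringOfSetsType _)) (coc_nu p2 (q_bnd hS g01 (reg_nice rs) (reg_dens rs))) => x h ix.
      by have /andP[q1 _] := h ix; rewrite max_l.
  apply: le_lt_trans fin2; apply: ge0_le_integral => //; first exact: mI.
  - by apply/measurable_EFinP.
  - by apply/measurable_EFinP; apply: measurable_funM => //; exact: measurable_maxr.
  - by move=> x _; rewrite lee_fin ler_peMr// le_max lexx orbT.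
have [cw ncw] : conf_orbit S nu w /\ nice S gamma w by case: rw.
have [J1 _] := dual_n hS cw (n:=1) Ifs (BV_cst ab 1).
have mI' := mI; have {}J1 : intg w (fun x => f (T_ S w x)).
  by apply: eq_integrable J1 => // x _ /=; rewrite mulr1.
rewrite (equi_intE rs Ifs) (equi_intE rw J1); congr EFin.
have [_ E1] := dual_n hS cw (n:=1) Ifs bq.
have I1 : intg (s w) (fun=> 1) by exact: (BV_int ab _ (BV_cst ab 1)).
have [_ E2] := dual_n hS cw (n:=1) I1 bq.
have [M M0 hM] := q_iter hS g01 1 rw.
have eL u : intg (s w) u -> E (s w) (fun x => u x * transfer_n S 1 w (q w) x) = M * E (s w) (fun x => u x * q (s w) x).
  move=> Iu; rewrite -(RintegralZl M mI (int_mulBV ab Iu bqs)); apply: (E_eq p2).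
  - exact: (int_mulBV ab Iu (trn_BV hS 1 (nice_good ncw) bq)).
  - exact: (intZ M (int_mulBV ab Iu bqs)).
  - by apply: coc_sub hM => x _ h; rewrite [transfer_n _ _ _ _ _]h mulrCA.
have m1 w' u : E w' (fun x => 1 * u x) = E w' u by apply: eq_Rintegral => x _; rewrite mul1r.
have E2' : lam_n S nu 1 w * E w (q w) = M * E (s w) (q (s w)).
  by have := etrans E2 (eL _ I1); rewrite !m1.
have E1' := etrans E1 (eL _ Ifs).
have L0 := lam_n_gt0 hS 1 cw.
have Z0 : 0 < E w (q w) by exact: lt_le_trans Zw.
have Zs0 : 0 < E (s w) (q (s w)) by exact: lt_le_trans Zs.
have -> : E w (q w) = (lam_n S nu 1 w)^-1 * (M * E (s w) (q (s w))).
  by rewrite -E2' mulrA mulVf ?mul1r// gt_eqF.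
have -> : E w (fun x => f (T_ S w x) * q w x) = (lam_n S nu 1 w)^-1 * (M * E (s w) (fun x => f x * q (s w) x)).
  by rewrite -[X in _ = _ * X]E1' mulrA mulVf ?mul1r// gt_eqF.
by field; rewrite !gt_eqF.
Qed.

(** For c large, h q + c and c lie in the cone of parameter gamma a, at a projective
distance from q bounded by [cmp_init]; their correlations are bounded by
[corr_cone] and their difference is h q. *)
Lemma corr_BV n w k f h : regular w -> 0 <= k -> Contr S gamma w n k -> BV h -> intg (future S n w) f ->
  `|corr S q nu n w f (fun x => h x * q w x)| <=
   16 * (2 + gamma^-1) / (1 - gamma) ^+ 2 * (1 + al w) ^+ 3 * (1 + al (future S n w)) * k * norm_BV a b h
   * E (future S n w) (fun x => `|f x|).
Proof.
move=> rw k0 C bh If.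
have nw := reg_nice rw; have dw := reg_dens rw; have bq := reg_q rw.
have [kq' Eq _] := dw; have a1 := al_ge1 nw; have a0 := al_gt0 nw.
have cw : conf_orbit S nu w by case: rw.
set A := al w in a1 a0 kq' *; set Ae := al (future S n w).
have Ae0 : 0 < Ae by apply: al_gt0; exact: (nice_future hS n nw).
set N := norm_BV a b h; have N0 : 0 <= N by exact: (norm_BV_ge0 ab bh).
have A1 : 0 <= 1 + A := addr_ge0 ler01 (ltW a0).
have Ae1 : 0 <= 1 + Ae := addr_ge0 ler01 (ltW Ae0).
pose B := N * (1 + A); have B0 : 0 <= B := mulr_ge0 N0 A1.
have gi0 : 0 < gamma^-1 by rewrite invr_gt0.
have [g1 g2] := andP g01.
have gi1 : 0 <= 1 + gamma^-1 := addr_ge0 ler01 (ltW gi0).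
have gA : gamma * A <= A by rewrite ger_pMl; [exact: ltW|exact: a0].
have gA0 : 0 < gamma * A := mulr_gt0 g1 a0.
pose c := B * (1 + gamma^-1).
have qb := q_bnd hS g01 nw dw; have bhq := BV_mul ab bh bq.
have hn := BV_norm_oo ab bh.
have v0 := var_ge0 ab h; have n0 := norm_oo_ge0 ab bh.
have hq' : coc (fun x => `|h x * q w x| <= B).
  apply: coc2 qb hn _ => x _ /andP[q1 q2] hx; rewrite normrM (ger0_norm (le_trans ler01 q1)).
  by apply: ler_pM => //; [exact: le_trans q1|apply: le_trans hx _; rewrite /N /norm_BV lerDr].
have vq : var a b (fun x => h x * q w x) <= B.
  have qa : coc (fun x => `|q w x| <= 1 + A).
    by apply: coc_sub qb => x _ /andP[q1 q2]; rewrite ger0_norm// (le_trans _ q1).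
  apply: le_trans (var_mul ab bh bq hn qa) _.
  have : var a b (q w) <= A.
    have [_] := kq'; rewrite [Einf _ _]Eq mulr1 => /le_trans; apply; exact: gA.
  move=> vA; have : norm_oo a b h * var a b (q w) <= norm_oo a b h * (1 + A).
    by apply: ler_wpM2l n0 _ _ _; apply: le_trans vA _; rewrite lerDr.
  by move=> vA'; rewrite /B /N /norm_BV [leRHS]mulrDl [var a b h * _]mulrC lerD2l.
pose H1 x := h x * q w x + c; pose H2 (_ : R) := c.
have bH1 : BV H1 := BV_add ab bhq (BV_cst ab c).
have k1 : kcone a b (gamma * A) H1.
  split=> //; apply: (@le_trans _ _ B).
    apply: le_trans (var_add ab bhq (BV_cst ab c)) _; by rewrite (var_cst ab) addr0.
  have : B * gamma^-1 <= Einf I H1.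
    apply: (le_Einf ab bH1); apply: coc_sub hq' => x _; rewrite ler_norml => /andP[h1 _].
    by rewrite /H1 /c mulrDr mulr1; lra.
  move=> e1; apply: (@le_trans _ _ (gamma * A * (B * gamma^-1))); last exact: ler_wpM2l (ltW gA0) _ _ e1.
  have -> : gamma * A * (B * gamma^-1) = A * B by field; rewrite gt_eqF.
  exact: ler_peMl B0 a1.
have c0 : 0 <= c := mulr_ge0 B0 gi1.
have k2 : kcone a b (gamma * A) H2.
  split; first exact: (BV_cst ab c).
  rewrite (var_cst ab) (Einf_cst ab); exact: mulr_ge0 (ltW gA0) c0.
have E0 : 0 < Einf (Icc a b) (q w) by rewrite [Einf _ _]Eq.
have cm H (kH : kcone a b (gamma * A) H) := cmp_init ab g01 a0 kq' E0 kH.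
have mo H (kH : kcone a b (gamma * A) H) : kcone a b A H.
  exact: (kcone_mono ab gA0 gA kH).
set x0 := kap gamma A ^- 2 in cm.
have /andP[kp0 kp1] := kap_itv g01 a0.
have x01 : 1 <= x0 by rewrite /x0 invf_ge1 ?exprn_gt0// exprn_ile1// ltW.
have x0b : x0 - 1 <= 4 / (1 - gamma) ^+ 2 * (1 + A) ^+ 2.
  have -> : 4 / (1 - gamma) ^+ 2 * (1 + A) ^+ 2 = (2 * (1 + A) / (1 - gamma)) ^+ 2.
    by field; rewrite subr_eq0 gt_eqF.
  apply: (@le_trans _ _ x0); first by rewrite gerBl.
  have h0 : 0 <= (1 - gamma)^-1 by rewrite invr_ge0 subr_ge0 ltW.
  have h1 : 0 <= 1 + gamma + gamma * A := addr_ge0 (addr_ge0 ler01 (ltW g1)) (ltW gA0).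
  have h2 : 1 + gamma + gamma * A <= 2 * (1 + A) by move: gA; set p := gamma * A; move: a0 g2; clearbody A p; lra.
  rewrite /x0 -exprVn /kap invf_div; apply: lerXn2r; rewrite ?nnegrE.
  - exact: mulr_ge0 h1 h0.
  - exact: mulr_ge0 (le_trans h1 h2) h0.
  - exact: ler_wpM2r h0 _ _ h2.
pose sh := B * (2 + gamma^-1).
have s1 : coc (fun x => H1 x <= sh).
  apply: coc_sub hq' => x _; rewrite ler_norml => /andP[_ h2].
  by rewrite /H1 /sh /c !mulrDr mulr1; lra.
have s2 : coc (fun x => H2 x <= sh).
  by apply: cocW => x _; rewrite /H2 /sh /c !mulrDr mulr1; lra.
have C1 := corr_cone hS g01 rw k0 C x01 (mo _ k1) (cm _ k1) s1 If.
have C2 := corr_cone hS g01 rw k0 C x01 (mo _ k2) (cm _ k2) s2 If.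
have eC : corr S q nu n w f (fun x => h x * q w x) = corr S q nu n w f H1 - corr S q nu n w f H2.
  have bH2 := BV_cst ab c.
  have [J1 _] := dual_n hS cw If bH1; have [J2 _] := dual_n hS cw If bH2.
  have e1 : E w (fun x => f (Tn S n w x) * (h x * q w x)) =
     E w (fun x => f (Tn S n w x) * H1 x) - E w (fun x => f (Tn S n w x) * H2 x).
    by rewrite -(RintegralB mI J1 J2); apply: eq_Rintegral => x _; rewrite -mulrBr /H1 /H2 addrK.
  have e2 : E w (fun x => h x * q w x) = E w H1 - E w H2.
    rewrite -(RintegralB mI (BV_int ab _ bH1) (BV_int ab _ bH2)).
    by apply: eq_Rintegral => x _; rewrite /H1 /H2 addrK.
  by rewrite /corr e1 e2; ring.
rewrite eC; apply: le_trans (ler_normB _ _) _; apply: le_trans (lerD C1 C2) _.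
have F0 : 0 <= E (future S n w) (fun x => `|f x|) by apply: Rintegral_ge0 => x _; exact: normr_ge0.
rewrite -/Ae -mulrDl; apply: ler_wpM2r F0 _ _ _.
have -> : 2 * (k * (x0 - 1)) * sh * (1 + Ae) + 2 * (k * (x0 - 1)) * sh * (1 + Ae) =
   (4 * k * sh * (1 + Ae)) * (x0 - 1) by ring.
apply: le_trans (ler_wpM2l _ x0b) _.
  have s0 : 0 <= sh := mulr_ge0 B0 (addr_ge0 (ler0n R 2) (ltW gi0)).
  exact: (mulr_ge0 (mulr_ge0 (mulr_ge0 (ler0n R 4) k0) s0) Ae1).
rewrite le_eqVlt; apply/orP; left; apply/eqP; rewrite /sh /B.
by move: (gamma^-1) ((1 - gamma) ^- 2) => p1 p2; ring.
Qed.

(** The constants of [corr_BV] at the two ends of an orbit segment are subexponential: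
[tempering] dominates their product by a tempered constant, times an exponential
which is absorbed by replacing theta with r. *)
Lemma decay theta r : 0 < theta < 1 -> contracts m S gamma theta -> theta < r ->
  exists C : Om -> R, [/\ forall w, 0 < C w, tempered m S C & correlation_decay m S nu equi C r].
Proof.
move=> /andP[t0 t1] [A [sA hA]] tr.
have r0 : 0 < r := lt_trans t0 tr.
have eta0 : 0 < ln r - ln theta by rewrite subr_gt0 ltr_ln ?posrE.
have [g1 g2] := andP g01.
pose K0 : R := 16 * (2 + gamma^-1) / (1 - gamma) ^+ 2.
have K01 : 1 <= K0.
  rewrite /K0 ler_pdivlMr ?exprn_gt0 ?subr_gt0// mul1r.
  have gi0 : 0 < gamma^-1 by rewrite invr_gt0.
  have : (1 - gamma) ^+ 2 <= 1 by rewrite exprn_ile1 ?subr_ge0 ?(ltW g2)// gerBl ltW.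
  lra.
pose L w := ln K0 + (3 * ln (1 + al w) + A w).
have sL : subexp m s sV L.
  have sa := aperture_subexp hS hphi g01 gc.
  by apply: subexp_add; [exact: subexp_cst|apply: subexp_add => //; exact: subexp_scale].
have L0 : {ae m, forall w, 0 <= L w}.
  apply: filterS hA => w [nw A0 _]; have a0 := al_gt0 nw.
  have h1 : 0 <= ln (1 + al w) by apply: ln_ge0; rewrite lerDl; exact: ltW a0.
  by rewrite /L; have := ln_ge0 K01; lra.
have [C [C0 tC hC]] := tempering hS sL L0 eta0.
exists C; split=> //.
have aL0 := ae_orbit hS L0; have aA := ae_orbit hS hA.
have areg := ae_orbit hS aereg; have aC := ae_orbit hS hC.
have all4 : {ae m, forall w, [/\ forall k, regular (orb w k), forall k, 0 <= L (orb w k),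
   forall k n, Contr S gamma (past S n (orb w k)) n (expR (A (orb w k)) * theta ^+ n),
   forall k, 0 <= A (orb w k) & forall k : int, expR (L w + L (orb w k)) <= C w * expR ((ln r - ln theta) * `|k|%N%:R)]}.
  apply: filterS2 (filterI areg aL0) (filterI aA hC) => w [h1 h2] [h3 h4].
  by split=> // k; case: (h3 k).
have eq4 (x y z t : R) : 0 < x -> 0 < y -> 0 < z ->
    x * y ^+ 3 * z * expR t = expR (ln x + 3 * ln y + ln z + t).
  by move=> x0 y0 z0; rewrite !expRD [3 * _]mulrC expRM_natr !lnK ?posrE.
have arith (x1 x2 x3 x4 x5 : R) : 0 <= x1 -> 0 <= x3 -> 0 <= x4 -> 0 <= x5 ->
    x1 + 3 * x2 + x3 + x5 <= x1 + (3 * x2 + x4) + (x1 + (3 * x3 + x5)).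
  by move=> *; lra.
(* The estimate from v to sigma^n v, with the constant D of either end point. *)
have main v n h f D : regular v -> regular (future S n v) -> 0 <= A v -> 0 <= A (future S n v) ->
    Contr S gamma v n (expR (A (future S n v)) * theta ^+ n) ->
    expR (L v + L (future S n v)) <= D * expR ((ln r - ln theta) * n%:R) -> 0 <= D ->
    BV h -> intg (future S n v) f ->
    (`| \int[equi v]_(x in I) (f (Tn S n v x) * h x)%:E
          - (\int[equi (future S n v)]_(x in I) (f x)%:E) * (\int[equi v]_(x in I) (h x)%:E) |
       <= D%:E * (\int[nu (future S n v)]_(x in I) `|f x|%:E) * (norm_BV a b h)%:E * (r ^+ n)%:E)%E.
  move=> rv re Av Ae Cv LD D0 bh If.
  have [nv cv _] := rv; have [J1 _] := dual_n hS cv If bh.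
  have k0 : 0 <= expR (A (future S n v)) * theta ^+ n by rewrite mulr_ge0 ?expR_ge0// exprn_ge0// ltW.
  have cb := corr_BV rv k0 Cv bh If.
  rewrite (equi_intE rv J1) (equi_intE re If) (equi_intE rv (BV_int ab _ bh)).
  have IF := int_abs If.
  rewrite [X in (_ <= _ * X * _ * _)%E](int_fin IF).
  rewrite -EFinM -EFinB -!EFinM lee_fin.
  have -> : E v (fun x => f (Tn S n v x) * h x * q v x) = E v (fun x => f (Tn S n v x) * (h x * q v x)).
    by apply: eq_Rintegral => x _; rewrite mulrA.
  have N0 : 0 <= norm_BV a b h := norm_BV_ge0 ab bh.
  set F := \int[nu (future S n v)]_(x in I) `|f x| in cb *.
  have F0 : 0 <= F by apply: Rintegral_ge0 => x _; exact: normr_ge0.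
  apply: le_trans cb _.
  have a0 := al_gt0 nv; have ae0 : 0 < al (future S n v) by apply: al_gt0; exact: reg_nice re.
  have key : K0 * (1 + al v) ^+ 3 * (1 + al (future S n v)) * (expR (A (future S n v)) * theta ^+ n) <= D * r ^+ n.
    have e1 : D * r ^+ n = D * expR ((ln r - ln theta) * n%:R) * theta ^+ n.
      rewrite -mulrA; congr (_ * _); rewrite -[in RHS](lnK (x:=theta)) ?posrE// expRK -expRM_natr -expRD.
      by rewrite -[r in LHS]lnK ?posrE// -expRM_natr; congr expR; ring.
    rewrite e1 mulrA ler_wpM2r ?exprn_ge0 ?(ltW t0)//; apply: le_trans LD.
    have lv : 0 < 1 + al v := addr_gt0 ltr01 a0.
    have le : 0 < 1 + al (future S n v) := addr_gt0 ltr01 ae0.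
    have K00 : 0 < K0 by apply: lt_le_trans K01.
    have -> : K0 * (1 + al v) ^+ 3 * (1 + al (future S n v)) * expR (A (future S n v)) =
       expR (ln K0 + 3 * ln (1 + al v) + ln (1 + al (future S n v)) + A (future S n v)).
      exact: (eq4 _ _ _ _ K00 lv le).
    rewrite ler_expR /L; have h1 : 0 <= ln K0 by rewrite ln_ge0.
    have h2 : 0 <= ln (1 + al (future S n v)).
      by apply: ln_ge0; rewrite lerDl; exact: ltW ae0.
    exact: (arith _ (ln (1 + al v)) _ _ _ h1 h2 Av Ae).
  have -> : D * F * norm_BV a b h * r ^+ n = D * r ^+ n * (norm_BV a b h * F) by ring.
  rewrite -mulrA; apply: ler_wpM2r key; exact: mulr_ge0 N0 F0.
apply: filterS all4 => w [h1 h2 h3 h4 h5] n h bh; split=> f If /=.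
- have e : future S n (past S n w) = w by exact: (future_pastK hS).
  have := main (past S n w) n h f (C w); rewrite e; apply=> //.
  + by rewrite past_orb; exact: h1.
  + exact: (h1 0).
  + by rewrite past_orb; exact: h4.
  + exact: (h4 0).
  + exact: (h3 0).
  + by rewrite addrC past_orb; have := h5 (- n%:Z); rewrite abszN.
  + exact: ltW.
- have e : past S n (orb w n%:Z) = w by exact: (past_futureK hS).
  apply: (main w n h f (C w)) => //.
  + exact: (h1 0).
  + exact: (h1 n%:Z).
  + exact: (h4 0).
  + exact: (h4 n%:Z).
  + by have := h3 n%:Z n; rewrite e.
  + exact: (h5 n%:Z).
  + exact: ltW.
Qed.

End Gamma.
End Equilibrium.

(** * The exponents of the multipliers *)

Lemma fibred_dep {d : measure_display} {Om : measurableType d} (T : countType)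
  (W : Om -> T) d' (U : measurableType d') (F : Om -> U) :
  fibred W -> (forall w w', W w = W w' -> F w = F w') -> measurable_fun setT F.
Proof.
move=> fW FE; rewrite (_ : F = (fun t => F (xget point [set w | W w = t])) \o W).
  exact: fibred_meas fW.
apply/funext => w /=; apply: FE.
by case: xgetP => [w' _ /= ->//|/(_ w)]; case.
Qed.

Section CompleteMeasurability.
Context {R : realType} {d : measure_display} {Om : measurableType d} (m : probability Om R).
Hypothesis mc : measure_is_complete m.
Implicit Types f g : Om -> R.

(** The upper limit is measurable, and completeness lets one change it on a null set. *)
Lemma ae_cvg_meas (u : nat -> Om -> R) f : (forall n, measurable_fun setT (u n)) ->
  {ae m, forall w, u n w @[n --> \oo] --> f w} -> measurable_fun setT f.
Proof.
move=> mu cu; apply/measurable_EFinP.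
have mE n : measurable_fun setT (EFin \o u n) by apply/measurable_EFinP.
apply: (ae_measurable_fun mc _ (measurable_fun_limn_esup mE)).
apply: filterS cu => w cw _ /=.
have c : ((u n w)%:E @[n --> \oo] --> (f w)%:E)%E by apply: cvg_EFin => //; exact: nearW.
by rewrite (is_cvg_limn_esupE (cvgP _ c)); exact: cvg_lim c.
Qed.

(** Only an almost sure comparison is given: replace u by its truncation between f and g. *)
Lemma integrable_between f g u : m.-integrable setT (EFin \o f) -> m.-integrable setT (EFin \o g) ->
  measurable_fun setT u -> {ae m, forall w, f w <= u w <= g w} -> m.-integrable setT (EFin \o u).
Proof.
move=> If Ig mu fug; have mf : measurable_fun setT f by apply/measurable_EFinP; exact: measurable_int If.
have mg : measurable_fun setT g by apply/measurable_EFinP; exact: measurable_int Ig.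
pose v w := Num.max (f w) (Num.min (u w) (g w)).
have mv : measurable_fun setT v by apply: measurable_maxr => //; exact: measurable_minr.
have vE : {ae m, forall w, u w = v w}.
  by apply: filterS fug => w /andP[h1 h2]; rewrite /v (min_idPl h2) (max_idPr h1).
have Iv : m.-integrable setT (EFin \o v).
  apply: (le_integrable measurableT _ _ (integrableD measurableT (integrable_abse If) (integrable_abse Ig))).
    exact/measurable_EFinP.
  move=> w _ /=; rewrite lee_fin [leRHS]ger0_norm ?addr_ge0//.
  have h1 : f w <= v w by rewrite /v le_max lexx.
  have h2 : v w <= f w \/ v w <= g w.
    rewrite /v; case: (leP (f w) (Num.min (u w) (g w))) => _; last by left.
    by right; rewrite ge_min lexx orbT.
  move: h1 h2 (ler_norm (f w)) (ler_norm (g w)) (normr_ge0 (f w)) (normr_ge0 (g w)) (ler_norm (- f w)).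
  rewrite normrN ler_norml => h1 h2 *; apply/andP; split; case: h2 => ?; lra.
apply/integrableP; split; first exact/measurable_EFinP.
have [_ vi] := integrableP _ _ _ Iv; apply: le_lt_trans vi.
rewrite le_eqVlt; apply/orP; left; apply/eqP; apply: ae_eq_integral => //.
- by apply: measurableT_comp => //; exact/measurable_EFinP.
- by apply: measurableT_comp => //; exact/measurable_EFinP.
- by apply: filterS vE => w /= -> _.
Qed.

Lemma integral_lne (lam u : Om -> R) : {ae m, forall w, 0 < lam w /\ ln (lam w) = u w} ->
  m.-integrable setT (EFin \o u) -> (\int[m]_w lne (lam w)%:E)%E = (\int[m]_w u w)%:E.
Proof.
move=> lu Iu; rewrite /Rintegral fineK; last exact: (integrable_fin_num measurableT Iu).
have e : ae_eq m setT (EFin \o u) (fun w => lne (lam w)%:E).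
  by apply: filterS lu => w [l0 e] _; rewrite lne_EFin// e.
have mu := measurable_int _ Iu.
apply/esym; apply: ae_eq_integral => //; exact: (ae_measurable_fun mc e mu).
Qed.

End CompleteMeasurability.

Section Multipliers.
Context {R : realType} {d : measure_display} {Om : measurableType d} (m : probability Om R)
  (S : system R Om).
Hypothesis hS : random_open_map m S.
Hypothesis hphi : strongly_contracting m S.
Variables (q : Om -> R -> R) (nu : Om -> probability (measurableTypeR R) R).
Hypothesis hq : equivariant_density m S q.
Hypothesis hnu : conformal_measure m S nu.
Implicit Types (w : Om) (n : nat) (f h : R -> R).
Local Notation a := (lo S).
Local Notation b := (hi S).
Local Notation I := (dom S).
Local Notation s := (sigma S).
Local Notation sV := (sigmaV S).
Local Notation orb := (orb s sV).
Local Notation BV := (inBV a b).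
Local Notation ab := (rm_ab hS).
Local Notation coc := (coc a b).
Local Notation sK := (sK hS).
Local Notation sVK := (sVK hS).
Local Notation mI := (I_meas a b).
Local Notation E w f := (\int[nu w]_(x in I) f x).
Local Notation mc := (rom_complete hS).

(** The conformal integral of a function of finitely many labels is a limit of
ratios that depend on finitely many labels; the constant added to the function
puts it into the cone on which these limits are given. *)
Lemma E_meas (T : countType) (W : Om -> T) (F : Om -> R -> R) : fibred W ->
  (forall w w', W w = W w' -> F w = F w') -> {ae m, forall w, BV (F w)} ->
  measurable_fun setT (fun w => E w (F w)).
Proof.
move=> fW FE bF.
pose K w := var a b (F w) + norm_oo a b (F w) + 1.
pose u n w := Einf I (transfer_n S n w (fun x => F w x + K w)) / Einf I (transfer_n S n w (cst 1)) - K w.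
apply: (ae_cvg_meas mc (u := u)) => [n|].
  have fp := fibred_pair (fibred_word hS n) fW.
  apply: (fibred_dep fp) => w w' [e1 e2].
  by rewrite /u /K (word_transfer e1) (FE _ _ e2).
apply: filterS2 hnu bF => w [h1 h2 h3 _] bf.
have V0 : 0 <= var a b (F w) := var_ge0 ab _.
have bk : BV (fun x => F w x + K w) := BV_add ab bf (BV_cst ab (K w)).
have N := BV_norm_oo ab bf.
have lo1 : coc (fun x => var a b (F w) + 1 <= F w x + K w).
  apply: coc_sub N => x _; rewrite ler_norml => /andP[h _].
  by rewrite /K; move: h; move: (var a b (F w)) (norm_oo a b (F w)) (F w x) => *; lra.
have ck : cone a b 1 (fun x => F w x + K w).
  split=> //.
    apply: coc_ae; apply: coc_sub lo1 => x _; apply: lt_le_trans.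
    by rewrite ltr_wpDl.
  rewrite mul1r; have e1 := le_Einf ab bk lo1; apply: le_trans (le_trans _ e1).
    by apply: le_trans (var_add ab bf (BV_cst ab (K w))) _; rewrite (var_cst ab) addr0.
  by rewrite lerDl.
have := h3 _ ck.
have -> : E w (fun x => F w x + K w) = E w (F w) + K w.
  by rewrite (RintegralD mI (BV_int ab _ bf) (BV_int ab _ (BV_cst ab (K w)))) (E_cst h1).
move=> c; rewrite -[X in _ --> X](addrK (K w)); apply: cvgB c _; exact: cvg_cst.
Qed.

Lemma lam_plus_meas : measurable_fun setT (lam_plus S nu).
Proof.
pose F w := transfer S (sV w) (cst 1).
have -> : lam_plus S nu = (fun w => E w (F w)) \o s by apply/funext => w /=; rewrite /F sK.
apply: measurableT_comp (ms hS).
apply: (E_meas (fibred_comp (msV hS) (fibred_label hS))) => [w w' e|].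
  by rewrite /F (transfer_label e).
apply: filterS (ae_good_orbit hS hphi) => w gw; apply: (tr_BV hS); last exact: BV_cst ab 1.
exact: (gw (-1)).
Qed.

Section Gamma.
Variable gamma : R.
Hypothesis g01 : 0 < gamma < 1.
Hypothesis gc : \int[m]_w lnc S w < ln gamma.
Local Notation regular := (regular S q nu gamma).

Let aereg := ae_regular hS hphi hq hnu g01 gc.

(** q is a uniform limit of functions that depend on finitely many labels of the past,
to which [E_meas] applies. *)
Lemma E_q_meas : measurable_fun setT (fun w => E w (q w)).
Proof.
pose F n w x := transfer_n S n (past S n w) (cst 1) x / Einf I (transfer_n S n (past S n w) (cst 1)).
have bF n w : regular w -> BV (F n w).
  move=> [nw _ _]; have b1 := trn_BV hS n (nice_good (nice_past hS n nw)) (BV_cst ab 1).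
  have := BV_scale ab (Einf I (transfer_n S n (past S n w) (cst 1)))^-1 b1.
  by congr inBV; apply/funext => x; rewrite /F mulrC.
apply: (ae_cvg_meas mc (u := fun n w => E w (F n w))) => [n|].
  apply: (E_meas (fibred_comp (iter_meas n (msV hS)) (fibred_word hS n))) => [w w' /= e|].
    by rewrite /F (word_transfer e).
  by apply: filterS aereg => w rw; exact: bF.
apply: filterS2 aereg hq => w rw [bq cq _].
have [_ cw _] := rw; have [h1 h2 _ _] := conf_at cw.
apply/cvgrPdist_le => e e0; near=> n.
have bn := bF n _ rw; have bd : BV (fun x => F n w x - q w x) := BV_sub ab bn bq.
have ne : norm_oo a b (fun x => F n w x - q w x) <= e.
  near: n; move/cvgrPdist_le: cq => /(_ e e0); apply: filterS => n.
  by rewrite sub0r normrN; exact: le_trans (ler_norm _).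
have Id := BV_int ab (nu w) bd; have Ic c := BV_int ab (nu w) (BV_cst ab c).
rewrite distrC -(RintegralB mI (BV_int ab _ bn) (BV_int ab _ bq)).
have N : coc (fun x => - e <= F n w x - q w x <= e).
  by apply: coc_sub (BV_norm_oo ab bd) => x _ /le_trans/(_ ne); rewrite ler_norml.
rewrite ler_norml; apply/andP; split.
  rewrite -[leLHS](E_cst h1 (- e)); apply: (E_mono h2) => //.
  by apply: coc_sub N => x _ /andP[].
rewrite -[leRHS](E_cst h1 e); apply: (E_mono h2) => //.
by apply: coc_sub N => x _ /andP[].
Unshelve. all: by end_near. Qed.

(** Integrating L q = lam_minus q with respect to the conformal measure at sigma w
gives lam_plus nu_w(q) = lam_minus nu_(sigma w)(q). *)
Lemma multipliers w : regular w ->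
  ln (lam_minus S q w) = ln (lam_plus S nu w) + (ln (E w (q w)) - ln (E (s w) (q (s w)))) /\
  [/\ 0 < lam_minus S q w, ln (Einf I (g_ S w)) <= ln (lam_minus S q w),
     ln (Einf I (g_ S w)) <= ln (lam_plus S nu w) &
     ln (lam_plus S nu w) <= ln (card_Z S w)%:R + ln (norm_oo a b (g_ S w))].
Proof.
move=> rw; have r1 := regular_future hS 1 rw; have [nw cw dw] := rw.
have [h1 h2 h3 gw] := conf_at cw.
have [k1 e1 c1] := dens_at dw; have bq := kcone_BV k1.
have [nw1 cw1 dw1] := r1; have [k2 e2 _] := dens_at dw1; have bq1 := kcone_BV k2.
have [h1' h2' _ _] := conf_at cw1.
have G0 := Einf_g_gt0 gw; have lp := lam_plus_gt0 hS cw.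
have E1 : 1 <= E w (q w) := E_q_ge1 hS rw.
have E2 : 1 <= E (s w) (q (s w)) := E_q_ge1 hS r1.
have q0 : coc (fun x => 0 <= q w x).
  by apply: coc_sub (q_bnd hS g01 nw (dens_at dw)) => x _ /andP[/(le_trans ler01)].
have lmG : Einf I (g_ S w) <= lam_minus S q w.
  by have := tr_Einf hS gw bq q0; rewrite e1 mulr1.
have lm : 0 < lam_minus S q w := lt_le_trans G0 lmG.
have eqE : lam_minus S q w * E (s w) (q (s w)) = lam_plus S nu w * E w (q w).
  rewrite -(h3 _ bq) -(RintegralZl _ mI (BV_int ab _ bq1)).
  apply: (E_eq h2') => [||].
  - exact: intZ (BV_int ab _ bq1).
  - exact: BV_int ab _ _ (tr_BV hS gw bq).
  - by apply: coc_sub c1 => x _ ->.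
have b1 := BV_cst ab 1; have bt := tr_BV hS gw b1.
have lpG : Einf I (g_ S w) <= lam_plus S nu w.
  apply: le_trans (E_Einf ab h1' h2' bt).
  by have := tr_Einf hS gw b1 (cocW (fun _ _ => ler01)); rewrite (Einf_cst ab) mulr1.
have zn : 0 < (card_Z S w)%:R * norm_oo a b (g_ S w).
  by apply: mulr_gt0 (norm_g_gt0 hS gw); rewrite ltr0n; have /andP[/leq_trans] := bf_card hS gw; apply.
have lpU : lam_plus S nu w <= (card_Z S w)%:R * norm_oo a b (g_ S w).
  have J1 := BV_int ab (nu (future S 1 w)) bt.
  have J2 := BV_int ab (nu (future S 1 w)) (BV_cst ab ((card_Z S w)%:R * norm_oo a b (g_ S w))).
  rewrite -(E_cst h1' (_ * _)); apply: (E_mono h2' J1 J2).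
  by have := tr_upper hS gw ler01 (cocW (fun _ _ => lexx 1)); rewrite mul1r.
split.
  have : ln (lam_minus S q w * E (s w) (q (s w))) = ln (lam_plus S nu w * E w (q w)) by rewrite eqE.
  have p1 := lt_le_trans ltr01 E1; have p2 := lt_le_trans ltr01 E2.
  rewrite !lnM ?posrE// => e; rewrite addrA -e; ring.
split=> //; rewrite ?ler_ln ?posrE//.
rewrite -lnM ?posrE ?(norm_g_gt0 hS gw)//.
  by rewrite ler_ln ?posrE.
by rewrite ltr0n; have /andP[/leq_trans] := bf_card hS gw; apply.
Qed.

(** By [multipliers] the logarithms of the two multipliers differ by the coboundary of
log nu(q), which is bounded below by an integrable function. *)
Lemma exponents_eq : exists Lambda1 : R,
    (\int[m]_w lne (lam_plus S nu w)%:E)%E = Lambda1%:E /\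
    (\int[m]_w lne (lam_minus S q w)%:E)%E = Lambda1%:E.
Proof.
pose psi w := ln (E w (q w)); pose Lp w := ln (lam_plus S nu w).
have [J1 J2 J3 _ _] := hphi.
have mpsi : measurable_fun setT psi by apply: measurableT_comp E_q_meas; exact: measurable_ln.
have mLp : measurable_fun setT Lp by apply: measurableT_comp lam_plus_meas; exact: measurable_ln.
have K1 : m.-integrable setT (EFin \o (fun w => ln (card_Z S w)%:R)).
  exact: (integrable_lne hS (G := fun j => (#|` fset_set (partX S j)|%N)%:R)) J1.
have K2 : m.-integrable setT (EFin \o (fun w => ln (norm_oo a b (g_ S w)))).
  exact: (integrable_lne hS (G := fun j => norm_oo a b (weight S j))) J2.
have K3 : m.-integrable setT (EFin \o (fun w => ln (Einf I (g_ S w)))).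
  exact: (integrable_lne hS (G := fun j => Einf I (weight S j))) J3.

have rI : m.-integrable setT (EFin \o (fun w => ln (card_Z S w)%:R + ln (norm_oo a b (g_ S w)))).
  exact: (integrableD measurableT K1 K2).
have ILp : m.-integrable setT (EFin \o Lp).
  by apply: (integrable_between K3 rI mLp); apply: filterS aereg => w /multipliers[_ [_ _ -> ->]].
have LG : m.-integrable setT (EFin \o (fun w => Lp w - ln (Einf I (g_ S w)))).
  exact: (integrableB measurableT ILp K3).
have Ineg : m.-integrable setT (EFin \o (fun w => Num.max (- (psi w - psi (s w))) 0)).
  have I0 : m.-integrable setT (EFin \o (fun=> 0 : R)) by exact: integrable0.
  apply: (integrable_between I0 LG).
    apply: measurable_maxr => //; apply: measurableT_comp => //; apply: measurable_funB => //.
    exact: measurableT_comp mpsi (ms hS).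
  apply: filterS aereg => w /multipliers[e [_ h1 h2 _]].
  rewrite le_max lexx orbT /= ge_max subr_ge0 h2 andbT; move: h1; rewrite e -/(Lp w) -/(psi w) -/(psi (s w)).
  by move=> *; lra.
have [Ipsi psi0] := coboundary (ms hS) (minv hS) mpsi Ineg.
exists (\int[m]_w Lp w); split.
  by apply: (integral_lne mc _ ILp); apply: filterS aereg => w [_ cw _]; split=> //; exact: (lam_plus_gt0 hS cw).
have ILm : m.-integrable setT (EFin \o (fun w => Lp w + (psi w - psi (s w)))).
  exact: (integrableD measurableT ILp Ipsi).
have <- : \int[m]_w (Lp w + (psi w - psi (s w))) = \int[m]_w Lp w.
  by rewrite (RintegralD measurableT ILp Ipsi) psi0 addr0.
by apply: (integral_lne mc _ ILm); apply: filterS aereg => w /multipliers[e [h _ _ _]].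
Qed.

End Gamma.
End Multipliers.

Theorem theorem6p1 (R : realType) (d : measure_display)
    (Om : measurableType d) (m : probability Om R) (S : system R Om)
    (hS : random_open_map m S) (hphi : strongly_contracting m S)
    (q : Om -> R -> R) (nu : Om -> probability (measurableTypeR R) R)
    (hq : equivariant_density m S q) (hnu : conformal_measure m S nu) :
  (exists Lambda1 : R,
    (\int[m]_w lne (lam_plus S nu w)%:E)%E = Lambda1%:E /\
    (\int[m]_w lne (lam_minus S q w)%:E)%E = Lambda1%:E) /\
  exists mu : Om -> probability (measurableTypeR R) R,
    [/\ equilibrium_measure m S q nu mu,
        equivariant_measure m S mu,
        exists (C : Om -> R) (r : R),
          [/\ forall w, 0 < C w, tempered m S C, 0 < r < 1
            & correlation_decay m S nu mu C r]
      & forall gamma theta : R, contraction_rate m S gamma theta ->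
          forall r : R, theta < r ->
          exists C : Om -> R,
            [/\ forall w, 0 < C w, tempered m S C
              & correlation_decay m S nu mu C r]].
Proof.
have neg := lnc_integral_lt0 hS hphi.
(* Any number between the exponential of the integral and 1 would do. *)
pose gamma0 : R := expR ((\int[m]_w lnc S w) / 2).
have g01 : 0 < gamma0 < 1 by rewrite expR_gt0 expR_lt1 ltr_pdivrMr// mul0r.
have gc : \int[m]_w lnc S w < ln gamma0 by rewrite expRK; move: neg; set x := \int[m]_w _ => ?; lra.
split; first exact: (exponents_eq hS hphi hq hnu g01 gc).
exists (equi S q nu); split.
- exact: (equi_equilibrium hS hphi hq hnu g01 gc).
- exact: (equi_equivariant hS hphi hq hnu g01 gc).
- have [theta [t01 ct]] := contracts_visits hS hphi g01 gc.
  have [t0 t1] := andP t01.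
  have tr : theta < (1 + theta) / 2 by lra.
  have [C [C0 tC dC]] := decay hS hphi hq hnu g01 gc t01 ct tr.
  by exists C, ((1 + theta) / 2); split=> //; lra.
move=> gamma theta [h01 hc t01 hk] r tr.
have hc' : \int[m]_w lnc S w < ln gamma.
  move: hc; rewrite (lnc_integral hS hphi) lne_EFin ?lte_fin//.
  by case/andP: h01.
exact: (decay hS hphi hq hnu h01 hc' t01 (contracts_rate hS hphi h01 hc' t01 (hk 0%N)) tr).
Qed.
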